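(* (i) For every integer $M\ge 1$, every tile $A\subset\mathbb{Z}_M$ is spectral, and every finite tile $A\subset\mathbb{Z}$ is spectral. (ii) Every bounded measurable set $F\subset\mathbb{R}$ of finite positive Lebesgue measure that tiles $\mathbb{R}$ by translations is spectral.
   Context: $\mathbb{Z}_M=\mathbb{Z}/M\mathbb{Z}$. For $G=\mathbb{Z}_M$ or $G=\mathbb{Z}$, a finite nonempty set $A\subset G$ is a tile of $G$ if there is $T\subset G$ such that every element of $G$ has a unique representation $a+t$ with $a\in A$, $t\in T$. A measurable set $F\subset\mathbb{R}$ tiles $\mathbb{R}$ by translations if there is a set $T\subset\mathbb{R}$ such that the translates $F+t$, $t\in T$, are pairwise disjoint up to Lebesgue null sets and cover $\mathbb{R}$ up to a Lebesgue null set. A finite subset of an abelian group is spectral if the restrictions to it of some characters of the group (homomorphisms to the unit circle) form an orthogonal basis for the complex-valued functions on that subset. A measurable set $F\subset\mathbb{R}$ of finite positive measure is spectral if $L^2(F)$ has an orthogonal basis consisting of exponential functions $x\mapsto e^{2\pi i\lambda x}$, $\lambda\in\mathbb{R}$. *)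

(* Defs.v *)
From HB Require Import structures.
From mathcomp Require Import all_boot all_order all_algebra finmap.
From mathcomp Require Import all_classical all_reals all_analysis.
From mathcomp Require Import complex.
Set Implicit Arguments.
Unset Strict Implicit.
Unset Printing Implicit Defensive.
Import Order.TTheory GRing.Theory Num.Theory numFieldNormedType.Exports.
Local Open Scope classical_set_scope.
Local Open Scope complex_scope.
Local Open Scope ring_scope.

Definition group_tile (G : zmodType) (A : {fset G}) : Prop :=
  A != fset0 /\
  exists T : set G,
    forall x : G, exists! p : G * G, [/\ p.1 \in A, T p.2 & p.1 + p.2 = x].

Definition is_character (R : realType) (G : zmodType) (chi : G -> R[i]) : Prop :=
  (forall x y, chi (x + y) = chi x * chi y) /\ (forall x, `|chi x| = 1).

(* Being a basis is the existence and uniqueness of coordinates. *)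
Definition group_spectral (R : realType) (G : zmodType) (A : {fset G}) : Prop :=
  exists (n : nat) (chi : 'I_n -> G -> R[i]),
    [/\ forall i, is_character (chi i),
        forall i j, i != j -> \sum_(a <- A) chi i a * (chi j a)^* = 0 &
        forall f : G -> R[i], exists! c : {ffun 'I_n -> R[i]},
          forall a, a \in A -> f a = \sum_(i < n) c i * chi i a].

(* [lebesgueT R] is R with the sigma-algebra of Lebesgue (Caratheodory)
   measurable sets, the domain of [completed_lebesgue_measure]; the default
   structure on R only has the Borel sets. *)
Notation lebesgueT R := (caratheodory_type (wlength (@idfun R))^*%mu).

Definition lebesgue_measurable (R : realType) (F : set R) : Prop :=
  measurable (F : set (lebesgueT R)).

Definition real_tile (R : realType) (F : set R) : Prop :=
  exists T : set R,
    (forall t u, T t -> T u -> t != u ->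
       (@completed_lebesgue_measure R).-negligible
         ([set x + t | x in F] `&` [set x + u | x in F])) /\
    (@completed_lebesgue_measure R).-negligible
      (~` \bigcup_(t in T) [set x + t | x in F]).

Definition expi (R : realType) (l x : R) : R[i] :=
  cos (2 * pi * l * x) +i* sin (2 * pi * l * x).

Definition L2norm_sq (R : realType) (F : set R) (f : R -> R[i]) : \bar R :=
  (\int[@completed_lebesgue_measure R]_(x in F)
     (complex.Re (f x) ^+ 2 + complex.Im (f x) ^+ 2)%:E)%E.

Definition in_L2 (R : realType) (F : set R) (f : R -> R[i]) : Prop :=
  [/\ measurable_fun (F : set (lebesgueT R)) (fun x => complex.Re (f x)),
      measurable_fun (F : set (lebesgueT R)) (fun x => complex.Im (f x)) &
      (L2norm_sq F f < +oo)%E].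

Definition L2dot (R : realType) (F : set R) (f g : R -> R[i]) : R[i] :=
  Rintegral (@completed_lebesgue_measure R) F
    (fun x => complex.Re (f x * (g x)^*))
  +i* Rintegral (@completed_lebesgue_measure R) F
    (fun x => complex.Im (f x * (g x)^*)).

(* An orthogonal basis of the Hilbert space L^2(F) is an orthogonal system with
   dense linear span. When F has positive measure, no exponential vanishes in
   L^2(F). *)
Definition real_spectral (R : realType) (F : set R) : Prop :=
  exists L : set R,
    (forall l m, L l -> L m -> l != m -> L2dot F (expi l) (expi m) = 0) /\
    (forall f, in_L2 F f -> forall e : R, 0 < e ->
       exists (s : seq R) (c : R -> R[i]),
         (forall l, l \in s -> L l) /\
         (L2norm_sq F (fun x => f x - \sum_(l <- s) c l * expi l x)%R < e%:E)%E).

(* Main.v *)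
(* Write A (+) B = Z/M and let M = p^(n+1) m with p prime and p not dividing m. If
   some residue class modulo p^n contains a number of elements of A that is
   prime to p, then A tiles Z/(M/p) with every "slab" of B, obtained by choosing
   one value of the n-th base p digit for each class modulo p^n. This is proved
   in the group ring F_p[Z/M], where Frobenius relates A to its multiples by
   powers of p. One of A and B always has such a class, and slicing either A or B
   in this way yields by induction a set Lam that is a spectrum of every
   complement of B. Tilings of Z by finite sets are periodic by the pigeonhole
   principle.

   On the line, let g be the distribution function of the tile F. Where g has
   slope nearly 1, only one translate contributes to the local density of a
   tiling, so if two tilings are close, the conserved "flux" between them
   determines the local deviation. Hence nearby tilings of a long window agree
   in its middle, and the pigeonhole principle makes the tiling periodic, by B
   + N Z say. Tijdeman's argument shows that q^j B + N Z also tiles with F, for q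
   prime to the size of B; two of these tilings are close, hence equal, so the
   differences of B are rational multiples of N. Then F splits into fibers that
   tile a fixed cyclic group with a fixed complement, and a universal spectrum
   Lam of this complement gives the spectrum (Lam + Q Z) / N of F. *)

Require Import Defs.
From HB Require Import structures.
From mathcomp Require Import all_boot all_order all_algebra cyclic finmap.
From mathcomp Require Import all_classical all_reals all_analysis.
From mathcomp Require Import measurable_realfun.
From mathcomp Require Import complex.
From mathcomp Require Import zify ring lra.
Set Implicit Arguments.
Unset Strict Implicit.
Unset Printing Implicit Defensive.
Import Order.TTheory GRing.Theory Num.Theory numFieldNormedType.Exports.
Local Open Scope ring_scope.

(** * Group rings over finite groups *)

(** The slab claim compares the all-ones function with the product of [A], the slab and the subgroup
    of order [p]. The difference is the constant given by the product over the classes [c] of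
    [1 - |A_c| ^ (q - 1)], which vanishes in characteristic [p] once one class size is prime to [p].
    A spectrum that serves all complements at once is needed because the fibers of a tile of the
    line vary from point to point. The flux across a point is the mass gained on its left when one
    tiling is moved to the other; it is the same at all points because both have density one, so no
    deviation can be absorbed elsewhere. Powers of [q] enter because infinitely many multiples of
    finitely many translates, reduced modulo [N], contain two close ones. Orthogonality on the line
    reduces to the fibers and to integrals over one period. For completeness, the spectrum is
    invariant under translation by [1 / u], so bounded [u]-periodic Borel functions multiply the
    closed span of the exponentials into itself; expanding an indicator along the fibers has such
    functions as coefficients. *)

Section GroupRing.
Variables (F : comNzRingType) (G : finZmodType).

Definition gring := {ffun G -> F}.
HB.instance Definition _ := GRing.Zmodule.copy gring {ffun G -> F}.

Implicit Types f g h : gring.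

Definition gdelta (a : G) : gring := [ffun x => (x == a)%:R].
Definition gmul f g : gring := [ffun x => \sum_y f y * g (x - y)].

Let gmulA : associative gmul.
Proof.
move=> f g h; apply/ffunP => x; rewrite !ffunE.
under eq_bigr => y _ do rewrite ffunE big_distrr /=.
under [RHS]eq_bigr => y _ do rewrite ffunE big_distrl /=.
rewrite [RHS]exchange_big /=; apply: eq_bigr => y _.
rewrite [RHS](reindex (fun z => z + y)) /=; last first.
  by exists (fun z => z - y) => z _; rewrite ?addrK ?subrK.
by apply: eq_bigr => z _; rewrite mulrA addrK opprD addrA addrAC.
Qed.

Let gmulC : commutative gmul.
Proof.
move=> f g; apply/ffunP => x; rewrite !ffunE.
rewrite [LHS](reindex (fun y => x - y)) /=; last first.
  by exists (fun y => x - y) => y _; rewrite opprB addrC subrK.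
by apply: eq_bigr => y _; rewrite mulrC opprB addrC subrK.
Qed.

Let gmul1 : left_id (gdelta 0) gmul.
Proof.
move=> f; apply/ffunP => x; rewrite !ffunE (bigD1 0) //= ffunE eqxx mul1r subr0.
by rewrite big1 ?addr0 // => y /negPf y0; rewrite ffunE y0 mul0r.
Qed.

Let gmulDl : left_distributive gmul +%R.
Proof.
move=> f g h; apply/ffunP => x; rewrite !ffunE -big_split /=.
by apply: eq_bigr => y _; rewrite ffunE mulrDl.
Qed.

Let gone_neq0 : gdelta 0 != 0 :> gring.
Proof.
by apply/eqP => /ffunP/(_ 0); rewrite !ffunE eqxx => /eqP; rewrite oner_eq0.
Qed.

HB.instance Definition _ :=
  GRing.Zmodule_isComNzRing.Build gring gmulA gmulC gmul1 gmulDl gone_neq0.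

Lemma gringM f g x : (f * g) x = \sum_y f y * g (x - y).
Proof. by rewrite ffunE. Qed.

Lemma gdelta0 : gdelta 0 = 1. Proof. by []. Qed.

Lemma gdeltaMl a f x : (gdelta a * f) x = f (x - a).
Proof.
rewrite gringM (bigD1 a) //= ffunE eqxx mul1r big1 ?addr0 // => y /negPf ya.
by rewrite ffunE ya mul0r.
Qed.

Lemma gdeltaD a b : gdelta (a + b) = gdelta a * gdelta b.
Proof. by apply/ffunP => x; rewrite gdeltaMl !ffunE subr_eq addrC. Qed.

Lemma gdeltaX a n : gdelta a ^+ n = gdelta (a *+ n).
Proof.
by elim: n => [|n IH]; rewrite ?mulr0n // exprS IH -gdeltaD mulrS.
Qed.

Definition gall : gring := [ffun=> 1].
Definition gaug f : F := \sum_x f x.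

Lemma gmul_all f : f * gall = [ffun=> gaug f].
Proof.
by apply/ffunP => x; rewrite gringM ffunE; apply: eq_bigr => y _; rewrite ffunE mulr1.
Qed.

Lemma gaugM f g : gaug (f * g) = gaug f * gaug g.
Proof.
rewrite /gaug; under eq_bigr => x _ do rewrite gringM.
rewrite exchange_big /= big_distrl; apply: eq_bigr => y _ /=.
rewrite -big_distrr /=; congr (_ * _).
rewrite (reindex (fun z => z + y)) /=; last first.
  by exists (fun z => z - y) => z _; rewrite ?addrK ?subrK.
by apply: eq_bigr => z _; rewrite addrK.
Qed.

Lemma gaug1 : gaug 1 = 1.
Proof.
rewrite /gaug (bigD1 0) //= ffunE eqxx big1 ?addr0 // => x /negPf x0.
by rewrite ffunE x0.
Qed.

Lemma gaugB f g : gaug (f - g) = gaug f - gaug g.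
Proof.
rewrite /gaug -sumrB; apply: eq_bigr => x _.
by rewrite !ffunE.
Qed.

Lemma gaugX f n : gaug (f ^+ n) = gaug f ^+ n.
Proof. by elim: n => [|n IH]; rewrite ?gaug1 // !exprS gaugM IH. Qed.

Lemma gaug_prod I (r : seq I) (P : pred I) (E : I -> gring) :
  gaug (\prod_(i <- r | P i) E i) = \prod_(i <- r | P i) gaug (E i).
Proof. exact: (big_morph gaug gaugM gaug1). Qed.

Lemma gaug_delta a : gaug (gdelta a) = 1.
Proof.
rewrite /gaug (bigD1 a) //= ffunE eqxx big1 ?addr0 // => x /negPf x0.
by rewrite ffunE x0.
Qed.

Lemma gaug_sum I (r : seq I) (P : pred I) (E : I -> gring) :
  gaug (\sum_(i <- r | P i) E i) = \sum_(i <- r | P i) gaug (E i).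
Proof.
apply: (big_morph gaug) => [f g|].
  by rewrite /gaug -big_split; apply: eq_bigr => x _; rewrite !ffunE.
by rewrite /gaug big1 // => x _; rewrite ffunE.
Qed.

Lemma gaug1BX f n : gaug (1 - f ^+ n) = 1 - gaug f ^+ n.
Proof. by rewrite gaugB gaug1 gaugX. Qed.

Definition gres (P : pred G) f : gring := [ffun x => if P x then f x else 0].

Lemma gresB P f g : gres P (f - g) = gres P f - gres P g.
Proof. by apply/ffunP => x; rewrite !ffunE; case: ifP; rewrite ?subr0. Qed.

(** Translations by elements of the support of [f] preserve [P]. The case of interest has [f]
    supported on multiples of [p ^ n.+1] and [P] a digit condition. *)
Lemma gresM P f g :
  (forall y, f y != 0 -> forall x, P (x - y) = P x) ->
  gres P (f * g) = f * gres P g.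
Proof.
move=> Pf; apply/ffunP => x; rewrite gringM ffunE.
case: ifPn => Px; rewrite ?gringM; last first.
  rewrite big1 // => y _; rewrite ffunE.
  have [->|fy] := eqVneq (f y) 0; first by rewrite mul0r.
  by rewrite Pf // (negPf Px) mulr0.
apply: eq_bigr => y _; rewrite ffunE.
have [->|fy] := eqVneq (f y) 0; first by rewrite !mul0r.
by rewrite Pf // Px.
Qed.

End GroupRing.

Lemma gring_pchar p (G : finZmodType) : prime p -> p \in [pchar (gring 'F_p G)].
Proof.
move=> pp; rewrite inE pp /=.
rewrite -gdelta0; apply/eqP/ffunP => x; rewrite ffunMnE !ffunE.
rewrite -mulrnA mulnC mulrnA; have := pchar_Fp pp; rewrite inE pp /= => /eqP ->.
by rewrite mul0rn.
Qed.

Lemma gring_pexp_sum p (G : finZmodType) I (r : seq I) (E : I -> gring 'F_p G) N :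
  prime p -> (\sum_(i <- r) E i) ^+ (p ^ N)%N = \sum_(i <- r) E i ^+ (p ^ N)%N.
Proof.
move=> pp; have pch := gring_pchar G pp.
elim: N => [|N IH]; first by rewrite expn0 expr1; apply: eq_bigr => i _; rewrite expr1.
rewrite expnS mulnC exprM IH -(pFrobenius_autE pch) rmorph_sum /=.
by apply: eq_bigr => i _; rewrite pFrobenius_autE exprM.
Qed.

(** * Tilings of cyclic groups *)

(* [Z/M] is the direct sum of [A] and [B], given by representatives that need
   not be smaller than [M]. *)
Definition tilem (M : nat) (A B : seq nat) : Prop :=
  [/\ (size A * size B = M)%N, uniq A, uniq B &
      forall a a' b b', a \in A -> a' \in A -> b \in B -> b' \in B ->
        (a + b = a' + b' %[mod M])%N -> a = a' /\ b = b'].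

Lemma uniq_map_inj (T1 T2 : eqType) (f : T1 -> T2) (s : seq T1) :
  uniq (map f s) -> {in s &, injective f}.
Proof.
elim: s => [|x s IH] //= /andP[nfx us] y z; rewrite !inE.
move=> /orP[/eqP->|ys] /orP[/eqP->|zs] // e.
- by rewrite e map_f in nfx.
- by rewrite -e map_f in nfx.
- exact: IH.
Qed.

Lemma tilem_sym M A B : tilem M A B -> tilem M B A.
Proof.
move=> [sM uA uB inj]; split => //; first by rewrite mulnC.
move=> b b' a a' hb hb' ha ha'; rewrite addnC [(b' + _)%N]addnC => /inj.
by move=> /(_ ha ha' hb hb') [].
Qed.

Lemma tilem_res M A B : tilem M A B ->
  uniq [seq ((a + b) %% M)%N | a <- A, b <- B].
Proof.
move=> [_ uA uB inj]; apply: allpairs_uniq => // -[a b] [a' b'].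
move=> /allpairsP[[x y] /= [hx hy [-> ->]]] /allpairsP[[x' y'] /= [hx' hy' [-> ->]]] e.
by have [-> ->] := inj _ _ _ _ hx hx' hy hy' e.
Qed.

Lemma tilem_cover M A B (z : nat) : (0 < M)%N -> tilem M A B ->
  exists a b, [/\ a \in A, b \in B & (a + b = z %[mod M])%N].
Proof.
move=> M0 tAB; have u := tilem_res tAB; have [sM _ _ _] := tAB.
set s := [seq _ | _ <- _, _ <- _] in u.
have sub : {subset s <= iota 0 M}.
  by move=> x /allpairsP[[a b] /= [_ _ ->]]; rewrite mem_iota /= add0n ltn_mod.
have ss : (size (iota 0 M) <= size s)%N by rewrite size_iota size_allpairs sM.
have [_ eqs] := uniq_min_size u sub ss.
have : (z %% M)%N \in s by rewrite eqs mem_iota /= add0n ltn_mod.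
by move=> /allpairsP[[a b] /= [ha hb e]]; exists a, b; split => //; rewrite -e.
Qed.

(** Pigeonhole: at most [M] sums hit all [M] residues, so no two of them coincide. *)
Lemma cover_tilem M A B : (0 < M)%N -> uniq A -> uniq B ->
  (size A * size B <= M)%N ->
  (forall z, (z < M)%N -> exists a b, [/\ a \in A, b \in B & (a + b = z %[mod M])%N]) ->
  tilem M A B.
Proof.
move=> M0 uA uB sM cov.
pose P := [seq (a, b) | a <- A, b <- B].
pose f (x : nat * nat) := ((x.1 + x.2) %% M)%N.
have sub : {subset iota 0 M <= map f P}.
  move=> z; rewrite mem_iota /= add0n => zM; have [a [b [ha hb e]]] := cov _ zM.
  apply/mapP; exists (a, b); first exact: allpairs_f.
  by rewrite /f /= e modn_small.
have sP : (size (map f P) <= size (iota 0 M))%N.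
  by rewrite size_map size_allpairs size_iota.
have uf : uniq (map f P) := leq_size_uniq (iota_uniq 0 M) sub sP.
have sE : size (map f P) = M.
  apply/eqP; rewrite eqn_leq -{1}(size_iota 0 M) sP /=.
  by rewrite -{1}(size_iota 0 M) uniq_leq_size ?iota_uniq.
split => //; first by move: sE; rewrite size_map size_allpairs.
move=> a a' b b' ha ha' hb hb' e.
have := uniq_map_inj uf (allpairs_f pair ha hb) (allpairs_f pair ha' hb').
by rewrite /f /= => /(_ e) [-> ->].
Qed.

Section GSum.
Variables (p m : nat).
Local Notation R := (gring 'F_p 'I_m.+1).

Definition gsum (s : seq nat) : R := \sum_(a <- s) gdelta _ (inZp a).

Lemma inZpD a b : inZp (a + b) = inZp a + inZp b :> 'I_m.+1.
Proof. by apply/val_inj; rewrite /= modnDm. Qed.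

Lemma inZpMn a k : inZp (a * k) = inZp a *+ k :> 'I_m.+1.
Proof.
elim: k => [|k IH]; first by rewrite muln0 mulr0n; apply/val_inj; rewrite /= mod0n.
by rewrite mulnS inZpD IH mulrS.
Qed.

Lemma inZp_eqP a b : inZp a = inZp b :> 'I_m.+1 <-> (a = b %[mod m.+1])%N.
Proof. by split => [[]|e] //; apply/val_inj. Qed.

Lemma gsumM s t : gsum s * gsum t = gsum [seq (a + b)%N | a <- s, b <- t].
Proof.
rewrite /gsum big_distrl /= big_allpairs_dep; apply: eq_bigr => a _.
by rewrite big_distrr; apply: eq_bigr => b _; rewrite /= inZpD gdeltaD.
Qed.

Lemma gsum_neq0 s z : gsum s z != 0 -> exists2 a, a \in s & inZp a = z.
Proof.
move=> h; have [/hasP[a ha /eqP e]|/hasPn nh] := boolP (has (fun a => inZp a == z) s).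
  by exists a.
case/eqP: h; rewrite /gsum sum_ffunE big1_seq // => a /= /nh na.
by rewrite ffunE eq_sym (negPf na).
Qed.

Lemma gaug_gsum s : gaug (gsum s) = (size s)%:R.
Proof.
rewrite /gsum gaug_sum (eq_bigr (fun=> 1)) => [|a _]; last exact: gaug_delta.
by rewrite big_const_seq count_predT iter_addr_0.
Qed.

Lemma tilem_gsum A B : tilem m.+1 A B -> gsum A * gsum B = gall 'F_p 'I_m.+1.
Proof.
move=> tAB; rewrite gsumM; have u := tilem_res tAB; have [sM _ _ _] := tAB.
pose s : seq 'I_m.+1 := [seq inZp i | i <- [seq (a + b)%N | a <- A, b <- B]].
have us : uniq s.
  have e : map val s = [seq ((a + b) %% m.+1)%N | a <- A, b <- B].
    by rewrite /s -map_comp map_allpairs; apply: eq_allpairs.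
  by rewrite -(map_inj_uniq val_inj) e.
have cs : (#|'I_m.+1| <= size s)%N by rewrite card_ord size_map size_allpairs sM.
have es : perm_eq s (index_enum 'I_m.+1).
  rewrite uniq_perm ?index_enum_uniq // => x; rewrite mem_index_enum.
  have ss : {subset s <= enum 'I_m.+1} by move=> y _; rewrite mem_enum.
  have [|_ ->] := uniq_min_size us ss; first by rewrite -cardE.
  by rewrite mem_enum.
apply/ffunP => x; rewrite /gsum -(big_map inZp xpredT (fun i => gdelta _ i)) -/s.
rewrite (perm_big _ es) /= sum_ffunE !ffunE (bigD1 x) //= ffunE eqxx big1 ?addr0 //.
by move=> y /negPf yx; rewrite ffunE eq_sym yx.
Qed.

(** A coefficient that is nonzero modulo [p] still shows that its residue is a sum; the
    multiplicities that reduction modulo [p] forgets are recovered from the sizes. *)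
Lemma gsum_tilem A B : uniq A -> uniq B -> (size A * size B <= m.+1)%N ->
  (forall z, (gsum A * gsum B) z != 0) -> tilem m.+1 A B.
Proof.
move=> uA uB sM nz; apply: cover_tilem => // z zm.
have := nz (inZp z); rewrite gsumM => /gsum_neq0[x /allpairsP[[a b] /= [ha hb ->]]].
by move=> /inZp_eqP e; exists a, b.
Qed.

Hypothesis pp : prime p.

Lemma gsum_pexp s N : gsum s ^+ (p ^ N)%N = gsum [seq (p ^ N * a)%N | a <- s].
Proof.
rewrite /gsum gring_pexp_sum // big_map; apply: eq_bigr => a _.
by rewrite gdeltaX mulnC inZpMn.
Qed.

Lemma gsum_p s : gsum s ^+ p = gsum [seq (p * a)%N | a <- s].
Proof. by have := gsum_pexp s 1; rewrite !expn1. Qed.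

End GSum.

Lemma natr_Fp_neq0 p n : prime p -> ~~ (p %| n)%N -> n%:R != 0 :> 'F_p.
Proof. by move=> pp; apply: contra; rewrite (dvdn_pcharf (pchar_Fp pp)). Qed.

(* Tijdeman: in [F_q[Z/M]] the set [q A] is represented by [A ^+ q], and
   [A ^+ q * B = A ^+ q.-1 * gall] is a nonzero constant, so [q A + B] covers. *)
Lemma tilem_mulp M q A B : prime q -> ~~ (q %| size A)%N -> (0 < M)%N ->
  tilem M A B -> tilem M [seq (q * a)%N | a <- A] B.
Proof.
case: M => [|m] pq nq // _ tAB; have [sM uA uB _] := tAB.
apply: (@gsum_tilem q) => //.
- rewrite map_inj_uniq // => x y /eqP; rewrite eqn_mul2l => /orP[|/eqP //].
  by case: q pq {nq} => [|q].
- by rewrite size_map sM.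
move=> z; rewrite -gsum_p //.
have -> : gsum q m A ^+ q = gsum q m A * gsum q m A ^+ q.-1.
  by rewrite -exprS prednK ?prime_gt0.
rewrite mulrAC tilem_gsum // mulrC gmul_all ffunE gaugX gaug_gsum.
by apply: expf_neq0; apply: natr_Fp_neq0.
Qed.

(** One prime factor of [r] is treated at a time; it cannot divide [size A], which divides [M]. *)
Lemma tilem_mul M r A B : (0 < M)%N -> coprime r M ->
  tilem M A B -> tilem M [seq (r * a)%N | a <- A] B.
Proof.
move=> M0; elim/ltn_ind: r A => r IH A cr tAB.
have [r1|r1] := leqP r 1.
  case: r r1 cr {IH} => [|[|r]] // _; last first.
    by move=> _; rewrite (eq_map (g := id)) ?map_id // => a; rewrite mul1n.
  (* For [r = 0] coprimality forces [M = 1], and then [A] is a singleton. *)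
  rewrite /coprime gcd0n => /eqP M1; move: tAB; rewrite M1 => -[sM uA uB inj].
  case: A sM uA inj => [|a [|a' A]] //=; last by move: (size B); lia.
  move=> sB _ inj; split => //= x x' b b'; rewrite !inE => /eqP-> /eqP-> hb hb' _.
  split => //; have [] := inj a a b b' _ _ hb hb'; rewrite ?inE ?eqxx //.
  by rewrite !modn1.
have pq := pdiv_prime r1; set q := pdiv r in pq.
have rE : (r = q * (r %/ q))%N by rewrite mulnC divnK // pdiv_dvd.
have [cq cr'] : coprime q M /\ coprime (r %/ q) M.
  by move: cr; rewrite rE coprimeMl => /andP[]; rewrite -rE.
have nq : ~~ (q %| size A)%N.
  apply/negP => qA; have [sM _ _ _] := tAB.
  have : (q %| M)%N by rewrite -sM dvdn_mulr.
  by move=> qM; move: cq; rewrite prime_coprime // qM.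
have r'r : (r %/ q < r)%N by rewrite ltn_Pdiv ?prime_gt1 //; lia.
have := tilem_mulp pq _ M0 (IH _ r'r A cr' tAB).
rewrite size_map => /(_ nq); rewrite -map_comp.
congr (tilem _ _ _); apply: eq_map => a /=.
by rewrite mulnA -rE.
Qed.

Local Open Scope nat_scope.

(** * Shifting one residue class of a tile *)

Lemma modn_solve p d e : prime p -> ~~ (p %| d) -> exists w, w * d = e %[mod p].
Proof.
move=> pp nd; have cd : coprime d p by rewrite coprime_sym prime_coprime.
have t0 : 0 < totient p by rewrite totient_gt0 prime_gt0.
exists (e * d ^ (totient p).-1).
by rewrite -mulnA -expnSr prednK // -modnMmr Euler_exp_totient // modnMmr muln1.
Qed.

Section Shift.
Variables (p n m : nat).
Hypotheses (pp : prime p) (nm : ~~ (p %| m)).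
Local Notation M := (p ^ n.+1 * m).
Local Notation kap := (p ^ n * m).

Let p0 : 0 < p. Proof. exact: prime_gt0. Qed.
Let m0 : 0 < m. Proof. by case: m nm; rewrite ?dvdn0. Qed.
Let M0 : 0 < M. Proof. by rewrite muln_gt0 expn_gt0 p0 m0. Qed.

(* Multiplying [A] by [r] moves [a - a'] by [kap], which excludes collisions
   between shifted and unshifted classes of [A]. *)
Lemma shift_multiplier a a' : a <> a' %[mod p ^ n] ->
  exists2 r, coprime r M & r * a + a' = r * a' + a + kap %[mod M].
Proof.
(* With [p ^ j * d] the difference of [a] and [a'], the multiplier [1 + p ^ (n - j) * m * w] is 1
   modulo [p] and modulo [m], and it adds [kap * (w * d)] to the difference, so that only [w * d]
   modulo [p] matters. *)
have unit_r j d w : ~~ (p %| d) -> j < n ->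
    coprime (1 + p ^ (n - j) * m * w) M.
  move=> nd jn; set X := p ^ (n - j) * m * w.
  have pX : p %| X.
    by rewrite /X -mulnA dvdn_mulr // -{1}(expn1 p) dvdn_exp2l // subn_gt0.
  rewrite coprimeMr; apply/andP; split.
    apply: coprimeXr; rewrite coprime_sym prime_coprime //; apply/negP => h.
    by move: h; rewrite (dvdn_addl 1 pX) dvdn1; case: p pp => [|[|]].
  by rewrite coprime_sym /X mulnAC addnC /coprime gcdnMDl -/(coprime m 1) coprimen1.
have dec d : ~~ (p ^ n %| d) -> exists j d', [/\ d = p ^ j * d', ~~ (p %| d') & j < n].
  move=> nd; have d0 : 0 < d by case: d nd; rewrite ?dvdn0.
  have [d' pd' dE] := pfactor_coprime pp d0.
  exists (logn p d), d'; split; first by rewrite mulnC.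
    by rewrite -prime_coprime.
  by rewrite ltnNge -pfactor_dvdn.
have [le_a'a|lt_aa'] := leqP a' a.
  move=> /eqP; rewrite eqn_mod_dvd // => /dec[j [d [dE nd jn]]].
  have [w wE] := modn_solve 1 pp nd.
  exists (1 + p ^ (n - j) * m * w); first exact: unit_r nd jn.
  have -> : a = a' + p ^ j * d by rewrite -dE subnKC.
  rewrite !mulnDl !mul1n !mulnDr.
  have -> : p ^ (n - j) * m * w * (p ^ j * d) = kap * (w * d).
    by rewrite -{2}(subnK (ltnW jn)) expnD; ring.
  have e : kap * (w * d) = kap %[mod M].
    have -> : M = kap * p by rewrite expnS; ring.
    by rewrite -!muln_modr wE muln_modr muln1.
  set X := p ^ (n - j) * m * w * a'.
  have -> : a' + p ^ j * d + (X + kap * (w * d)) + a'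
     = kap * (w * d) + (a' + X + (a' + p ^ j * d)) by ring.
  by rewrite -modnDml e modnDml addnC.
move=> /eqP; rewrite eq_sym eqn_mod_dvd ?(ltnW lt_aa') // => /dec[j [d [dE nd jn]]].
(* Now [a < a'], so the difference has the opposite sign and [w * d] has to be [-1] modulo [p]. *)
have [w wE] := modn_solve p.-1 pp nd.
exists (1 + p ^ (n - j) * m * w); first exact: unit_r nd jn.
have -> : a' = a + p ^ j * d by rewrite -dE subnKC // ltnW.
rewrite !mulnDl !mul1n !mulnDr.
have -> : p ^ (n - j) * m * w * (p ^ j * d) = kap * (w * d).
  by rewrite -{2}(subnK (ltnW jn)) expnD; ring.
have e : kap * (w * d) + kap = 0 %[mod M].
  have -> : M = kap * p by rewrite expnS; ring.
  rewrite -mulnSr -muln_modr.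
  have -> : (w * d).+1 %% p = 0.
    by rewrite -addn1 -modnDml wE modnDml addn1 prednK // modnn.
  by rewrite muln0 mod0n.
set X := p ^ (n - j) * m * w * a.
have -> : a + p ^ j * d + (X + kap * (w * d)) + a + kap
   = (kap * (w * d) + kap) + (a + X + (a + p ^ j * d)) by ring.
by rewrite -[in RHS]modnDml e mod0n add0n.
Qed.

Definition shift_class c a := if a == c %[mod p ^ n] then a + kap else a.

(** Compared with the tiling by [A] itself, this makes the sumset of one class of [A] with [B]
    invariant under translation by [kap], an element of order [p]; see [Wkinv]. *)
Lemma tilem_shift c A B : tilem M A B -> tilem M [seq shift_class c a | a <- A] B.
Proof.
move=> tAB; have [sM uA uB inj] := tAB.
have mixed a a' b b' : a \in A -> a' \in A -> b \in B -> b' \in B ->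
    a = c %[mod p ^ n] -> a' <> c %[mod p ^ n] ->
    a + kap + b <> a' + b' %[mod M].
  move=> ha ha' hb hb' ac a'c e.
  have [|r cr rE] := @shift_multiplier a a'; first by rewrite ac => /esym.
  have [_ _ _ injr] := tilem_mul M0 cr tAB.
  (* The supposed collision becomes one in the tiling by [r * A] and [B], where it forces
     [a = a']. *)
  have e' : r * a + b = r * a' + b' %[mod M].
    apply/eqP; rewrite -(eqn_modDl a'); apply/eqP.
    have -> : a' + (r * a + b) = (r * a + a') + b by ring.
    rewrite -modnDml rE modnDml.
    have -> : r * a' + a + kap + b = r * a' + (a + kap + b) by ring.
    by rewrite -modnDmr e modnDmr; congr (_ %% _); ring.
  have [/eqP] := injr _ _ _ _ (map_f _ ha) (map_f _ ha') hb hb' e'.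
  rewrite eqn_mul2l => /orP[/eqP r0|/eqP aa'].
    move: cr; rewrite r0 /coprime gcd0n => /eqP M1.
    have : p %| 1 by rewrite -M1 dvdn_mulr // dvdn_exp.
    by rewrite dvdn1 => /eqP p1; move: pp; rewrite p1.
  by rewrite aa' in ac.
have injs a a' b b' : a \in A -> a' \in A -> b \in B -> b' \in B ->
    shift_class c a + b = shift_class c a' + b' %[mod M] -> a = a' /\ b = b'.
  move=> ha ha' hb hb'; rewrite /shift_class; case: eqP => ac; case: eqP => a'c.
  - move=> e; apply: inj => //; apply/eqP; rewrite -(eqn_modDr kap); apply/eqP.
    by rewrite addnAC e; congr (_ %% _); ring.
  - by move=> /(mixed _ _ _ _ ha ha' hb hb' ac a'c).
  - by move=> /esym /(mixed _ _ _ _ ha' ha hb' hb a'c ac).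
  - exact: inj.
split => //; first by rewrite size_map.
  rewrite map_inj_in_uniq // => a a' ha ha' e.
  case: B sM {tAB uB inj mixed} injs => [|b B]; first by rewrite muln0; lia.
  by move=> _ /(_ a a' b b ha ha'); rewrite e inE eqxx => /(_ isT isT erefl) [].
by move=> _ _ b b' /mapP[a ha ->] /mapP[a' ha' ->] hb hb' /injs[] // -> ->.
Qed.

End Shift.

(** * Slabs cut out by a digit *)

Lemma count_digit p m y e : prime p -> ~~ (p %| m) -> e < p ->
  (\sum_(i < p) ((y + i * m) %% p == e))%N = 1%N.
Proof.
move=> pp nm ep; have p0 := prime_gt0 pp.
pose h (i : 'I_p) : 'I_p := Ordinal (ltn_pmod (y + i * m) p0).
have hinj : injective h.
  move=> i j [/eqP]; rewrite eqn_modDl.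
  wlog ij : i j / j <= i.
    by move=> H; case: (leqP j i) => [/H //|/ltnW/H h1]; rewrite eq_sym => /h1.
  rewrite eqn_mod_dvd ?leq_mul2r ?ij ?orbT // -mulnBl Euclid_dvdM // (negPf nm) orbF.
  move=> d; apply/val_inj => /=; apply/eqP; rewrite eqn_leq ij andbT -subn_eq0.
  apply: contraLR d; rewrite -lt0n => s0; rewrite gtnNdvd //.
  by rewrite (leq_ltn_trans (leq_subr _ _)).
transitivity (\sum_(j < p) (j == Ordinal ep)).
  by rewrite [RHS](reindex_inj hinj).
by rewrite (bigD1 (Ordinal ep)) //= eqxx big1 // => i /negPf ->.
Qed.

Definition digit p n (y : nat) := (y %/ p ^ n) %% p.
(* The slab of the [y] whose [n]-th digit in base [p] is the one that [k]
   prescribes for the class of [y] modulo [p ^ n]. *)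
Definition digit_sel p n (k : nat -> nat) (y : nat) := digit p n y == k (y %% p ^ n).

Lemma digit_modn p n M y : p ^ n.+1 %| M -> digit p n (y %% M) = digit p n y.
Proof. by move=> d; rewrite /digit !modn_divl -expnS modn_dvdm. Qed.

Lemma digit_sel_modn p n k M y : p ^ n.+1 %| M ->
  digit_sel p n k (y %% M) = digit_sel p n k y.
Proof.
move=> d; rewrite /digit_sel digit_modn // modn_dvdm //.
by apply: dvdn_trans d; rewrite dvdn_exp2l.
Qed.

Lemma digitMDr p n y t : 0 < p -> digit p n (y + p ^ n * t) = (y %/ p ^ n + t) %% p.
Proof. by move=> p0; rewrite /digit addnC mulnC divnMDl ?expn_gt0 ?p0 // addnC. Qed.

Lemma digit_selMDr p n k y t : p ^ n.+1 %| t ->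
  digit_sel p n k (y + t) = digit_sel p n k y.
Proof.
by move=> d; rewrite -(@digit_sel_modn _ _ _ (p ^ n.+1)) // -modnDmr (eqP d) addn0 digit_sel_modn.
Qed.

(* In [F_p[Z/M]], with [q] a power of [p] that is [1] modulo [m] and [0] modulo
   [p ^ n.+1]: [Acl c] is the class of [c] modulo [p ^ n] in [A], [S c] its
   [q]-th power, [P c] a translation, [kinv] invariance under the subgroup of
   order [p], [gk] the sum over that subgroup and [res] the restriction to the
   slab. Frobenius makes [S c] idempotent up to exponent, which kills [D c], and
   hence the defect [L] of the slab, against every [S c]. *)
Section SlabAlgebra.
Local Open Scope ring_scope.
Variables (T : comNzRingType) (I : finType) (p q : nat).
Variables (Acl S P Pm : I -> T) (gB gk gBk gal : T) (res : T -> T) (kinv : T -> Prop).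
Hypotheses (p0 : (0 < p)%N) (q2 : (1 < q)%N) (qp : (p <= q)%N).
Hypothesis kinvMl : forall f V, kinv V -> kinv (f * V).
Hypothesis PPm : forall c, P c * Pm c = 1.
Hypothesis Sq : forall c, S c ^+ q = S c.
Hypothesis AclV : forall c V, kinv V -> Acl c * V = P c * S c * V.
Hypothesis Aclp : forall c, Acl c ^+ p = P c ^+ p * S c ^+ p.
Hypothesis Wkinv : forall c, kinv (Acl c * gB).
Hypothesis gk_res : forall V, kinv V -> gk * res V = V.
Hypothesis resB : forall f g, res (f - g) = res f - res g.
Hypothesis res_S : forall c f, res (S c * f) = S c * res f.
Hypothesis res_B : res gB = gBk.
Hypothesis gk_kinv : kinv gk.
Hypothesis tileAB : (\sum_c Acl c) * gB = gal.

Let W c := Acl c * gB.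
Let D c := Pm c * W c - S c * gB.
Let gA := \sum_c Acl c.
Let L := gal - gA * gk * gBk.

Let AclXV c V t : kinv V -> Acl c ^+ t * V = P c ^+ t * S c ^+ t * V.
Proof.
move=> hV; elim: t => [|t IH]; first by rewrite !expr0 !mul1r.
rewrite !exprS -mulrA IH AclV; last exact: kinvMl.
ring.
Qed.

(** [Acl c ^+ p * gB] is evaluated by [Aclp] and, with one factor kept inside the invariant [W c],
    by [AclV]. The comparison gives [S c ^+ p.-1 * D c = 0], which suffices because [S c = S c ^+ q]
    and [p <= q]. *)
Let SDc c : S c * D c = 0.
Proof.
have E : S c ^+ p * gB = S c ^+ p.-1 * (Pm c * W c).
  have h : P c ^+ p * (S c ^+ p * gB) = P c ^+ p * (S c ^+ p.-1 * (Pm c * W c)).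
    rewrite mulrA -Aclp //.
    have -> : Acl c ^+ p = Acl c ^+ p.-1 * Acl c by rewrite -exprSr prednK.
    rewrite -mulrA -/(W c) AclXV; last exact: Wkinv.
    have -> : P c ^+ p = P c ^+ p.-1 * P c by rewrite -exprSr prednK.
    have -> : P c ^+ p.-1 * P c * (S c ^+ p.-1 * (Pm c * W c))
      = P c ^+ p.-1 * S c ^+ p.-1 * W c * (P c * Pm c) by ring.
    by rewrite PPm mulr1.
  have := congr1 ( *%R (Pm c ^+ p)) h; rewrite ![_ * (P c ^+ p * _)]mulrA.
  by rewrite -[Pm c ^+ p * P c ^+ p]exprMn [Pm c * P c]mulrC PPm expr1n !mul1r.
have qE : (q = q - p + p)%N by rewrite subnK.
have -> : S c * D c = S c ^+ q * D c by rewrite Sq.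
have -> : S c ^+ q = S c ^+ (q - p) * (S c ^+ p.-1 * S c).
  by rewrite -exprSr prednK // -exprD -qE.
have -> : S c ^+ (q - p) * (S c ^+ p.-1 * S c) * D c
  = S c ^+ (q - p) * S c * (S c ^+ p.-1 * (Pm c * W c) - S c ^+ p.-1 * S c * gB).
  by rewrite /D; ring.
have -> : S c ^+ p.-1 * S c = S c ^+ p by rewrite -exprSr prednK.
by rewrite E subrr mulr0.
Qed.

(** This is the symmetry of [Acl c' * Acl c * gB]; it carries [SDc] from one class to all pairs of
    classes. *)
Let SDswap c c' : S c' * D c = S c * D c'.
Proof.
rewrite /D !mulrBr [S c' * (S c * gB)]mulrCA; congr (_ - _).
have h : P c' * S c' * W c = P c * S c * W c'.
  rewrite -AclV; last exact: Wkinv.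
  rewrite -AclV; last exact: Wkinv.
  by rewrite /W mulrCA.
have := congr1 ( *%R (Pm c * Pm c')) h.
have -> : Pm c * Pm c' * (P c' * S c' * W c) = (P c' * Pm c') * (S c' * (Pm c * W c)) by ring.
have -> : Pm c * Pm c' * (P c * S c * W c') = (P c * Pm c) * (S c * (Pm c' * W c')) by ring.
by rewrite !PPm !mul1r.
Qed.

Let SD c c' : S c' * D c = 0.
Proof.
rewrite -(Sq c') -(subnK q2) addn2 !exprSr -!mulrA SDswap [S c' * _]mulrCA.
by rewrite SDc !mulr0.
Qed.

Let gAk V : kinv V -> gA * V = \sum_c P c * S c * V.
Proof.
by move=> hV; rewrite /gA big_distrl; apply: eq_bigr => c _; rewrite /= AclV.
Qed.

Let kgB : kinv (gk * gBk).
Proof. by rewrite mulrC; apply: kinvMl. Qed.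

(** Since [gk * res] recovers the invariant [W c], the defect sees only the restrictions of the
    [D c]. *)
Let LE : L = gk * \sum_c P c * res (D c).
Proof.
rewrite /L -mulrA gAk // -tileAB big_distrl /=.
rewrite big_distrr -sumrB; apply: eq_bigr => c _ /=.
rewrite -/(W c) /D resB res_S res_B mulrBr mulrBr; congr (_ - _); last by ring.
rewrite mulrCA gk_res; last exact: kinvMl (Wkinv c).
by rewrite mulrA PPm mul1r.
Qed.

Let SL c : S c * L = 0.
Proof.
have r0 : res 0 = 0 by rewrite -[X in res X](subrr 0) resB subrr.
rewrite LE mulrCA big_distrr big1 ?mulr0 // => c' _ /=.
by rewrite mulrCA -res_S SD r0 mulr0.
Qed.

(** The product on the right kills each [S c], hence also [gA * gk * gBk]. It fixes the defect [L],
    because every [S c] kills [L]. *)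
Lemma slab_defect :
  gal - (\sum_c Acl c) * gk * gBk = (\prod_c (1 - S c ^+ q.-1)) * gal.
Proof.
rewrite -/gA -/L; set pi := \prod_c _.
have q0 : (0 < q.-1)%N by move: q2; case: q => [|[|]].
have piS c : pi * S c = 0.
  rewrite /pi (bigD1 c) //= mulrAC mulrBl mul1r -exprSr prednK ?Sq ?subrr ?mul0r //.
  exact: ltnW.
have piL : pi * L = L.
  apply: (big_ind (fun x => x * L = L)) => [|x y hx hy|c _].
  - by rewrite mul1r.
  - by rewrite -mulrA hy.
  - by rewrite mulrBl mul1r -(prednK q0) exprSr -mulrA SL // mulr0 subr0.
rewrite -piL /L mulrBr -mulrA gAk // [X in _ - X]big_distrr /= big1 ?subr0 //.
by move=> c _; rewrite mulrA mulrCA [pi * _]mulrA piS mul0r mulr0 || rewrite -mulrA mulrCA [pi * _]mulrA piS mul0r mulr0.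
Qed.

End SlabAlgebra.

Section Slab.
Variables (p n m : nat).
Hypotheses (pp : prime p) (nm : ~~ (p %| m)).
Local Notation M := (p ^ n.+1 * m).
Local Notation kap := (p ^ n * m).

Let p0 : 0 < p. Proof. exact: prime_gt0. Qed.
Let m0 : 0 < m. Proof. by case: m nm; rewrite ?dvdn0. Qed.
Let M0 : 0 < M. Proof. by rewrite muln_gt0 expn_gt0 p0 m0. Qed.
Let ME : M = kap * p. Proof. by rewrite expnS; ring. Qed.

Variables (A B : seq nat).
Hypothesis tAB : tilem M A B.
Hypothesis Ac : exists c, ~~ (p %| count (fun a => a == c %[mod p ^ n]) A).
Variable k : nat -> nat.
Hypothesis kp : forall c, k c < p.

Local Notation M1 := (M.-1).
Local Notation R := (gring 'F_p 'I_M1.+1).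
Local Notation Z := (@inZp M1).
Let M1E : M1.+1 = M. Proof. by rewrite prednK. Qed.

(** Euler's theorem makes [q] equal to 1 modulo [m], and the factor [n.+1] makes it 0 modulo
    [p ^ n.+1]. As [e] represents [1 - q] modulo [M], the identity [a = q a + e a] splits [Z/M] into
    its parts of order [m] and [p ^ n.+1]. *)
Let N := (totient m * n.+1)%N.
Let q := p ^ N.
Let e := 1 + M1 * q.

Let N0 : 0 < N. Proof. by rewrite muln_gt0 totient_gt0 m0. Qed.

Let qm : q = 1 %[mod m].
Proof.
rewrite /q /N expnM -modnXm Euler_exp_totient ?modnXm ?exp1n //.
by rewrite prime_coprime.
Qed.

Let qpn : p ^ n.+1 %| q.
Proof. by rewrite dvdn_exp2l // leq_pmull // totient_gt0. Qed.

Let em : m %| e.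
Proof.
have : e + q = 0 + q %[mod m].
  rewrite add0n qm /e -addnA -{2}(mul1n q) -mulnDl addn1 M1E addnC.
  by rewrite -mulnA [m * q]mulnC mulnA modnMDl.
by move/eqP; rewrite eqn_modDr mod0n.
Qed.

Let Zqe a : Z a = (Z (q * a) + Z (e * a))%R.
Proof.
rewrite -inZpD; apply/inZp_eqP; rewrite M1E.
have -> : q * a + e * a = (q * a) * M + a by rewrite -[in RHS]M1E /e; ring.
by rewrite modnMDl.
Qed.

Let qq a : Z (q * (q * a)) = Z (q * a).
Proof.
apply/inZp_eqP; rewrite M1E; apply/eqP.
rewrite chinese_remainder ?coprimeXl ?prime_coprime //.
apply/andP; split; last by rewrite -modnMml qm modnMml mul1n.
by rewrite (eqP (dvdn_mulr _ qpn)) (eqP (dvdn_mulr _ qpn)).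
Qed.

Local Open Scope ring_scope.

Definition gkinv (V : R) := gdelta _ (Z kap) * V = V.

Lemma gkinvMl f V : gkinv V -> gkinv (f * V).
Proof. by rewrite /gkinv mulrCA => ->. Qed.

Lemma gkinvX t V : gkinv V -> gdelta _ (Z (kap * t)%N) * V = V.
Proof.
move=> h; elim: t => [|t IH].
  by rewrite muln0 (_ : Z 0 = 0) ?gdelta0 ?mul1r //; apply/val_inj; rewrite /= mod0n.
by rewrite mulnS inZpD gdeltaD -mulrA IH.
Qed.

Let cls (c : nat) := [seq a <- A | a == c %[mod p ^ n]%N].
Let Acl c : R := gsum p M1 (cls c).
Let S c : R := gsum p M1 [seq (q * a)%N | a <- cls c].
Let P c : R := gdelta _ (Z (e * c)).
Let Pm c : R := gdelta _ (- Z (e * c)).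
Let gA := gsum p M1 A.
Let gB := gsum p M1 B.

Let PPm c : P c * Pm c = 1.
Proof. by rewrite -gdeltaD addrN. Qed.

Let Sq c : S c ^+ q = S c.
Proof.
rewrite /S gsum_pexp // /gsum !big_map; apply: eq_bigr => a _.
by rewrite -/q qq.
Qed.

(** The multiple of [kap] left over acts trivially on invariant functions ([AclV]) and becomes a
    multiple of [M] after multiplication by [p] ([Aclp]). *)
Let ec_split (a c : nat) : (c < p ^ n)%N -> (a == c %[mod p ^ n])%N ->
  exists t, (e * a = e * c + kap * t)%N.
Proof.
move=> cp /eqP; rewrite [RHS]modn_small // => ac.
have /dvdnP[e' eE] := em.
exists (e' * (a %/ p ^ n))%N; rewrite {1}(divn_eq a (p ^ n)) ac.
by rewrite eE; ring.
Qed.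

Let AclV c V : (c < p ^ n)%N -> gkinv V -> Acl c * V = P c * S c * V.
Proof.
move=> cp hV; rewrite /Acl /S /gsum big_map /= !big_distrl big_distrr /= big_distrl /=.
apply: eq_big_seq => a; rewrite mem_filter => /andP[ac _].
have [t eE] := ec_split cp ac.
rewrite Zqe gdeltaD eE inZpD gdeltaD /P -!mulrA gkinvX //.
by rewrite mulrCA.
Qed.

Let Aclp c : (c < p ^ n)%N -> Acl c ^+ p = P c ^+ p * S c ^+ p.
Proof.
move=> cp; rewrite /P gdeltaX -inZpMn /Acl /S !gsum_p //.
rewrite /gsum !big_map big_distrr /=.
apply: eq_big_seq => a; rewrite mem_filter => /andP[ac _].
have [t eE] := ec_split cp ac.
rewrite -gdeltaD -inZpD; congr (gdelta _ _); apply/inZp_eqP; rewrite M1E.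
have -> : (e * c * p + p * (q * a) = q * a * p + e * c * p)%N by ring.
have := f_equal (fun x : 'I_M1.+1 => x *+ p) (Zqe a).
rewrite -inZpD -!inZpMn => /inZp_eqP; rewrite M1E eE.
have -> : ((q * a + (e * c + kap * t)) * p = t * M + (q * a * p + e * c * p))%N.
  by rewrite ME; ring.
by rewrite modnMDl mulnC.
Qed.

Let W c := Acl c * gB.

Let tAB1 : tilem M1.+1 A B. Proof. by rewrite M1E. Qed.

Let Wkinv c : gkinv (W c).
Proof.
have ts := tilem_shift pp nm c tAB; rewrite -M1E in ts.
have := tilem_gsum p ts; rewrite -(tilem_gsum p tAB1).
have split_ (f : nat -> nat) : gsum p M1 (map f A) =
   gsum p M1 (map f (cls c)) + gsum p M1 (map f [seq a <- A | a != c %[mod p ^ n]%N]).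
  by rewrite /gsum !big_map !big_filter (bigID (fun a => (a == c %[mod p ^ n])%N)).
rewrite -[in RHS](map_id A) !split_ !mulrDl => /eqP.
have -> : [seq shift_class p n m c i | i <- A & (i != c %[mod p ^ n])%N]
       = [seq id i | i <- A & (i != c %[mod p ^ n])%N].
  by apply/eq_in_map => a; rewrite mem_filter /shift_class => /andP[/negPf ->].
rewrite (inj_eq (addIr _)) map_id => /eqP E; rewrite /gkinv /W mulrA -[RHS]E.
congr (_ * _); rewrite /Acl /gsum big_map big_distrr; apply: eq_big_seq => a.
by rewrite mem_filter => /andP[ac _]; rewrite /shift_class ac addnC inZpD gdeltaD.
Qed.

Let res := gres (fun x : 'I_M1.+1 => digit_sel p n k x) : R -> R.
Let gk : R := \sum_(i < p) gdelta _ (- Z (i * kap)).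

Let kapM : (p ^ n.+1 %| M1.+1)%N. Proof. by rewrite M1E dvdn_mulr. Qed.

(** Adding [i * kap] fixes the class modulo [p ^ n] and adds [i * m] to the [n]-th digit. As [p]
    does not divide [m], exactly one of the [p] translates lies in the slab. *)
Let gk_res V : gkinv V -> gk * res V = V.
Proof.
move=> hV; apply/ffunP => x; rewrite /gk big_distrl /= sum_ffunE.
have Vx (i : nat) : V (x + Z (i * kap)) = V x.
  by rewrite -{1}(gkinvX i hV) gdeltaMl [(i * kap)%N]mulnC addrK.
transitivity (V x *+ (\sum_(i < p) ((x %/ p ^ n + i * m) %% p == k (x %% p ^ n))%N)%N).
  rewrite -sumrMnr; apply: eq_bigr => i _; rewrite gdeltaMl opprK /res ffunE Vx.
  rewrite /= modnDmr digit_sel_modn // /digit_sel.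
  have -> : (i * kap = p ^ n * (i * m))%N by ring.
  have modE y t : ((y + p ^ n * t) %% p ^ n = y %% p ^ n)%N by rewrite addnC mulnC modnMDl.
  by rewrite digitMDr // modE; case: eqP.
by rewrite count_digit // mulr1n.
Qed.

Let res_S c f : res (S c * f) = S c * res f.
Proof.
apply: gresM => y /gsum_neq0[_ /mapP[a _ ->] <-] x.
rewrite -[in RHS](subrK (Z (q * a)) x); move: (x - Z (q * a)) => w.
by rewrite /= modnDmr digit_sel_modn // digit_selMDr // dvdn_mulr.
Qed.

Definition digit_filter p n k B := [seq b <- B | digit_sel p n k b].

Let gBk : R := gsum p M1 (digit_filter p n k B).

Let res_B : res gB = gBk.
Proof.
apply/ffunP => x; rewrite /res ffunE /gB /gBk /gsum !sum_ffunE big_filter.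
rewrite [RHS]big_mkcond /=; case: ifP => xs.
  apply: eq_bigr => b _; rewrite ffunE; case: ifPn => // /negPf bs.
  case: eqP => // xb; move: xs; rewrite xb /= digit_sel_modn //.
  by rewrite bs.
rewrite big1 // => b _; rewrite ffunE; case: ifPn => // bs.
by case: eqP => // xb; move: xs; rewrite xb /= digit_sel_modn // bs.
Qed.

Let gk_kinv : gkinv gk.
Proof.
have gkE r : r = p -> gk = \sum_(0 <= i < r) gdelta _ (- Z (i * kap)).
  by move=> ->; rewrite big_mkord.
rewrite /gkinv (gkE _ (prednK p0)) big_distrr big_nat_recl // [RHS]big_nat_recr //.
rewrite [RHS]addrC /=; congr (_ + _); last first.
  apply: eq_bigr => i _; rewrite -gdeltaD; congr (gdelta _ _).
  by rewrite mulSn inZpD opprD addNKr.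
rewrite -gdeltaD; congr (gdelta _ _); apply/eqP; rewrite -subr_eq0 opprK.
rewrite mul0n (_ : Z 0 = 0) ?subr0; last by apply/val_inj; rewrite /= mod0n.
rewrite -inZpD -mulSn prednK //; apply/eqP/val_inj => /=.
by rewrite M1E ME mulnC modnn.
Qed.

Let sum_cls (f : nat -> R) :
  \sum_(a <- A) f a = \sum_(c < p ^ n) \sum_(a <- cls c) f a.
Proof.
under [RHS]eq_bigr => c _ do rewrite /cls big_filter big_mkcond /=.
rewrite exchange_big /=; apply: eq_bigr => a _.
have ap : (a %% p ^ n < p ^ n)%N by rewrite ltn_mod expn_gt0 p0.
rewrite (bigD1 (Ordinal ap)) //= modn_mod eqxx big1 ?addr0 // => c.
rewrite -val_eqE /= => /negPf ca; case: ifP => // /eqP ac.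
by move: ca; rewrite ac modn_small ?eqxx.
Qed.

Let gAE : gA = \sum_(c < p ^ n) Acl c.
Proof. exact: sum_cls. Qed.

(** The defect is [gall] times the augmentation of the product in [slab_defect]. For a class of size
    prime to [p], that size is a nonzero [x] in ['F_p] with [x ^+ q = x], so its factor
    [1 - x ^+ q.-1] vanishes. *)
Let slab_tile : gA * gk * gBk = gall 'F_p _.
Proof.
have q2 : (1 < q)%N by rewrite -(exp1n N) ltn_exp2r ?prime_gt1.
have qp : (p <= q)%N by rewrite -{1}(expn1 p) leq_exp2l ?prime_gt1.
have cl (c : 'I_(p ^ n)) := ltn_ord c.
have tile : (\sum_(c < p ^ n) Acl c) * gB = gall 'F_p _.
  by rewrite -gAE; exact: tilem_gsum tAB1.
have := @slab_defect R 'I_(p ^ n) p q (fun c => Acl c) (fun c => S c) (fun c => P c)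
  (fun c => Pm c) gB gk gBk (gall 'F_p _) res gkinv p0 q2 qp gkinvMl
  (fun c => PPm c) (fun c => Sq c) (fun c V => @AclV c V (cl c)) (fun c => Aclp (cl c))
  (fun c => Wkinv c) gk_res (gresB _) (fun c f => res_S c f) res_B gk_kinv tile.
rewrite -gAE => E; apply/esym/subr0_eq; rewrite {}E gmul_all gaug_prod.
suff -> : \prod_(i < p ^ n) gaug (1 - S i ^+ q.-1) = 0.
  by apply/ffunP => x; rewrite !ffunE.
have [c0 nc] := Ac.
have cp : (c0 %% p ^ n < p ^ n)%N by rewrite ltn_mod expn_gt0 p0.
have prod0 (f : 'I_(p ^ n) -> 'F_p) : f (Ordinal cp) = 0 -> \prod_i f i = 0.
  by move=> h; rewrite (bigD1 (Ordinal cp)) //= h mul0r.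
apply: (prod0 (fun i => gaug (1 - S i ^+ q.-1))).
rewrite (gaug1BX (S _) q.-1).
have -> : nat_of_ord (Ordinal cp) = (c0 %% p ^ n)%N by [].
have nz : gaug (S (c0 %% p ^ n)) != 0.
  rewrite /S gaug_gsum size_map size_filter.
  by under eq_count => a do rewrite modn_mod; apply: natr_Fp_neq0.
have := congr1 (@gaug _ _) (Sq (c0 %% p ^ n)%N); rewrite gaugX.
move: (gaug _) nz => x nz.
have qE : q = q.-1.+1 by rewrite prednK // expn_gt0 p0.
rewrite [X in x ^+ X = _]qE exprSr => h.
have -> : x ^+ q.-1 = 1 by apply: (mulIf nz); rewrite mul1r.
by rewrite subrr.
Qed.

Lemma slab_cover z : exists a b, [/\ a \in A, b \in digit_filter p n k B & a + b = z %[mod kap]]%N.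
Proof.
have : (gA * gk * gBk) (Z z) != 0.
  by rewrite slab_tile ffunE oner_neq0.
rewrite mulrAC mulrC /gk big_distrl /= sum_ffunE => nz.
have [i nzi] : exists i : 'I_p, (gA * gBk) (Z z + Z (i * kap)) != 0.
  apply/existsP; apply: contraR nz => /existsPn h; apply/eqP/big1 => i _.
  by rewrite gdeltaMl opprK; have := h i; rewrite negbK => /eqP.
move: nzi; rewrite /gA /gBk gsumM => /gsum_neq0[_ /allpairsP[[a b] /= [ha hb ->]]].
rewrite -inZpD => /inZp_eqP; rewrite M1E => E.
exists a, b; split => //.
have d : (kap %| M)%N by rewrite ME dvdn_mulr.
by rewrite -(modn_dvdm _ d) E modn_dvdm // addnC modnMDl.
Qed.

End Slab.

(* Adding [i] to every selected digit gives [p] disjoint slabs exhausting [B],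
   each of which covers, so none can be larger than the size of a complement. *)
Lemma tilem_slab p n m A B k : prime p -> ~~ (p %| m)%N ->
  tilem (p ^ n.+1 * m) A B ->
  (exists c, ~~ (p %| count (fun a => a == c %[mod p ^ n]) A))%N ->
  (forall c, k c < p)%N ->
  tilem (p ^ n * m) A (digit_filter p n k B).
Proof.
move=> pp nm tAB Ac kp; have p0 := prime_gt0 pp; have [sM uA uB _] := tAB.
have kap0 : (0 < p ^ n * m)%N.
  by rewrite muln_gt0 expn_gt0 p0; case: m nm {tAB sM}; rewrite ?dvdn0.
pose ki i c := ((k c + i * 1) %% p)%N.
have kip i c : (ki i c < p)%N by rewrite ltn_mod.
have k0 : digit_filter p n k B = digit_filter p n (ki 0%N) B.
  by apply: eq_filter => b; rewrite /digit_sel /ki mul0n addn0 (modn_small (kp _)).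
have lo i : (p ^ n * m <= size A * size (digit_filter p n (ki i) B))%N.
  have cov := slab_cover pp nm tAB Ac (kip i).
  pose s := [seq ((a + b) %% (p ^ n * m))%N | a <- A, b <- digit_filter p n (ki i) B].
  have : (size (iota 0 (p ^ n * m)) <= size s)%N.
    apply: uniq_leq_size (iota_uniq _ _) _ => z; rewrite mem_iota add0n /= => zk.
    have [a [b [ha hb E]]] := cov z.
    by apply/allpairsP; exists (a, b); rewrite /= E modn_small.
  by rewrite size_iota size_allpairs.
have tot : (\sum_(i < p) size A * size (digit_filter p n (ki i) B) = p * (p ^ n * m))%N.
  rewrite -big_distrr /=.
  have -> : (\sum_(i < p) size (digit_filter p n (ki i) B) = size B)%N.
    under eq_bigr => i _ do rewrite size_filter -sum1_count big_mkcond.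
    rewrite exchange_big /= -sum1_size; apply: eq_bigr => b _.
    have pn1 : ~~ (p %| 1)%N by rewrite dvdn1 neq_ltn prime_gt1 // orbT.
    rewrite -[RHS](count_digit (k (b %% p ^ n)) pp pn1 (ltn_pmod (b %/ p ^ n) p0)).
    by apply: eq_bigr => i _; rewrite /digit_sel /digit /ki eq_sym; case: eqP.
  by rewrite sM expnS mulnA.
apply: cover_tilem => //; first exact: filter_uniq.
  rewrite k0; move: tot; rewrite (bigD1 (Ordinal p0)) //= => tot.
  have : (p.-1 * (p ^ n * m) <= \sum_(i < p | i != Ordinal p0) size A * size (digit_filter p n (ki i) B))%N.
    rewrite (_ : p.-1 = #|[pred i : 'I_p | i != Ordinal p0]|); last first.
      by rewrite -[RHS]/#|predC1 _| cardC1 card_ord.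
    by rewrite -sum_nat_const; apply: leq_sum => i _.
  rewrite -(leq_add2l (size A * size (digit_filter p n (ki 0%N) B))%N) tot.
  have -> : (p * (p ^ n * m) = p ^ n * m + p.-1 * (p ^ n * m))%N by rewrite -mulSn prednK.
  by rewrite leq_add2r.
by move=> z _; apply: (slab_cover pp nm tAB Ac kp).
Qed.

Local Open Scope complex_scope.
Local Open Scope ring_scope.

(** * Universal spectra *)

Section Cis.
Variable R : realType.
Implicit Types x y : R.

Definition cis x : R[i] := cos (2 * pi * x) +i* sin (2 * pi * x).

Lemma expiE (l x : R) : expi l x = cis (l * x).
Proof. by rewrite /expi /cis mulrA. Qed.

Lemma cisD x y : cis (x + y) = cis x * cis y.
Proof.
rewrite /cis mulrDr cosD sinD; apply/eqP; rewrite eq_complex /=.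
by rewrite eqxx /= addrC [cos _ * sin _]mulrC [sin _ * cos _]mulrC addrC.
Qed.

Lemma cis0 : cis 0 = 1.
Proof. by rewrite /cis mulr0 cos0 sin0. Qed.

Lemma conj_cis x : (cis x)^* = cis (- x).
Proof. by rewrite /cis mulrN cosN sinN. Qed.

Lemma normr_cis x : `|cis x| = 1.
Proof. by rewrite /cis normc_def /= cos2Dsin2 sqrtr1. Qed.

Lemma cis_neq0 x : cis x != 0.
Proof. by rewrite -normr_eq0 normr_cis oner_neq0. Qed.

Lemma cisN x : cis (- x) = (cis x)^-1.
Proof.
apply: (mulfI (cis_neq0 x)); rewrite -cisD subrr cis0 divff //.
exact: cis_neq0.
Qed.

Lemma cisMn x n : cis (n%:R * x) = cis x ^+ n.
Proof.
elim: n => [|n IH]; first by rewrite mul0r cis0.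
by rewrite exprS -IH -cisD mulrSr mulrDl mul1r addrC.
Qed.

Lemma cis1 : cis 1 = 1.
Proof. by rewrite /cis mulr1 mulr_natl cos2pi sin2pi. Qed.

Lemma cis_nat n : cis n%:R = 1.
Proof. by rewrite -[n%:R]mulr1 cisMn cis1 expr1n. Qed.

Lemma cis_int (z : int) : cis z%:~R = 1.
Proof.
case: z => n; first exact: cis_nat.
by rewrite NegzE mulrNz cisN cis_nat invr1.
Qed.

Lemma cis_neq1 x : 0 < `|x| < 1 -> cis x != 1.
Proof.
wlog x0 : x / 0 < x.
  move=> H /andP[x0 x1]; have [/H|xneg|xE] := ltgtP 0 x; last by rewrite -xE normr0 ltxx in x0.
    by apply; rewrite x0 x1.
  rewrite -[x]opprK cisN invr_eq1; apply: H; first by rewrite oppr_gt0.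
  by rewrite normrN x0 x1.
rewrite gtr0_norm // => /andP[_ x1].
rewrite eq_complex /= negb_and; apply/orP; left.
have -> : 2 * pi * x = (pi * x) *+ 2 by rewrite mulr2n; ring.
have s0 : 0 < sin (pi * x).
  by apply: sin_gt0_pi; rewrite mulr_gt0 ?pi_gt0 //= gtr_pMr ?pi_gt0.
rewrite mulr2n cosD -!expr2 cos2sin2.
by apply/eqP; nra.
Qed.

Lemma sum_cis_eq0 p x : 0 < `|x| < 1 -> cis (p%:R * x) = 1 ->
  \sum_(i < p) cis (i%:R * x) = 0.
Proof.
move=> x01 xp; have z1 := cis_neq1 x01.
under eq_bigr => i _ do rewrite cisMn.
apply: (mulfI (_ : 1 - cis x != 0)); first by rewrite subr_eq0 eq_sym.
have := subrX1 (cis x) p; rewrite -cisMn xp subrr => /esym/eqP.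
by rewrite mulf_eq0 subr_eq0 (negPf z1) /= => /eqP ->; rewrite mulr0.
Qed.

End Cis.

Section Spectrum.
Variable R : realType.

Definition is_spectrum (M : nat) (A Lam : seq nat) : Prop :=
  [/\ size Lam = size A, uniq Lam &
    forall l l', l \in Lam -> l' \in Lam -> l != l' ->
      \sum_(a <- A) cis (a%:R * ((l%:R - l'%:R) / M%:R) : R) = 0].

Lemma sum_digits p n (V : nmodType) (A : seq nat) (f : nat -> V) : (0 < p)%N ->
  \sum_(a <- A) f a = \sum_(c < p ^ n) \sum_(i < p)
    \sum_(a <- A | (a %% p ^ n == c)%N && (digit p n a == i)) f a.
Proof.
move=> p0.
under [RHS]eq_bigr => c _ do under eq_bigr => i _ do rewrite big_mkcond /=.
under [RHS]eq_bigr => c _ do rewrite exchange_big /=.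
rewrite exchange_big /=; apply: eq_bigr => a _.
have cp : (a %% p ^ n < p ^ n)%N by rewrite ltn_mod expn_gt0 p0.
have ip : (digit p n a < p)%N by rewrite ltn_mod.
rewrite (bigD1 (Ordinal cp)) //= [X in _ + X]big1 ?addr0; last first.
  move=> c; rewrite -val_eqE /= => /negPf ca; apply: big1 => i _.
  by rewrite eq_sym ca.
rewrite (bigD1 (Ordinal ip)) //= !eqxx big1 ?addr0 // => i.
by rewrite -val_eqE /= eq_sym => /negPf ->.
Qed.

Lemma sum_digit_filter p n (V : nmodType) (A : seq nat) (f : nat -> V) k : (0 < p)%N ->
  (forall c, k c < p)%N ->
  \sum_(a <- digit_filter p n k A) f a =
  \sum_(c < p ^ n) \sum_(a <- A | (a %% p ^ n == c)%N && (digit p n a == k c)) f a.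
Proof.
move=> p0 kp; rewrite (sum_digits n _ _ p0); apply: eq_bigr => c _.
rewrite (bigD1 (Ordinal (kp c))) //= [X in _ + X]big1 ?addr0; last first.
  move=> i; rewrite -val_eqE /= => ik; rewrite big_filter_cond big1 // => a.
  rewrite /digit_sel => /andP[/eqP ak /andP[/eqP ac /eqP ai]].
  by move: ik; rewrite -ai ak ac eqxx.
rewrite big_filter_cond; apply: eq_bigl => a; rewrite /digit_sel.
by have [->|] := eqVneq (a %% p ^ n)%N (c : nat); rewrite ?andbF //= andbb.
Qed.

(** Among the sums, [p * m] are divisible by [p ^ n]. Pairing each class of [A] with the opposite
    class of [B] counts them as a sum of products of class sizes, which would be divisible by
    [p * p]. *)
Lemma tilem_count_dvd p n m A B : prime p -> ~~ (p %| m)%N ->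
  tilem (p ^ n.+1 * m) A B ->
  (forall c, p %| count (fun a => a == c %[mod p ^ n]) A)%N ->
  (forall c, p %| count (fun a => a == c %[mod p ^ n]) B)%N -> False.
Proof.
move=> pp nm tAB hA hB; have p0 := prime_gt0 pp.
have pn0 : (0 < p ^ n)%N by rewrite expn_gt0 p0.
have m0 : (0 < m)%N by case: m nm {tAB}; rewrite ?dvdn0.
set M := (p ^ n.+1 * m)%N in tAB.
have M0 : (0 < M)%N by rewrite muln_gt0 expn_gt0 p0.
pose s := [seq ((a + b) %% M)%N | a <- A, b <- B].
pose mult := [seq (p ^ n * j)%N | j <- iota 0 (p * m)].
have ME : M = (p ^ n * (p * m))%N by rewrite /M expnSr mulnA.
have us : uniq s := tilem_res tAB.
have pe : perm_eq [seq z <- s | (p ^ n %| z)%N] mult.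
  apply: uniq_perm; first exact: filter_uniq.
    rewrite map_inj_uniq ?iota_uniq // => x y /eqP.
    by rewrite eqn_mul2l gtn_eqF //= => /eqP.
  move=> z; rewrite mem_filter; apply/andP/mapP => [[/dvdnP[j ->]]|[j]].
    move=> /allpairsP[[a b] /= [_ _ E]]; exists j; last by rewrite mulnC.
    rewrite mem_iota add0n /= -(ltn_pmul2l pn0) -ME mulnC E ltn_mod //.
  rewrite mem_iota add0n /= => jm ->; split; first exact: dvdn_mulr.
  have [a [b [ha hb E]]] := tilem_cover (p ^ n * j)%N M0 tAB.
  by apply/allpairsP; exists (a, b); rewrite /= E modn_small // ME ltn_pmul2l.
have := perm_size pe; rewrite size_map size_iota size_filter.
have pnM : (p ^ n %| M)%N by rewrite ME dvdn_mulr.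
have -> : count (fun z => p ^ n %| z)%N s =
    (\sum_(a <- A) count (fun b => (a + b) %% p ^ n == 0) B)%N.
  rewrite /s count_flatten sumnE !big_map; apply: eq_bigr => a _.
  by rewrite count_map; apply: eq_count => b /=; rewrite /dvdn modn_dvdm.
move=> E; have : (p * p %| p * m)%N; last by rewrite dvdn_pmul2l // (negPf nm).
have sdn (f : nat -> nat) : (\sum_(a <- A) f a = \sum_(c < p ^ n) \sum_(i < p)
    \sum_(a <- A | (a %% p ^ n == c) && (digit p n a == i)) f a)%N.
  exact: (sum_digits n A f p0).
rewrite -E sdn.
apply: (big_ind (fun x : nat => p * p %| x)%N) => // [x y|c _]; first exact: dvdn_add.
have cn : exists c', forall a b, (a %% p ^ n = c)%N ->
    ((a + b) %% p ^ n == 0)%N = (b == c' %[mod p ^ n]).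
  exists (p ^ n - c)%N => a b ac; rewrite -modnDml ac.
  rewrite -[in RHS](eqn_modDl c) subnKC; last exact/ltnW/ltn_ord.
  by rewrite modnn.
have [c' c'E] := cn.
rewrite (eq_bigr (fun i : 'I_p => (count (fun b => b == c' %[mod p ^ n]) B *
   count (fun a => (a %% p ^ n == c) && (digit p n a == i)) A)%N)); last first.
  move=> i _; rewrite -[X in (_ * X)%N]sum1_count big_distrr /=.
  apply: eq_bigr => a /andP[/eqP ac _].
  by rewrite muln1; apply: eq_count => b; apply: c'E.
rewrite -big_distrr /= dvdn_mul //.
have -> : (\sum_(i < p) count (fun a => (a %% p ^ n == c) && (digit p n a == i)) A)%N
   = count (fun a => a == c %[mod p ^ n]) A.
  under eq_bigr => i _ do rewrite -sum1_count big_mkcond.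
  rewrite exchange_big /= -sum1_count [RHS]big_mkcond; apply: eq_bigr => a _.
  have ip : (digit p n a < p)%N by rewrite ltn_mod.
  rewrite (bigD1 (Ordinal ip)) //= eqxx andbT big1 ?addn0.
    by rewrite [(c %% _)%N]modn_small.
  by move=> i; rewrite -val_eqE /= eq_sym => /negPf ->; rewrite andbF.
exact: hA.
Qed.

End Spectrum.

Section Universal.
Variable R : realType.

Lemma digit_div p n a : (0 < p)%N ->
  (a = (a %/ p ^ n.+1) * p ^ n.+1 + (a %% p ^ n + p ^ n * digit p n a))%N.
Proof.
move=> p0; rewrite /digit {1}(divn_eq a (p ^ n)) {1}(divn_eq (a %/ p ^ n) p).
by rewrite -divnMA -expnSr expnS; ring.
Qed.

(** Changing a selector [k] at a single class [c] does not affect the exponential sum over the slab,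
    so the partial sum [G c i] does not depend on the digit [i]. For [j1 != j2] the additional phase
    [i * t / p] then produces a vanishing geometric sum over [i]; for [j1 = j2] the constant
    selectors give zero digit by digit. *)
Lemma spectrum_lift p n m (A Lam : seq nat) : prime p -> ~~ (p %| m)%N ->
  (forall k, (forall c, k c < p)%N ->
     is_spectrum R (p ^ n * m) (digit_filter p n k A) Lam) ->
  is_spectrum R (p ^ n.+1 * m) A
    [seq (p * l + j * m)%N | j <- iota 0 p, l <- Lam].
Proof.
move=> pp nm H; have p0 := prime_gt0 pp.
have pn0 : (0 < p ^ n)%N by rewrite expn_gt0 p0.
have m0 : (0 < m)%N by case: m nm {H}; rewrite ?dvdn0.
have [_ uL _] := H (fun=> 0%N) (fun=> p0).
have sizeE : size A = (p * size Lam)%N.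
  have E := @sum_digits p n nat A (fun=> 1%N) p0.
  rewrite -sum1_size; transitivity (\sum_(i < p) size (digit_filter p n (fun=> i : nat) A))%N.
    rewrite [LHS]E exchange_big /=; apply: eq_bigr => i _.
    have := @sum_digit_filter p n nat A (fun=> 1%N) (fun=> i : nat) p0 (fun=> ltn_ord i).
    by rewrite -sum1_size => ->.
  rewrite (eq_bigr (fun=> size Lam)) ?sum_nat_const ?card_ord // => i _.
  by have [<-] := H (fun=> i : nat) (fun=> ltn_ord i).
have jlt j j' l l' : (j < p)%N -> (j' < p)%N -> (p * l + j * m = p * l' + j' * m)%N ->
    j = j' /\ l = l'.
  wlog jj' : j j' l l' / (j <= j')%N.
    move=> W hj hj' E; have [h|/ltnW h] := leqP j j'; first exact: W.
    by have [] := W _ _ _ _ h hj' hj (esym E) => -> ->.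
  move=> hj hj' E.
  have d : (p %| (j' - j) * m)%N.
    have : ((j' - j) * m = p * l - p * l')%N by rewrite mulnBl; lia.
    by move=> ->; rewrite -mulnBr dvdn_mulr.
  rewrite Euclid_dvdM // (negPf nm) orbF in d.
  have j0 : (j' - j = 0)%N.
    have [//|s0] := posnP (j' - j).
    by move: d; rewrite gtnNdvd // (leq_ltn_trans (leq_subr _ _)).
  have jE : j = j' by lia.
  split => //; move: E; rewrite jE => /addIn /eqP.
  by rewrite eqn_pmul2l // => /eqP.
split.
- by rewrite size_allpairs size_iota sizeE.
- apply: allpairs_uniq => //; first exact: iota_uniq.
  move=> [j l] [j' l'] /allpairsP[[a b] /= [ha hb [-> ->]]].
  move=> /allpairsP[[a' b'] /= [ha' hb' [-> ->]]].
  rewrite !mem_iota /= add0n in ha ha'.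
  by move=> /(jlt _ _ _ _ ha ha')[-> ->].
move=> _ _ /allpairsP[[j1 l1] /= [hj1 hl1 ->]] /allpairsP[[j2 l2] /= [hj2 hl2 ->]] neq.
rewrite !mem_iota /= add0n in hj1 hj2.
pose y : R := (l1%:R - l2%:R) / (p ^ n * m)%:R.
pose t : R := j1%:R - j2%:R.
have pR : (p%:R : R) != 0 by rewrite pnatr_eq0 -lt0n.
have pnR : ((p ^ n)%:R : R) != 0 by rewrite pnatr_eq0 -lt0n.
have mR : (m%:R : R) != 0 by rewrite pnatr_eq0 -lt0n.
have xE : ((p * l1 + j1 * m)%:R - (p * l2 + j2 * m)%:R) / (p ^ n.+1 * m)%:R
   = y + t / (p ^ n.+1)%:R.
  rewrite /y /t expnS !natrD !natrM; field.
  by rewrite pR pnR mR.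
rewrite xE.
pose G (c i : nat) : R[i] :=
  \sum_(a <- A | (a %% p ^ n == c)%N && (digit p n a == i)) cis (a%:R * y).
pose v : R[i] := if l1 == l2 then (size Lam)%:R else 0.
have sumG (k : nat -> nat) : (forall c, k c < p)%N -> \sum_(c < p ^ n) G c (k c) = v.
  move=> kp; have [sL _ oL] := H k kp.
  rewrite /G -sum_digit_filter // /v; case: eqP => [l12|/eqP l12].
    rewrite /y l12 subrr mul0r sL.
    under eq_bigr => a _ do rewrite mulr0 cis0.
    by rewrite big_const_seq count_predT iter_addr_0.
  exact: oL.
have [j12|j12] := eqVneq j1 j2.
  have l12 : (l1 == l2) = false.
    by apply: contraNF neq => /eqP ->; rewrite j12.
  rewrite /t j12 subrr mul0r addr0 (sum_digits n _ _ p0) exchange_big /= big1 // => i _.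
  have := sumG (fun=> i : nat) (fun=> ltn_ord i).
  by rewrite /v l12.
have Gc (c : 'I_(p ^ n)) (i : 'I_p) : G c i = G c 0%N.
  pose k0 (_ : nat) := 0%N.
  pose k1 (c' : nat) := if c' == c then (i : nat) else 0%N.
  have k1p c' : (k1 c' < p)%N by rewrite /k1; case: ifP.
  have := sumG k1 k1p; rewrite -(sumG k0 (fun=> p0)).
  rewrite (bigD1 c) //= [RHS](bigD1 c) //= /k1 eqxx.
  rewrite (eq_bigr (fun c' : 'I_(p ^ n) => G c' (k0 c'))) => [/addIr //|c'].
  by rewrite -val_eqE /= => /negPf ->.
rewrite (sum_digits n _ _ p0) big1 // => c _.
have tz : t = ((j1%:Z - j2%:Z)%:~R : R) by rewrite rmorphB.
transitivity (\sum_(i < p) G c 0%N * cis (c%:R * (t / (p ^ n.+1)%:R)) * cis (i%:R * (t / p%:R))).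
  apply: eq_bigr => i _; rewrite -(Gc c i) /G !big_distrl /=.
  apply: eq_bigr => a /andP[/eqP ac /eqP ai].
  rewrite mulrDr cisD -mulrA; congr (_ * _).
  have aE := digit_div n a p0; rewrite ac ai in aE.
  have -> : a%:R * (t / (p ^ n.+1)%:R) =
     (a %/ p ^ n.+1)%:R * t + (c%:R * (t / (p ^ n.+1)%:R) + i%:R * (t / p%:R)).
    rewrite {1}aE expnS !natrD !natrM; field.
    by rewrite pR pnR.
  rewrite cisD cisMn tz cis_int expr1n mul1r cisD.
  by rewrite -tz.
rewrite -big_distrr /= sum_cis_eq0 ?mulr0 //.
  have jR : j1%:R != j2%:R :> R by rewrite eqr_nat.
  have p0R : (0 : R) < p%:R by rewrite ltr0n.
  rewrite normrM normfV (gtr0_norm p0R) divr_gt0 //=; last by rewrite normr_gt0 subr_eq0.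
  rewrite ltr_pdivrMr // mul1r ltr_norml /t.
  have h1 : (j1%:R : R) < p%:R by rewrite ltr_nat.
  have h2 : (j2%:R : R) < p%:R by rewrite ltr_nat.
  have h3 : (0 : R) <= j1%:R by [].
  have h4 : (0 : R) <= j2%:R by [].
  by apply/andP; split; lra.
by rewrite mulrC divfK // tz cis_int.
Qed.

(* The induction replaces [A] by its slabs modulo a smaller number, so the
   spectrum has to depend on the complement [B] only. *)
Lemma universal_spectrum M (B : seq nat) : (0 < M)%N ->
  exists Lam, forall A, tilem M A B -> is_spectrum R M A Lam.
Proof.
elim/ltn_ind: M B => M IH B M0.
have [M1|M1] := leqP M 1.
  have {M1}-> : M = 1%N by lia.
  exists [:: 0%N] => A [sM _ _ _].
  have sA : size A = 1%N by move/eqP: sM; rewrite muln_eq1 => /andP[/eqP].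
  by split => // l l'; rewrite !inE => /eqP-> /eqP->; rewrite eqxx.
pose p := pdiv M; have pp : prime p := pdiv_prime M1; have p0 := prime_gt0 pp.
have [m cpm ME] := pfactor_coprime pp M0.
have nm : ~~ (p %| m)%N by rewrite -prime_coprime.
have e0 : (0 < logn p M)%N by rewrite logn_gt0 pi_pdiv.
set n := (logn p M).-1.
have {}ME : M = (p ^ n.+1 * m)%N by rewrite prednK // mulnC.
have m0 : (0 < m)%N by move: M0; rewrite ME; case: (m); rewrite ?muln0.
have K0 : (0 < p ^ n * m)%N by rewrite muln_gt0 expn_gt0 p0.
have KM : (p ^ n * m < M)%N.
  by rewrite ME ltn_pmul2r // ltn_exp2l // prime_gt1.
(* The case distinction concerns [B] alone, because the spectrum is chosen before [A]. *)
have [[c hc]|nB] := pselect (exists c, ~~ (p %| count (fun a => a == c %[mod p ^ n]) B))%N.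
  have [Lam HL] := IH _ KM B K0.
  exists [seq (p * l + j * m)%N | j <- iota 0 p, l <- Lam] => A tAB.
  rewrite ME; apply: spectrum_lift => // k kp; apply: HL; apply: tilem_sym.
  apply: tilem_slab => //; last by exists c.
  by rewrite -ME; apply: tilem_sym.
have hB c : (p %| count (fun a => a == c %[mod p ^ n]) B)%N.
  by apply: contrapT => /negP h; apply: nB; exists c.
(* Every complement of [B] now has the required class, by [tilem_count_dvd], so one slab of [B]
   serves all of them; digit 0 is an arbitrary choice. The factor [p] on the frequencies compensates
   for passing from [M] to [M / p]. *)
have [Lam HL] := IH _ KM (digit_filter p n (fun=> 0%N) B) K0.
exists [seq (p * l)%N | l <- Lam] => A tAB; rewrite ME in tAB.
have hA : exists c, ~~ (p %| count (fun a => a == c %[mod p ^ n]) A)%N.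
  apply: contrapT => nA; apply: (tilem_count_dvd pp nm tAB _ hB) => c.
  by apply: contrapT => /negP h; apply: nA; exists c.
have [sL uL oL] := HL A (tilem_slab pp nm tAB hA (fun=> p0)).
have pinj : injective (muln p).
  by move=> x z /eqP; rewrite eqn_pmul2l // => /eqP.
split; [by rewrite size_map | by rewrite map_inj_uniq |].
move=> _ _ /mapP[l hl ->] /mapP[l' hl' ->]; rewrite (inj_eq pinj) => ll'.
apply: etrans (oL _ _ hl hl' ll'); apply: eq_bigr => a _; congr (cis (_ * _)).
have pR : (p%:R : R) != 0 by rewrite pnatr_eq0 -lt0n.
have KR : ((p ^ n * m)%:R : R) != 0 by rewrite pnatr_eq0 -lt0n.
have -> : M = (p * (p ^ n * m))%N by rewrite ME expnS mulnA.
rewrite !natrM -!natrM [(p * _)%:R]natrM; rewrite !natrM in KR *.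
move: KR; rewrite mulf_eq0 negb_or => /andP[h1 h2]; field.
by rewrite pR h1 h2.
Qed.

End Universal.

Lemma tilem_intro M A B : (0 < M)%N -> uniq A -> uniq B ->
  (forall a a' b b', a \in A -> a' \in A -> b \in B -> b' \in B ->
     (a + b = a' + b' %[mod M])%N -> a = a' /\ b = b') ->
  (forall z, (z < M)%N -> exists a b, [/\ a \in A, b \in B & (a + b = z %[mod M])%N]) ->
  tilem M A B.
Proof.
move=> M0 uA uB inj cov; apply: cover_tilem => //.
rewrite -(size_allpairs (fun a b => (a + b) %% M)%N) -[leqRHS](size_iota 0 M).
apply: uniq_leq_size; last first.
  by move=> _ /allpairsP[[a b] /= [_ _ ->]]; rewrite mem_iota add0n /= (ltn_pmod (a + b) M0).
apply: allpairs_uniq => // -[a b] [a' b'].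
move=> /allpairsP[[x y] /= [hx hy [-> ->]]] /allpairsP[[x' y'] /= [hx' hy' [-> ->]]] E.
by have [-> ->] := inj _ _ _ _ hx hx' hy hy' E.
Qed.

(** * Tiles of finite cyclic groups and of the integers *)

Section GroupSpectral.
Variable R : realType.
Local Notation C := R[i].

(** There are as many characters as points, so orthogonality makes the square matrix of their values
    invertible, which is existence and uniqueness of coordinates. *)
Lemma orthogonal_group_spectral (G : zmodType) (A : {fset G}) (chi : 'I_(size A) -> G -> C) :
  (forall i, is_character (chi i)) ->
  (forall i j, i != j -> \sum_(a <- A) chi i a * (chi j a)^* = 0) ->
  group_spectral R A.
Proof.
move=> hchi orth; exists (size A), chi; split => // f.
set n := size A in chi hchi orth *.
have [n0|n0] := posnP n.
  exists [ffun=> 0]; split.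
    move=> a aA; exfalso; have : (index a (A : seq G) < n)%N by rewrite index_mem.
    by rewrite n0.
  by move=> c _; apply/ffunP => i; case: i => i hi; exfalso; move: hi; rewrite n0.
pose s : seq G := A.
pose el (j : 'I_n) : G := nth 0 s j.
pose U : 'M[C]_n := \matrix_(i, j) chi i (el j).
pose V : 'M[C]_n := \matrix_(i, j) (chi j (el i))^*.
have UV : U *m V = (n%:R)%:M.
  apply/matrixP => i j; rewrite !mxE.
  under eq_bigr => k _ do rewrite !mxE.
  have sumE (F : G -> C) : \sum_(k < n) F (el k) = \sum_(a <- A) F a.
    by rewrite (big_nth 0) big_mkord.
  rewrite (sumE (fun a => chi i a * (chi j a)^*)).
  have [<-|ij] := eqVneq i j; last by rewrite mulr0n orth.
  rewrite mulr1n (eq_bigr (fun=> 1)); last first.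
    by move=> a _; rewrite -normCK (hchi i).2 expr1n.
  by rewrite big_const_seq count_predT iter_addr_0.
have nC : (n%:R : C) != 0 by rewrite pnatr_eq0 -lt0n.
have Uu : U \in unitmx.
  have : (U *m V) \in unitmx by rewrite UV unitmxE det_scalar unitrX ?unitfE.
  by rewrite unitmx_mul => /andP[].
pose fr : 'rV[C]_n := \row_j f (el j).
have eqv (c : {ffun 'I_n -> C}) :
    (forall a, a \in A -> f a = \sum_(i < n) c i * chi i a) <->
    (\row_i c i) *m U = fr.
  split=> [h|h a aA].
    apply/rowP => j; rewrite !mxE h; last by apply: mem_nth.
    by apply: eq_bigr => i _; rewrite !mxE.
  have ai : (index a s < n)%N by rewrite index_mem.
  have := congr1 (fun r : 'rV_n => r ord0 (Ordinal ai)) h.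
  rewrite !mxE /el /= nth_index // => <-.
  by apply: eq_bigr => i _; rewrite !mxE /el /= nth_index.
exists [ffun i => (fr *m invmx U) ord0 i]; split.
  apply/eqv; rewrite (_ : \row_i _ = fr *m invmx U) ?mulmxKV //.
  by apply/rowP => i; rewrite !mxE ffunE mxE.
move=> c /eqv h; apply/ffunP => i; rewrite ffunE -h mulmxK //.
by rewrite mxE.
Qed.

(** The unimodular factor [u] allows [A] to be translated to natural representatives [r]; it comes
    out of each inner product as a constant. *)
Lemma spectrum_group_spectral (G : zmodType) (A : {fset G}) M (Lam : seq nat)
    (e : nat -> G -> C) (r : G -> nat) (u : nat -> C) :
  (forall l, is_character (e l)) ->
  (forall l, `|u l| = 1) ->
  (forall l a, a \in A -> e l a = u l * cis ((r a)%:R * (l%:R / M%:R))) ->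
  is_spectrum R M [seq r a | a <- A] Lam ->
  group_spectral R A.
Proof.
move=> he hu eE [sL uL oL]; rewrite size_map in sL.
pose chi (i : 'I_(size A)) := e (nth 0%N Lam i).
apply: (@orthogonal_group_spectral _ _ chi) => [i|i j ij]; first exact: he.
have iL k : nth 0%N Lam (nat_of_ord (k : 'I_(size A))) \in Lam.
  by rewrite mem_nth // sL.
have lij : nth 0%N Lam i != nth 0%N Lam j by rewrite nth_uniq ?sL.
have := oL _ _ (iL i) (iL j) lij; rewrite big_map => E.
pose w := u (nth 0%N Lam i) * (u (nth 0%N Lam j))^*.
transitivity (w * \sum_(a <- A)
   cis ((r a)%:R * (((nth 0%N Lam i)%:R - (nth 0%N Lam j)%:R) / M%:R) : R)); last first.
  by rewrite E mulr0.
rewrite big_distrr; apply: eq_big_seq => a aA /=; rewrite /chi !eE // rmorphM /= conj_cis /w.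
by rewrite mulrACA -cisD; congr (_ * cis _); ring.
Qed.

Lemma cyclic_tile_spectral m (A : {fset 'I_m.+1}) : group_tile A -> group_spectral R A.
Proof.
move=> [_ [T hT]].
pose B := [seq val t | t <- [seq t <- enum 'I_m.+1 | t \in T]].
have memB t : (val t \in B) <-> T t.
  rewrite mem_map; last exact: val_inj.
  by rewrite mem_filter mem_enum andbT in_setE.
have valD (x y : 'I_m.+1) : (val x + val y = val (x + y)%R %[mod m.+1])%N.
  by rewrite /= modn_mod.
have tAB : tilem m.+1 [seq val a | a <- A] B.
  apply: tilem_intro => //.
  - by rewrite map_inj_uniq ?fset_uniq //; exact: val_inj.
  - rewrite map_inj_uniq; last exact: val_inj.
    by rewrite filter_uniq ?enum_uniq.
  - move=> _ _ b b' /mapP[a aA ->] /mapP[a' a'A ->] hb hb'.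
    have /mapP[t _ bt] := hb; have /mapP[t' _ bt'] := hb'.
    move: hb hb'; rewrite bt bt' => /memB Tt /memB Tt'.
    rewrite !valD !modn_small ?ltn_ord // => /val_inj E.
    have [p [_ pU]] := hT (a + t).
    have := pU (a, t) (And3 aA Tt erefl); rewrite (pU (a', t') (And3 a'A Tt' (esym E))).
    by case=> -> ->.
  - move=> z zm; have [[a t] [[/= aA Tt E] _]] := hT (Ordinal zm).
    exists (val a), (val t); split; [exact: map_f | exact/memB |].
    by rewrite valD E.
have [Lam HL] := @universal_spectrum R m.+1 B isT.
refine (@spectrum_group_spectral _ A m.+1 Lam
   (fun l x => cis ((val x)%:R * (l%:R / m.+1%:R))) (fun x => val x) (fun=> 1) _ _ _ _).
- move=> l; split => [x y|x]; last exact: normr_cis.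
  rewrite -cisD -mulrDl -natrD.
  (* The carry of the addition in ['I_m.+1] contributes an integer to the phase. *)
  have -> : (val x + val y)%N = ((val x + val y) %/ m.+1 * m.+1 + val (x + y)%R)%N.
    exact: divn_eq.
  rewrite natrD natrM mulrDl cisD.
  have -> : ((val x + val y) %/ m.+1)%:R * m.+1%:R * (l%:R / m.+1%:R)
      = ((val x + val y) %/ m.+1 * l)%:R :> R.
    by rewrite natrM -mulrA; congr (_ * _); rewrite mulrC divfK // pnatr_eq0.
  by rewrite cis_nat mul1r.
- by move=> l; rewrite normr1.
- by move=> l a _; rewrite mul1r.
- exact: HL.
Qed.

Lemma character_cis_int (x : R) : is_character (fun a : int => cis (a%:~R * x)).
Proof.
split => [a b|a]; last exact: normr_cis.
by rewrite rmorphD mulrDl cisD.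
Qed.

Lemma shift_pos (A : {fset int}) : exists D : nat, forall a : int, a \in A ->
  (`|(a + D%:Z)%R|%N%:Z = a + D%:Z) /\ (`|(a + D%:Z)%R| < D.*2.+1)%N.
Proof.
exists (\max_(a <- A) `|(a : int)|)%N => a aA.
have : (`|a| <= \max_(a <- A) `|(a : int)|)%N.
  by rewrite (big_rem a aA) leq_maxl.
by move: (\max_(_ <- _) _)%N => D; lia.
Qed.

(* Newman: the tiling to the right of [n] is determined by a window of length
   [D], and only finitely many windows exist. *)
Lemma int_tile_periodic (A : seq nat) (D : nat) (T : set int) :
  uniq A -> A != [::] -> (forall a, a \in A -> a < D)%N ->
  (forall z : int, exists! p : nat * int, [/\ p.1 \in A, T p.2 & p.1%:Z + p.2 = z]) ->
  exists N B, (0 < N)%N /\ tilem N A B.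
Proof.
move=> uA A0 AD hT.
have ex z : exists a, a \in A /\ T (z - a%:Z).
  have [[a t] [[/= aA Tt <-] _]] := hT z; exists a; split => //.
  by rewrite addrC addKr.
have un a a' t t' : a \in A -> a' \in A -> T t -> T t' -> a%:Z + t = a'%:Z + t' -> a = a' /\ t = t'.
  move=> aA a'A Tt Tt' E; have [p [_ pU]] := hT (a%:Z + t).
  have := pU (a, t) (And3 aA Tt erefl); rewrite (pU (a', t') (And3 a'A Tt' (esym E))).
  by case=> -> ->.
pose w n : {ffun 'I_D -> bool} := [ffun i : 'I_D => `[< T (n%:Z + (i : nat)%:Z) >]].
have [a0 a0A a0min] : exists2 a0, a0 \in A & forall a, a \in A -> (a0 <= a)%N.
  case: A A0 {uA AD hT ex un} => // x A _.
  have xA : exists a, (a \in x :: A) by exists x; rewrite mem_head.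
  by case: (ex_minnP xA) => a0 a0A h; exists a0.
(* The point [n + z + a0] is covered exactly once: by [a0] if [n + z] is in [T], and otherwise by
   some larger [a], whose translate is less than [D] to the left of [n + z] and thus not to the left
   of [n]. *)
have rec n : forall z : nat, (D <= z)%N ->
    (T (n%:Z + z%:Z) <-> forall a, a \in A -> (a0 < a)%N -> ~ T (n%:Z + (z - (a - a0))%N%:Z)).
  move=> z Dz; split=> [Tz a aA aa0 Tz'|h].
    have [|aE] := un a0 a _ _ a0A aA Tz Tz'; last by lia.
    by have := AD _ aA; lia.
  have [a [aA Ta]] := ex (n%:Z + z%:Z + a0%:Z).
  have aa := a0min _ aA; have [aE|aE] := eqVneq a a0.
    by move: Ta; rewrite aE addrK.
  exfalso; apply: (h a aA); first by rewrite ltn_neqAle eq_sym aE.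
  by congr T: Ta; have := AD _ aA; lia.
have [n [n' [nn' ww]]] : exists n n', (n < n')%N /\ w n = w n'.
  apply: contrapT => nw.
  pose K := #|{ffun 'I_D -> bool}|.
  have inj : injective (fun i : 'I_K.+1 => w i).
    move=> i j /eqP ij; apply/val_inj/eqP; apply: contraT => /=.
    rewrite neq_ltn => /orP[h|h]; exfalso; apply: nw.
      by exists i, j; split => //; apply/eqP.
    by exists j, i; split => //; apply/esym/eqP.
  by have := leq_card _ inj; rewrite card_ord ltnn.
have per z : T (n%:Z + z%:Z) <-> T (n'%:Z + z%:Z).
  elim/ltn_ind: z => z IH; have [zD|Dz] := ltnP z D.
    have := congr1 (fun f : {ffun 'I_D -> bool} => f (Ordinal zD)) ww.
    rewrite !ffunE /= => e.
    by split=> h; apply/asboolP; [rewrite -e | rewrite e]; apply/asboolP.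
  rewrite (rec n z Dz) (rec n' z Dz); split=> h a aA aa0 Ta; apply: (h a aA aa0);
    by apply/IH => //; have := AD _ aA; lia.
pose N := (n' - n)%N.
have perN z k : T (n%:Z + z%:Z) <-> T (n%:Z + (z + k * N)%N%:Z).
  elim: k => [|k IH]; first by rewrite mul0n addn0.
  rewrite IH per; have -> : n'%:Z + (z + k * N)%N%:Z = n%:Z + (z + k.+1 * N)%N%:Z by rewrite /N; nia.
  by [].
have N0 : (0 < N)%N by rewrite subn_gt0.
pose B := [seq b <- iota 0 N | `[< T (n%:Z + b%:Z) >]].
have memB b : (b \in B) = (b < N)%N && `[< T (n%:Z + b%:Z) >].
  by rewrite mem_filter mem_iota add0n /= andbC.
exists N, B; split => //; apply: tilem_intro => //.
- by rewrite filter_uniq ?iota_uniq.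
- move=> a a' b b' aA a'A; rewrite !memB => /andP[bN /asboolP Tb] /andP[b'N /asboolP Tb'] E.
  pose k := ((a' + b') %/ N)%N; pose k' := ((a + b) %/ N)%N.
  have E' : (a + b + k * N = a' + b' + k' * N)%N.
    rewrite {1}(divn_eq (a + b) N) {1}(divn_eq (a' + b') N) E -/k -/k'.
    by rewrite addnAC [in RHS]addnAC addnC [in RHS]addnC [(k * N + _)%N]addnC.
  have [|aa' bb'] := un a a' _ _ aA a'A ((perN b k).1 Tb) ((perN b' k').1 Tb'); first by lia.
  split => //; have : (b = b' %[mod N])%N.
    by apply/eqP; rewrite -(eqn_modDl a) {2}aa' E.
  by rewrite !modn_small.
(* Periodicity is known only to the right of [n]; the summand [D * N] keeps the position of the
   translate there. *)
move=> z zN; have [a [aA Ta]] := ex (n%:Z + (z + D * N)%N%:Z).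
have aD := AD _ aA.
have aDN : (a <= z + D * N)%N by rewrite (leq_trans (ltnW aD)) // -{1}(muln1 D); nia.
pose y := (z + D * N - a)%N.
exists a, (y %% N)%N; split => //.
  rewrite memB ltn_mod N0 /=; apply/asboolP/(perN _ (y %/ N)%N).
  rewrite addnC -divn_eq; congr T: Ta; rewrite /y; lia.
by rewrite modnDmr /y subnKC // addnC modnMDl.
Qed.

Lemma int_tile_spectral (A : {fset int}) : group_tile A -> group_spectral R A.
Proof.
move=> [A0 [T hT]]; have [D hD] := shift_pos A.
pose r (a : int) := `|(a + D%:Z)%R|%N.
have rE a : a \in A -> (r a)%:Z = a + D%:Z by move=> /hD[].
have rinj : {in A &, injective r}.
  by move=> a b /rE aE /rE bE E; move: aE; rewrite E bE => /addIr.
have [|||z|N [B [N0 tAB]]] := @int_tile_periodic [seq r a | a <- A] D.*2.+1 T.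
- by rewrite map_inj_in_uniq ?fset_uniq.
- apply: contra A0 => /eqP/(congr1 size); rewrite size_map => h.
  by rewrite -cardfs_eq0; apply/eqP; exact: h.
- by move=> _ /mapP[a aA ->]; have [] := hD a aA.
- have [[a t] [[/= aA Tt atz] pU]] := hT (z - D%:Z).
  exists (r a, t); split => /=.
    by split; [exact: map_f | | rewrite rE // addrAC atz subrK].
  move=> [_ t'] /= [/mapP[a' a'A ->] Tt' E].
  suff [-> ->] : (a, t) = (a', t') by [].
  apply: pU; split => //=; rewrite -E rE //; ring.
have [Lam HL] := @universal_spectrum R N B N0.
apply: (@spectrum_group_spectral _ _ N Lam
   (fun l a => cis (a%:~R * (l%:R / N%:R))) r
   (fun l => cis (- (D%:R * (l%:R / N%:R))))).
- by move=> l; apply: character_cis_int.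
- by move=> l; apply: normr_cis.
- move=> l a aA; rewrite -cisD; congr cis.
  have -> : ((r a)%:R : R) = a%:~R + D%:R.
    by rewrite -[LHS]/((r a)%:Z%:~R) rE // rmorphD.
  by ring.
- exact: HL.
Qed.

End GroupSpectral.

Local Open Scope classical_set_scope.
Local Open Scope complex_scope.
Local Open Scope ring_scope.

(** * Translates of a bounded set *)

Section AlmostEverywhere.
Context d (T : measurableType d) (R : realType) (mu : {measure set T -> \bar R}).
Implicit Types P Q S : T -> Prop.

Lemma ae_mono P Q : (forall x, P x -> Q x) ->
  {ae mu, forall x, P x} -> {ae mu, forall x, Q x}.
Proof. by move=> PQ; apply: negligibleS => x /= nQ /PQ. Qed.

Lemma ae_mono2 P Q S : (forall x, P x -> Q x -> S x) ->
  {ae mu, forall x, P x} -> {ae mu, forall x, Q x} -> {ae mu, forall x, S x}.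
Proof.
move=> PQS hP hQ; apply: (negligibleS _ (negligibleU hP hQ)) => x /= nS.
have [Px|] := pselect (P x); last by left.
by right => Qx; apply: nS; apply: PQS.
Qed.

Lemma ae_all_seq (I : eqType) (s : seq I) (P : I -> T -> Prop) :
  (forall i, i \in s -> {ae mu, forall x, P i x}) ->
  {ae mu, forall x, forall i, i \in s -> P i x}.
Proof.
elim: s => [|i s IH] h; first exact: aeW.
have h2 : {ae mu, forall x, forall j, j \in s -> P j x}.
  by apply: IH => j js; apply: h; rewrite inE js orbT.
apply: ae_mono2 (h i (mem_head _ _)) h2 => x Pi Ps j; rewrite inE => /orP[/eqP->//|].
exact: Ps.
Qed.

Lemma ae_forall_int (P : int -> T -> Prop) :
  (forall z, {ae mu, forall x, P z x}) -> {ae mu, forall x, forall z, P z x}.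
Proof.
move=> h.
have h1 : {ae mu, forall x, forall n : nat, P n%:Z x /\ P (- n%:Z) x}.
  by apply: ae_foralln => n; apply: ae_mono2 (h n%:Z) (h (- n%:Z)).
apply: ae_mono h1 => x Px [n|n]; first by have [] := Px n.
by rewrite NegzE; have [] := Px n.+1.
Qed.

End AlmostEverywhere.

Section LebesgueShift.
Variable R : realType.
Local Notation mu := (@lebesgue_measure R).
Local Notation mT := (measurableTypeR R).
Implicit Types (A : set mT) (P : R -> Prop) (t : R).

Lemma measurable_shift A t : measurable A -> measurable ([set x | A (x - t)] : set mT).
Proof.
move=> mA; rewrite -[X in measurable X]setTI.
have mf : measurable_fun [set: mT] (fun x : mT => x - t : mT) by exact: measurable_funB.
exact: mf.
Qed.

Lemma lebesgue_measure_shift A t : measurable A -> mu [set x | A (x - t)] = mu A.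
Proof.
move=> mA; pose f : mT -> mT := fun x => x - t.
have mf : measurable_fun setT f by exact: measurable_funB.
rewrite -[LHS]/(pushforward mu f A); apply/esym/lebesgue_measure_unique => //= _ [[a b]] _ <-.
rewrite /pushforward.
have -> : f @^-1` `]a, b]%classic = `]a + t, b + t]%classic.
  apply/seteqP; split => x /=; rewrite /f !in_itv /= ?ltrBrDr ?lerBlDr //.
by rewrite !lebesgue_measure_itv /= !lte_fin ltrD2r -!EFinB; case: ifP => // _; congr (_%:E); ring.
Qed.

Lemma ae_shift P t : {ae mu, forall x, P x} -> {ae mu, forall x, P (x - t)}.
Proof.
move=> [N [mN N0 PN]]; exists [set x | N (x - t)]; split.
- exact: measurable_shift.
- by rewrite lebesgue_measure_shift.
- by move=> x /= nP; apply: PN.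
Qed.

End LebesgueShift.

Section Cumulative.
Variable R : realType.
Local Notation mu := (@lebesgue_measure R).
Local Notation mT := (measurableTypeR R).
Variables (A : set mT) (D : R).
Hypothesis mA : measurable A.
Hypothesis AD : forall x, A x -> `|x| < D.

Definition cum (y : R) : R := fine (mu (A `&` `]-oo, y])).

Let mAy y : measurable (A `&` `]-oo, y] : set mT).
Proof. exact: measurableI. Qed.

Lemma cum_set_lty (B : set mT) : measurable B -> (mu (A `&` B) < +oo)%E.
Proof.
move=> mB; apply: (@le_lt_trans _ _ (mu (`]-D, D] : set mT))).
  apply: le_measure; rewrite ?inE //; first exact: measurableI.
  move=> x [/AD]; rewrite ltr_norml /= in_itv /= => /andP[-> h] _.
  by rewrite ltW.
by rewrite lebesgue_measure_itv /=; case: ifP => _; rewrite ?ltry.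
Qed.

Lemma cumE y : (cum y)%:E = mu (A `&` `]-oo, y]).
Proof. by rewrite fineK // ge0_fin_numE // cum_set_lty. Qed.

Lemma cum_itv a b : a <= b -> mu (A `&` `]a, b]) = (cum b - cum a)%:E.
Proof.
move=> ab; rewrite EFinB !cumE.
have -> : A `&` `]-oo, b] = (A `&` `]-oo, a]) `|` (A `&` `]a, b]).
  rewrite -setIUr; congr (_ `&` _); apply/seteqP; split => x /=; rewrite !in_itv /=.
    by move=> xb; have [h|h] := leP x a; [left | right; rewrite ?h].
  by move=> [xa|/andP[]//]; apply: le_trans ab.
rewrite measureU //; first 1 last.
- exact: measurableI.
- rewrite setIACA setIid; apply/seteqP; split => // x [_ []] /=.
  by rewrite !in_itv /= => xa /andP[]; rewrite ltNge xa.
by rewrite addeAC subee ?add0e // ge0_fin_numE // cum_set_lty.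
Qed.

Lemma cum_le a b : a <= b -> cum a <= cum b.
Proof. by move=> ab; rewrite -subr_ge0 -lee_fin -cum_itv. Qed.

Lemma cum_lip a b : a <= b -> cum b - cum a <= b - a.
Proof.
move=> ab; rewrite -lee_fin -cum_itv //.
apply: (@le_trans _ _ (mu (`]a, b] : set mT))).
  by apply: le_measure; rewrite ?inE //; exact: measurableI.
rewrite lebesgue_measure_itv /= lte_fin; case: ifP => // _.
by rewrite lee_fin subr_ge0.
Qed.

Lemma cum_low y : y <= - D -> cum y = 0.
Proof.
move=> yD; rewrite /cum (_ : A `&` _ = set0) ?measure0 //.
apply/seteqP; split => // x [/AD] /=; rewrite in_itv /= ltr_norml => /andP[h _] h2.
by move: (lt_le_trans h h2); rewrite ltNge yD.
Qed.

Lemma cum_high y : D <= y -> cum y = fine (mu A).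
Proof.
move=> yD; rewrite /cum; congr (fine (mu _)); apply/setIidPl => x /AD.
rewrite ltr_norml /= in_itv /= => /andP[_ h]; exact: ltW (lt_le_trans h yD).
Qed.

Definition cnt (s : seq R) (x : R) : R := \sum_(t <- s) \1_A (x - t).

Lemma indic_shift t x : \1_A (x - t) = \1_([set x | A (x - t)] : set mT) x :> R.
Proof. by rewrite !indicE; congr (_%:R); congr (nat_of_bool _); apply/idP/idP; rewrite !inE. Qed.

Lemma measurable_cnt s B : measurable_fun B (EFin \o cnt s : mT -> \bar R).
Proof.
apply/measurable_EFinP; rewrite /cnt; apply: measurable_sum => t.
under eq_fun => x do rewrite indic_shift.
by apply: measurable_indic; apply: measurable_shift.
Qed.

Lemma cnt_ge0 s x : 0 <= cnt s x.
Proof. by apply: sumr_ge0 => t _. Qed.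

Lemma integral_cnt s a b : a <= b ->
  (\int[mu]_(x in `]a, b]) (cnt s x)%:E = (\sum_(t <- s) (cum (b - t) - cum (a - t)))%:E)%E.
Proof.
move=> ab; rewrite /cnt.
under eq_integral => x _ do rewrite -sumEFin.
have mf t : measurable_fun `]a, b]%classic (fun x : mT => (\1_A (x - t))%:E : \bar R).
  have -> : (fun x : mT => (\1_A (x - t))%:E : \bar R) = EFin \o \1_([set x | A (x - t)] : set mT).
    by apply/funext => x /=; rewrite indic_shift.
  by apply/measurable_EFinP; apply: measurable_indic; apply: measurable_shift.
have f0 t (x : mT) : `]a, b]%classic x -> (0 <= (\1_A (x - t))%:E :> \bar R)%E.
  by rewrite lee_fin.
have E := ge0_integral_sum mu (measurable_itv `]a, b]) mf f0 s.
apply: etrans E _.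
rewrite -sumEFin; apply: eq_bigr => t _.
under eq_integral => x _ do rewrite indic_shift.
rewrite integral_indic //; last exact: measurable_shift.
rewrite -cum_itv; last by rewrite lerD2r.
rewrite -[RHS](lebesgue_measure_shift t); last exact: measurableI.
congr (mu _); apply/seteqP; split => x /= [? h]; split => //; move: h;
  by rewrite /= !in_itv /= ltrBrDr lerBlDr !subrK.
Qed.

Lemma integral_one a b : a <= b -> (\int[mu]_(x in `]a, b]) 1%:E = (b - a)%:E)%E.
Proof.
move=> ab; rewrite integral_cst // mul1e; apply: etrans (lebesgue_measure_itv _) _.
by rewrite /= lte_fin; case: ltgtP ab => // ->; rewrite subrr.
Qed.

Lemma cnt_le_itv s a b : a <= b ->
  {ae mu, forall x, a < x <= b -> cnt s x <= 1} ->
  \sum_(t <- s) (cum (b - t) - cum (a - t)) <= b - a.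
Proof.
move=> ab h; rewrite -lee_fin -integral_cnt // -integral_one //.
apply: ae_ge0_le_integral => //.
- by move=> x _; rewrite lee_fin cnt_ge0.
- exact: measurable_cnt.
Qed.

Lemma cnt_ge_itv s a b : a <= b ->
  {ae mu, forall x, a < x <= b -> 1 <= cnt s x} ->
  b - a <= \sum_(t <- s) (cum (b - t) - cum (a - t)).
Proof.
move=> ab h; rewrite -lee_fin -integral_cnt // -integral_one //.
apply: ae_ge0_le_integral => //.
- by move=> x _; rewrite lee_fin cnt_ge0.
- exact: measurable_cnt.
Qed.

(** [A] has positive measure between [a] and [b], so Lebesgue's density theorem provides a point of
    density one of [A] there. *)
Lemma density_point a b : cum a < cum b ->
  exists2 w, a < w < b & forall e, 0 < e -> exists2 d, 0 < d &
    forall h, 0 < h < d -> (1 - e) * (2 * h) <= cum (w + h) - cum (w - h).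
Proof.
move=> ab.
have ltab : a < b by rewrite ltNge; apply/negP => /cum_le; rewrite leNgt ab.
have dens := lebesgue_density mA.
have [w [Aw wab Hw]] : exists w, [/\ A w, a < w < b &
    (mu (A `&` ball w r) * (mu (ball w r))^-1)%E @[r --> 0^'+] --> (\1_A w)%:E].
  apply: contrapT => nw.
  have : mu (A `&` `]a, b[) = 0.
    have [N [mN N0 PN]] := dens.
    apply/eqP; rewrite eq_le measure_ge0 andbT -N0.
    apply: le_measure; rewrite ?inE //; first exact: measurableI.
    move=> x [Ax /=]; rewrite in_itv /= => xab; apply: PN => /= Hx.
    by apply: nw; exists x.
  move=> m0; have := cum_itv (ltW ltab).
  suff -> : mu (A `&` `]a, b]) = 0.
    by case=> /esym/eqP; rewrite subr_eq0 gt_eqF.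
  apply/eqP; rewrite eq_le measure_ge0 andbT.
  apply: (@le_trans _ _ (mu ((A `&` `]a, b[) `|` [set b]))).
    apply: le_measure; rewrite ?inE //; first exact: measurableI.
      by apply: measurableU => //; exact: measurableI.
    move=> x [Ax /=]; rewrite in_itv /= le_eqVlt => /andP[ax /orP[/eqP->|xb]]; [by right|left].
    by split => //=; rewrite in_itv /= ax.
  apply: (le_trans (measureU2 _ _ _)) => //; first exact: measurableI.
  rewrite [X in (X + _)%E](_ : _ = 0%E); last exact: m0.
  by rewrite [X in (_ + X)%E](_ : _ = 0%E) ?adde0 //; exact: lebesgue_measure_set1.
exists w => // e e0.
have Hl := Hw; rewrite indicE mem_set // in Hl.
have oE : ((1 - e)%:E < (1 : R)%:E)%E by rewrite lte_fin ltrBlDr ltrDl.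
have [d /= d0 Hd] := Hl _ (open_ereal_gt' oE).
exists d => // h /andP[h0 hd].
have bh : ball 0 d h by rewrite /ball /= sub0r normrN gtr0_norm.
have lt1 := Hd h bh h0; rewrite /= (lebesgue_measure_ball _ (ltW h0)) in lt1.
have whw : w - h <= w + h by lra.
have fin : (mu (A `&` ball w h) <= (cum (w + h) - cum (w - h))%:E)%E.
  rewrite -cum_itv //; apply: le_measure; rewrite ?inE; [| exact: measurableI |].
    by apply: measurableI => //; apply: measurable_ball.
  move=> x [Ax]; rewrite /ball /= => xw; split => //=; rewrite in_itv /=.
  by move: xw; rewrite distrC ltr_distl => /andP[? ?]; apply/andP; split; lra.
have h2 : 0 < h *+ 2 by rewrite mulrn_wgt0.
rewrite inver gt_eqF // in lt1.
have hi0 : (0 <= ((h *+ 2)^-1)%:E :> \bar R)%E by rewrite lee_fin invr_ge0 ltW.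
have := lt_le_trans lt1 (lee_wpmul2r hi0 fin).
by rewrite -EFinM lte_fin ltr_pdivlMr // => /ltW; rewrite mulr_natl.
Qed.

End Cumulative.

(** * Rigidity of tilings of the line *)

(* The many hypotheses on reals of the sections below slow [lia] down, so we
   discard them. *)
Ltac nlia := repeat match goal with H : ?P |- _ =>
  lazymatch P with nat => fail | is_true (leq _ _) => fail | @eq nat _ _ => fail
  | is_true (_ || _) => fail | is_true (_ && _) => fail | is_true (~~ _) => fail | not _ => fail
  | _ => clear H end end; lia.

Lemma gaps_sum (R : realDomainType) (a : nat -> R) (ga : R) W i j :
  (forall k, (k < W)%N -> ga <= a k.+1 - a k) -> (i <= j)%N -> (j <= W)%N ->
  (j - i)%:R * ga <= a j - a i.
Proof.
move=> gaps; elim: j => [|j IH] ij jW.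
  by move: ij; rewrite leqn0 => /eqP ->; rewrite subn0 mul0r subrr.
move: ij; rewrite leq_eqVlt => /orP[/eqP <-|ij]; first by rewrite subnn mul0r subrr.
rewrite subSn // -natr1 mulrDl mul1r.
have -> : a j.+1 - a i = (a j - a i) + (a j.+1 - a j) by ring.
by rewrite lerD ?gaps // IH // ltnW.
Qed.

Section Flux.
Variable R : realType.
Variables (m : R -> R) (D : R).
Hypothesis m_le : forall a b, a <= b -> m a <= m b.
Hypothesis m_lip : forall a b, a <= b -> m b - m a <= b - a.
Hypothesis m_low : forall y, y <= - D -> m y = m (- D).
Hypothesis m_high : forall y, D <= y -> m y = m D.

Definition dense_at (w e d : R) :=
  forall h, 0 < h < d -> (1 - e) * (2 * h) <= m (w + h) - m (w - h).

(** A tiling of a window, seen only through the masses that the translates put on intervals. Both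
    almost-everywhere tilings ([tiles_onP]) and coverings of exact density ([cover_tiles_on])
    provide it. *)
Definition tiles_on (I : finType) (t : I -> R) (al be : R) :=
  forall x y, al <= x -> x <= y -> y <= be ->
    \sum_i (m (y - t i) - m (x - t i)) = y - x.

(** Net mass gained on the left of [x] when every translate moves from [t i] to [t i + s i]. *)
Definition flux (I : finType) (t s : I -> R) (x : R) :=
  \sum_i (m (x - t i - s i) - m (x - t i)).

(** The mass between [x] and [y] is [y - x] before and after the move, so nothing accumulates
    there. *)
Lemma flux_const (I : finType) (t s : I -> R) al be x y :
  tiles_on t al be -> tiles_on (fun i => t i + s i) al be ->
  al <= x -> x <= y -> y <= be -> flux t s x = flux t s y.
Proof.
move=> h1 h2 ax xy yb; apply/eqP; rewrite -subr_eq0 /flux -sumrB; apply/eqP.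
transitivity (\sum_i (m (y - t i) - m (x - t i)) -
   \sum_i (m (y - (t i + s i)) - m (x - (t i + s i)))); last by rewrite h1 // h2 // subrr.
by rewrite -sumrB; apply: eq_bigr => i _; rewrite !opprD !addrA; ring.
Qed.

(* Since [m] has slope almost [1] at [w] and the slopes add up to [1], only the
   translate number [b] contributes to the flux at [t b + w]. *)
Lemma flux_at (I : finType) (t sg : I -> R) al be (b : I) w e d s :
  dense_at w e d -> tiles_on t al be -> 0 < s -> s < d ->
  al <= t b + w - s -> t b + w + s <= be -> `|sg b| <= s ->
  (forall i, i != b -> `|sg i| <= s \/
     m (t b + w - t i - sg i) = m (t b + w - t i)) ->
  `|flux t sg (t b + w) + sg b| <= 4 * e * s.
Proof.
move=> dn tl s0 sd h1 h2 sb si; set X := t b + w in h1 h2 si *.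
pose u i := m (X + s - t i) - m (X - s - t i).
have u0 i : 0 <= u i by rewrite subr_ge0 m_le //; lra.
have su : \sum_i u i = 2 * s by rewrite (tl (X - s) (X + s)) //; lra.
have ub : (1 - e) * (2 * s) <= u b.
  have hw : (1 - e) * (2 * s) <= m (w + s) - m (w - s) by apply: dn; rewrite s0.
  have E1 : X + s - t b = w + s by rewrite /X; ring.
  have E2 : X - s - t b = w - s by rewrite /X; ring.
  by rewrite /u E1 E2.
(* Translate [b] leaves at most [2 * e * s] of the window of length [2 * s] to all others together,
   which bounds their part of the flux; its own part differs from [- sg b] by at most the same
   amount. *)
have uo : \sum_(i | i != b) u i <= 2 * e * s.
  by move: su; rewrite (bigD1 b) //=; lra.
have hb : `|m (w - sg b) - m w + sg b| <= 2 * e * s.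
  have hw : (1 - e) * (2 * s) <= m (w + s) - m (w - s) by apply: dn; rewrite s0.
  have := sb; rewrite ler_norml => /andP[sb1 sb2].
  have l1 : m (w + s) - m (w - sg b) <= w + s - (w - sg b) by apply: m_lip; lra.
  have l2 : m (w - sg b) - m (w - s) <= w - sg b - (w - s) by apply: m_lip; lra.
  have l3 : m (w + s) - m w <= w + s - w by apply: m_lip; lra.
  have l4 : m w - m (w - s) <= w - (w - s) by apply: m_lip; lra.
  have [g|g] := leP 0 (sg b).
    have l5 : m w - m (w - sg b) <= w - (w - sg b) by apply: m_lip; lra.
    by rewrite ler_norml; apply/andP; split; lra.
  have l5 : m (w - sg b) - m w <= w - sg b - w by apply: m_lip; lra.
  by rewrite ler_norml; apply/andP; split; lra.
rewrite /flux (bigD1 b) //=.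
have -> : X - t b - sg b = w - sg b by rewrite /X; ring.
have -> : X - t b = w by rewrite /X; ring.
set Sr := \sum_(i | i != b) _.
have hS : `|Sr| <= 2 * e * s.
  apply: le_trans uo; apply: le_trans (ler_norm_sum _ _ _) _.
  apply: ler_sum => i ib; have [si1|->] := si i ib; last by rewrite subrr normr0.
  move: si1; rewrite ler_norml => /andP[q1 q2].
  have k1 : m (X - s - t i) <= m (X - t i - sg i) by apply: m_le; lra.
  have k2 : m (X - t i - sg i) <= m (X + s - t i) by apply: m_le; lra.
  have k3 : m (X - s - t i) <= m (X - t i) by apply: m_le; lra.
  have k4 : m (X - t i) <= m (X + s - t i) by apply: m_le; lra.
  by rewrite ler_norml /u; apply/andP; split; lra.
have -> : m (w - sg b) - m w + Sr + sg b = (m (w - sg b) - m w + sg b) + Sr by ring.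
apply: le_trans (ler_normD _ _) _; lra.
Qed.

(* Two tilings that are [eps]-close on a long window, after aligning their
   [c]-th translates, coincide in its middle. Let [O k o] say that the
   deviations [sg] are at most [o] up to distance [k] of [c]. The flux at a right
   (left) end point of the tile only feels the translates to the left (right),
   so [O k o] gives [O k.+1 (2 * o)]; the flux at both ends of [l] steps bounds
   the deviations in the middle by [8 * e * 2 ^+ l * o <= o / 2]. *)
Section Isolation.
Variables (ga u1 u2 e d : R) (l : nat).
Hypotheses (D0 : 0 < D) (ga0 : 0 < ga) (d0 : 0 < d) (e0 : 0 < e).
Hypothesis lga : 2 * D + 1 <= l%:R * ga.
Hypothesis el : 16 * e * 2 ^+ l <= 2^-1.
Hypotheses (u1D : `|u1| <= D) (u2D : `|u2| <= D).
Hypotheses (dn1 : dense_at u1 e d) (dn2 : dense_at u2 e d).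
Hypothesis u1low : m (u1 - ga / 2) = m (- D).
Hypothesis u2high : m (u2 + ga / 2) = m D.

Let low y : y <= u1 - ga / 2 -> m y = m (- D).
Proof.
move=> yu; have [h|h] := leP y (- D); first exact: m_low.
by apply: le_anti; rewrite -{1}u1low !m_le // ltW.
Qed.

Let high y : u2 + ga / 2 <= y -> m y = m D.
Proof.
move=> yu; have [h|h] := leP D y; first exact: m_high.
by apply: le_anti; rewrite -{2}u2high !m_le // ltW.
Qed.

Variables (r c W : nat) (a sg : nat -> R) (eps : R).
Hypothesis rl : (l < r)%N.
Hypothesis cE : c = (3 * l + r + 1)%N.
Hypothesis WE : W = (c + c)%N.
Hypotheses (eps0 : 0 < eps) (epsd : eps < d) (eps1 : eps <= 1) (epsg : eps <= ga / 2).
Hypothesis gaps : forall i, (i < W)%N -> ga <= a i.+1 - a i.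
Hypothesis sge : forall i, (i <= W)%N -> `|sg i| <= eps.
Hypothesis sgc : sg c = 0.
Let al := a 0%N + D + 1.
Let be := a W - D - 1.
Hypothesis tl1 : tiles_on (fun i : 'I_W.+1 => a i) al be.
Hypothesis tl2 : tiles_on (fun i : 'I_W.+1 => a i + sg i) al be.

Let gapn i j : (i <= j)%N -> (j <= W)%N -> (j - i)%:R * ga <= a j - a i.
Proof. exact: gaps_sum. Qed.

Let gapl i j : (i + l <= j)%N -> (j <= W)%N -> 2 * D + 1 <= a j - a i.
Proof.
move=> ij jW; apply: le_trans (gapn (leq_trans (leq_addr _ _) ij) jW).
apply: le_trans lga _; rewrite ler_pM2r // ler_nat; nlia.
Qed.

Let X b (u : R) := a b + u.

(** Evaluating at index [b] takes [2 * l] indices on each side, every [l] of them being worth at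
    least [2 * D + 1]. The choice [c = 3 * l + r + 1] leaves this room around all indices within
    [r + l] of [c]. *)
Let range b u s : (2 * l <= b)%N -> (b + 2 * l <= W)%N -> `|u| <= D -> s <= 1 ->
  al <= a b + u - s /\ a b + u + s <= be.
Proof.
move=> b1 b2; rewrite ler_norml => /andP[uD1 uD2] s1.
have h1 : 2 * D + 1 <= a (b - l)%N - a 0%N by apply: gapl; nlia.
have h2 : 2 * D + 1 <= a b - a (b - l)%N by apply: gapl; nlia.
have h3 : 2 * D + 1 <= a (b + l)%N - a b by apply: gapl; nlia.
have h4 : 2 * D + 1 <= a W - a (b + l)%N by apply: gapl; nlia.
by rewrite /al /be; split; lra.
Qed.

Let PhiV := flux (fun i : 'I_W.+1 => a i) (fun i => sg i) (a c + u1).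

Let Phi_eq b u : (2 * l <= b)%N -> (b + 2 * l <= W)%N -> `|u| <= D ->
  flux (fun i : 'I_W.+1 => a i) (fun i => sg i) (a b + u) = PhiV.
Proof.
move=> b1 b2 uD.
have [r1 r2] := range (s := 0) b1 b2 uD ler01.
have cl1 : (2 * l <= c)%N by nlia.
have cl2 : (c + 2 * l <= W)%N by nlia.
have [r3 r4] := range (s := 0) cl1 cl2 u1D ler01.
have [h|h] := leP (a b + u) (a c + u1); last symmetry;
  apply: (flux_const tl1 tl2); lra.
Qed.

Let sgb i : (i <= W)%N -> - eps <= sg i /\ sg i <= eps.
Proof. by move=> /sge; rewrite ler_norml => /andP. Qed.

Let far i b u : (i <= W)%N -> (b <= W)%N -> `|u| <= D -> (i + l <= b)%N || (b + l <= i)%N ->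
  m (a b + u - a i - sg i) = m (a b + u - a i).
Proof.
move=> iW bW; rewrite ler_norml => /andP[uD1 uD2].
have [s1 s2] := sgb iW.
move=> /orP[h|h].
  have g := gapl h bW.
  have p1 : D <= a b + u - a i - sg i by move: eps1 epsg; lra.
  have p2 : D <= a b + u - a i by move: eps1 epsg; lra.
  by rewrite (m_high p1) (m_high p2).
have g := gapl h iW.
have p1 : a b + u - a i - sg i <= - D by move: eps1 epsg; lra.
have p2 : a b + u - a i <= - D by move: eps1 epsg; lra.
by rewrite (m_low p1) (m_low p2).
Qed.

Let local b s : (2 * l <= b)%N -> (b + 2 * l <= W)%N -> 0 < s -> s <= eps ->
  (forall i, (b <= i + l)%N -> (i <= b + l)%N -> `|sg i| <= s) ->
  `|PhiV + sg b| <= 4 * e * s.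
Proof.
move=> b1 b2 s0 se hs; rewrite -(Phi_eq b1 b2 u1D).
have bW : (b < W.+1)%N by nlia.
have [r1 r2] := range b1 b2 u1D (le_trans se eps1).
apply: (flux_at (b := Ordinal bW) dn1 tl1) => //=; first exact: le_lt_trans se epsd.
  by apply: hs; nlia.
move=> i ib; have iW := ltn_ord i; have [hl|hl] := boolP ((b <= i + l) && (i <= b + l))%N.
  by left; case/andP: hl => ? ?; apply: hs.
by right; apply: far => //; nlia.
Qed.

(** Near [u1], where the tile begins, a translate of larger index has not yet started, even after a
    move by [eps <= ga / 2]. So only indices up to [b] enter, and control can be extended to the
    right. *)
Let right b s : (2 * l <= b)%N -> (b + 2 * l <= W)%N -> 0 < s -> s <= eps ->
  (forall i, (b <= i + l)%N -> (i <= b)%N -> `|sg i| <= s) ->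
  `|PhiV + sg b| <= 4 * e * s.
Proof.
move=> b1 b2 s0 se hs; rewrite -(Phi_eq b1 b2 u1D).
have bW : (b < W.+1)%N by nlia.
have [r1 r2] := range b1 b2 u1D (le_trans se eps1).
apply: (flux_at (b := Ordinal bW) dn1 tl1) => //=; first exact: le_lt_trans se epsd.
  by apply: hs; nlia.
move=> i ib; have iW := ltn_ord i; have [hl|hl] := boolP ((b <= i + l) && (i <= b))%N.
  by left; case/andP: hl => ? ?; apply: hs.
right; have [hi|hi] := leqP (i + l) b; first by apply: far => //; nlia.
have bi : (b < i)%N by nlia.
have iW' : (i <= W)%N by nlia.
have g : ga <= a i - a b.
  rewrite -[ga]mul1r; apply: le_trans (gapn (ltnW bi) iW'); rewrite ler_pM2r // ler1n; nlia.
have [s1 s2] := sgb iW'.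
have p1 : a b + u1 - a i - sg i <= u1 - ga / 2 by move: eps1 epsg; lra.
have p2 : a b + u1 - a i <= u1 - ga / 2 by move: eps1 epsg; lra.
by rewrite (low p1) (low p2).
Qed.

(** The mirror image, at [u2], where the tile ends. *)
Let left b s : (2 * l <= b)%N -> (b + 2 * l <= W)%N -> 0 < s -> s <= eps ->
  (forall i, (b <= i)%N -> (i <= b + l)%N -> `|sg i| <= s) ->
  `|PhiV + sg b| <= 4 * e * s.
Proof.
move=> b1 b2 s0 se hs; rewrite -(Phi_eq b1 b2 u2D).
have bW : (b < W.+1)%N by nlia.
have [r1 r2] := range b1 b2 u2D (le_trans se eps1).
apply: (flux_at (b := Ordinal bW) dn2 tl1) => //=; first exact: le_lt_trans se epsd.
  by apply: hs; nlia.
move=> i ib; have iW := ltn_ord i; have [hl|hl] := boolP ((b <= i) && (i <= b + l))%N.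
  by left; case/andP: hl => ? ?; apply: hs.
right; have [hi|hi] := leqP (b + l) i; first by apply: far => //; nlia.
have bi : (i < b)%N by nlia.
have bW' : (b <= W)%N by nlia.
have g : ga <= a b - a i.
  rewrite -[ga]mul1r; apply: le_trans (gapn (ltnW bi) bW'); rewrite ler_pM2r // ler1n; nlia.
have [s1 s2] := sgb (ltnW (leq_trans bi bW')).
have p1 : u2 + ga / 2 <= a b + u2 - a i - sg i by move: eps1 epsg; lra.
have p2 : u2 + ga / 2 <= a b + u2 - a i by move: eps1 epsg; lra.
by rewrite (high p1) (high p2).
Qed.

Let O k o := forall i, (c <= i + k)%N -> (i <= c + k)%N -> `|sg i| <= o.

Let pl : 1 <= 2 ^+ l :> R.
Proof. by rewrite exprn_ege1 // ler1n. Qed.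

Let e16 : 16 * e <= 2^-1.
Proof. by apply: le_trans el; rewrite ler_peMr // mulr_ge0 // ltW. Qed.

Let O_ext k o : (l < k)%N -> (k < r + l)%N -> 0 < o -> O k o -> O k.+1 (2 * o).
Proof.
move=> lk kr o0 Ho i i1 i2.
have [oe|oe] := leP o eps; last first.
  have iW : (i <= W)%N by nlia.
  by apply: le_trans (sge iW) _; lra.
have main b b' : (2 * l <= b)%N -> (b + 2 * l <= W)%N -> `|sg b'| <= o ->
    (forall s, 0 < s -> s <= eps -> o <= s -> `|sg b| <= s -> `|PhiV + sg b| <= 4 * e * s) ->
    (forall s, 0 < s -> s <= eps -> o <= s -> `|PhiV + sg b'| <= 4 * e * s) ->
    `|sg b| <= 2 * o.
  (* The unknown size of [sg b] enters its own bound through [s]. It can be absorbed, because the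
     two flux errors add up to [8 * e * s], at most a quarter of [s]. *)
  move=> b1 b2 hb' H1 H2; pose s := Num.max o `|sg b|.
  have so : o <= s by rewrite le_max lexx.
  have ssb : `|sg b| <= s by rewrite le_max lexx orbT.
  have bW : (b <= W)%N by nlia.
  have se : s <= eps by rewrite ge_max oe sge.
  have s0 : 0 < s by apply: lt_le_trans so.
  have k1 := H1 s s0 se so ssb; have k2 := H2 s s0 se so.
  have sle : s <= o + `|sg b|.
    by rewrite ge_max; apply/andP; split; have := normr_ge0 (sg b); lra.
  have tri : `|sg b| <= `|sg b'| + (4 * e * s + 4 * e * s).
    have -> : sg b = sg b' + ((PhiV + sg b) - (PhiV + sg b')) by ring.
    apply: le_trans (ler_normD _ _) _; rewrite lerD2l.
    by apply: le_trans (ler_normB _ _) _; lra.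
  have es : 16 * e * s <= 2^-1 * s by rewrite ler_pM2r.
  by have := normr_ge0 (sg b); lra.
have [/andP[h1 h2]|h] := boolP ((c <= i + k) && (i <= c + k))%N.
  by apply: le_trans (Ho i h1 h2) _; lra.
have [h1|h1] : i = (c + k).+1 \/ c = (i + k).+1 by nlia.
  apply: (main i (c + k)%N); [nlia|nlia|apply: Ho; nlia| |].
    move=> s s0 se os sb; apply: right => //; [nlia|nlia|].
    move=> j j1 j2; have [->//|/eqP ji] := eqVneq j i.
    by apply: le_trans os; apply: Ho; nlia.
  move=> s s0 se os; apply: right => //; [nlia|nlia|].
  by move=> j j1 j2; apply: le_trans os; apply: Ho; nlia.
apply: (main i i.+1); [nlia|nlia|apply: Ho; nlia| |].
  move=> s s0 se os sb; apply: left => //; [nlia|nlia|].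
  move=> j j1 j2; have [->//|/eqP ji] := eqVneq j i.
  by apply: le_trans os; apply: Ho; nlia.
move=> s s0 se os; apply: left => //; [nlia|nlia|].
by move=> j j1 j2; apply: le_trans os; apply: Ho; nlia.
Qed.

Let O_iter k o : (k <= l)%N -> 0 < o -> O r o -> O (r + k)%N (2 ^+ k * o).
Proof.
elim: k => [|k IH] kl o0 h; first by rewrite addn0 expr0 mul1r.
rewrite addnS exprS -mulrA; apply: O_ext; [nlia|nlia| |].
  by rewrite mulr_gt0 // exprn_gt0.
by apply: IH => //; nlia.
Qed.

Let O_contract o : 0 < o -> O r o -> O r (o / 2).
Proof.
move=> o0 Ho i i1 i2.
have H2 := O_iter (leqnn l) o0 Ho; set o' := 2 ^+ l * o in H2.
have o'0 : 0 < o' by rewrite mulr_gt0 // exprn_gt0.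
(* [flux_at] needs [s] below [d]; the cut at [eps] is harmless, as [eps] bounds all deviations. *)
pose s := Num.min o' eps.
have s0 : 0 < s by rewrite lt_min o'0 eps0.
have se : s <= eps by rewrite ge_min lexx orbT.
have so : s <= o' by rewrite ge_min lexx.
have Hs j : (c <= j + (r + l))%N -> (j <= c + (r + l))%N -> `|sg j| <= s.
  by move=> j1 j2; rewrite le_min H2 // sge //; nlia.
have k1 : `|PhiV + sg i| <= 4 * e * s.
  apply: local => //; [nlia|nlia|].
  by move=> j j1 j2; apply: Hs; nlia.
have k2 : `|PhiV + sg c| <= 4 * e * s.
  apply: local => //; [nlia|nlia|].
  by move=> j j1 j2; apply: Hs; nlia.
rewrite sgc addr0 in k2.
have -> : sg i = (PhiV + sg i) - PhiV by ring.
apply: le_trans (ler_normB _ _) _.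
have k3 : 8 * e * s <= 8 * e * o' by rewrite ler_pM2l // mulr_gt0.
have k4 : 16 * e * 2 ^+ l * o <= 2^-1 * o by rewrite ler_pM2r.
have k5 : 16 * e * 2 ^+ l * o = 2 * (8 * e * o') by rewrite /o'; ring.
have k6 : 0 < 8 * e * o' by rewrite !mulr_gt0.
lra.
Qed.

Lemma isolation i : (c <= i + r)%N -> (i <= c + r)%N -> sg i = 0.
Proof.
have step n : O r (eps / 2 ^+ n).
  elim: n => [|n IH]; first by move=> j j1 j2; rewrite expr0 divr1 sge //; nlia.
  rewrite exprS invfM mulrA mulrAC; apply: O_contract IH.
  by rewrite divr_gt0 // exprn_gt0.
move=> i1 i2; apply/eqP; rewrite -normr_eq0; apply/eqP/le_anti; rewrite normr_ge0 andbT.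
rewrite leNgt; apply/negP => s0.
have [n nE] : exists n : nat, eps / `|sg i| < 2 ^+ n.
  exists (Num.bound (eps / `|sg i|)); apply: lt_trans (archi_boundP _) _.
    by rewrite divr_ge0 // ltW.
  by rewrite -natrX ltr_nat ltn_expl.
have := step n i i1 i2; rewrite leNgt => /negP; apply.
by rewrite ltr_pdivrMr ?exprn_gt0 // mulrC -ltr_pdivrMr.
Qed.

End Isolation.
End Flux.

(** * Periodicity *)

Lemma pigeonhole (F : finType) (f : nat -> F) : exists i j, (i < j)%N /\ f i = f j.
Proof.
have /injectivePn[x [y xy fxy]] : ~~ injectiveb (fun i : 'I_#|F|.+1 => f i).
  by apply/negP => /injectiveP/leq_card; rewrite card_ord ltnn.
case: (ltngtP x y) => h; [by exists x, y|by exists y, x|].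
by move/eqP: xy; case; apply: val_inj.
Qed.

Section PeriodicTiling.
Variable R : realType.
Local Notation mu := (@lebesgue_measure R).
Local Notation mT := (measurableTypeR R).

Lemma ae_exists a b (P : R -> Prop) : a < b -> {ae mu, forall x, P x} ->
  exists2 x, a < x < b & P x.
Proof.
move=> ab [N [mN N0 PN]]; apply: contrapT => nP.
have : (mu `]a, b[ <= mu N)%E.
  apply: le_measure; rewrite ?inE //; move=> x /=; rewrite in_itv /= => xab.
  by apply: PN => /= Px; apply: nP; exists x.
rewrite N0 [X in (X <= _)%E](_ : _ = (b - a)%:E); last first.
  by apply: etrans (lebesgue_measure_itv _) _; rewrite /= lte_fin ab.
by rewrite lee_fin subr_le0 leNgt ab.
Qed.

Variables (A : set mT) (D : R).
Hypothesis mA : measurable A.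
Hypothesis AD : forall x, A x -> `|x| < D.
Hypothesis A0 : cum A (- D) < cum A D.
Local Notation m := (cum A).
Let mle := cum_le mA AD.
Let mlip := cum_lip mA AD.

Let D0 : 0 < D.
Proof.
rewrite ltNge; apply/negP => D0; move: A0; rewrite ltNge mle //; lra.
Qed.

Lemma tiles_onP (I : finType) (f : I -> R) al be :
  {ae mu, forall x, al < x <= be -> exists! i, A (x - f i)} ->
  tiles_on m f al be.
Proof.
move=> h x y ax xy yb.
pose s := [seq f i | i <- index_enum I].
have hc : {ae mu, forall z, x < z <= y -> cnt A s z = 1}.
  apply: ae_mono h => z hz /andP[xz zy].
  have [|i [Ai Ui]] := hz; first by rewrite (le_lt_trans ax xz) (le_trans zy yb).
  rewrite /cnt /s big_map (bigD1 i) //= indicE mem_set // big1 ?addr0 // => j ji.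
  rewrite indicE memNset // => Aj; by move: ji; rewrite (Ui j Aj) eqxx.
rewrite -(big_map f xpredT (fun t => m (y - t) - m (x - t))).
apply/le_anti; rewrite (cnt_le_itv mA AD xy) /=.
  by rewrite (cnt_ge_itv mA AD xy) //; apply: ae_mono hc => z hz /hz ->.
by apply: ae_mono hc => z hz /hz ->.
Qed.

Lemma tiles_on_shift (I : finType) (f : I -> R) al be tau :
  tiles_on m f al be -> tiles_on m (fun i => f i + tau) (al + tau) (be + tau).
Proof.
move=> h x y ax xy yb.
rewrite -[RHS](_ : (y - tau) - (x - tau) = _); last by ring.
rewrite -h; [|lra|lra|lra].
by apply: eq_bigr => i _; congr (m _ - m _); ring.
Qed.

Lemma tiles_on_sub (I : finType) (f : I -> R) al be al' be' : al <= al' -> be' <= be ->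
  tiles_on m f al be -> tiles_on m f al' be'.
Proof. by move=> h1 h2 h x y ax xy yb; apply: h => //; lra. Qed.

(** Walking from [- D] in steps of length [g], the first step on which [m] grows contains a density
    point, and no mass lies before that step. *)
Lemma density_low g : 0 < g -> exists2 w, m (w - g) = m (- D) /\ `|w| <= D &
  forall e, 0 < e -> exists2 d, 0 < d & dense_at m w e d.
Proof.
move=> g0.
have [n] : exists n : nat, m (- D) < m (- D + n%:R * g).
  exists (Num.bound (2 * D / g)); apply: lt_le_trans A0 _; apply: mle.
  have : 2 * D / g < (Num.bound (2 * D / g))%:R.
    by apply: archi_boundP; rewrite divr_ge0 ?mulr_ge0 // ltW.
  rewrite ltr_pdivrMr //; lra.
elim: n => [|n IH h]; first by rewrite mul0r addr0 ltxx.
have [/IH//|h2] := ltP (m (- D)) (m (- D + n%:R * g)).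
have lt : m (- D + n%:R * g) < m (- D + n.+1%:R * g) by apply: le_lt_trans h.
have ng : 0 <= n%:R * g by rewrite mulr_ge0 // ltW.
have E0 : m (- D + n%:R * g) = m (- D).
  by apply/le_anti; rewrite h2 mle //; lra.
have [w /andP[w1 w2] Hw] := density_point mA AD lt.
exists w => //.
have nD : - D + n%:R * g < D.
  rewrite ltNge; apply/negP => nD; move: A0; rewrite -E0 ltNge => /negP; apply.
  exact: mle.
move: w2; rewrite -addn1 natrD mulrDl mul1r => w2.
split.
  apply/le_anti/andP; split; first by rewrite -E0; apply: mle; lra.
  have [h3|h3] := leP (- D) (w - g); first exact: mle.
  by rewrite !(cum_low AD) // ltW.
apply/ler_normlP; split; first lra.
rewrite leNgt; apply/negP => Dw.
have [d d0 Hd] := Hw 1 ltr01.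
have [d' d'0 Hd'] := Hw 2^-1 (ltac:(by rewrite invr_gt0)).
pose h' := Num.min (d' / 2) (w - D).
have h'0 : 0 < h' by rewrite lt_min; apply/andP; split; lra.
have hd' : h' < d' by rewrite gt_min; apply/orP; left; lra.
have hw : h' <= w - D by rewrite ge_min lexx orbT.
have := Hd' h'; rewrite h'0 hd' => /(_ isT).
by rewrite !(cum_high AD) ?subrr; lra.
Qed.

Lemma density_high g : 0 < g -> exists2 w, m (w + g) = m D /\ `|w| <= D &
  forall e, 0 < e -> exists2 d, 0 < d & dense_at m w e d.
Proof.
move=> g0.
have [n] : exists n : nat, m (D - n%:R * g) < m D.
  exists (Num.bound (2 * D / g)); apply: le_lt_trans A0; apply: mle.
  have : 2 * D / g < (Num.bound (2 * D / g))%:R.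
    by apply: archi_boundP; rewrite divr_ge0 ?mulr_ge0 // ltW.
  rewrite ltr_pdivrMr //; lra.
elim: n => [|n IH h]; first by rewrite mul0r subr0 ltxx.
have [/IH//|h2] := ltP (m (D - n%:R * g)) (m D).
have lt : m (D - n.+1%:R * g) < m (D - n%:R * g) by apply: lt_le_trans h2.
have ng : 0 <= n%:R * g by rewrite mulr_ge0 // ltW.
have E0 : m (D - n%:R * g) = m D.
  by apply/le_anti; rewrite h2 mle //; lra.
have [w /andP[w1 w2] Hw] := density_point mA AD lt.
exists w => //.
have nD : - D < D - n%:R * g.
  rewrite ltNge; apply/negP => nD; move: A0; rewrite -E0 ltNge => /negP; apply.
  exact: mle.
move: w1; rewrite -addn1 natrD mulrDl mul1r => w1.
split.
  apply/le_anti/andP; split; last by rewrite -E0; apply: mle; lra.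
  have [h3|h3] := leP (w + g) D; first exact: mle.
  by rewrite !(cum_high AD) // ltW.
apply/ler_normlP; split; last lra.
rewrite leNgt; apply/negP => Dw.
have [d' d'0 Hd'] := Hw 2^-1 (ltac:(by rewrite invr_gt0)).
pose h' := Num.min (d' / 2) (- D - w).
have h'0 : 0 < h' by rewrite lt_min; apply/andP; split; lra.
have hd' : h' < d' by rewrite gt_min; apply/orP; left; lra.
have hw : h' <= - D - w by rewrite ge_min lexx orbT.
have := Hd' h'; rewrite h'0 hd' => /(_ isT).
by rewrite !(cum_low AD) ?subrr; lra.
Qed.

Definition periodic_tiling (I : finType) (b : I -> R) (N : R) :=
  {ae mu, forall x, exists! z : I * int, A (x - b z.1 - z.2%:~R * N)}.

Section Sequence.
Variables (t : nat -> R) (ga : R).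
Hypothesis ga0 : 0 < ga.
Hypothesis gaps : forall n, ga <= t n.+1 - t n.
Hypothesis disj : {ae mu, forall x, forall n k, A (x - t n) -> A (x - t k) -> n = k}.
Hypothesis cover : {ae mu, forall x, t 0%N + D <= x -> exists n, A (x - t n)}.

Let gapn i j : (i <= j)%N -> (j - i)%:R * ga <= t j - t i.
Proof. by move=> ij; exact: gaps_sum (fun k _ => gaps k) ij (leqnn j). Qed.

Let tle i j : (i <= j)%N -> t i <= t j.
Proof.
by move=> ij; rewrite -subr_ge0; apply: le_trans (gapn ij); rewrite mulr_ge0 // ltW.
Qed.

Let lt_index i j : t i < t j -> (i < j)%N.
Proof. by move=> h; rewrite ltnNge; apply/negP => /tle; rewrite leNgt h. Qed.

Let gap_le n : t n.+1 - t n <= 2 * D.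
Proof.
rewrite leNgt; apply/negP => h.
have lt : t n + D < t n.+1 - D by lra.
have [x /andP[x1 x2] cx] := ae_exists lt cover.
have [|k /AD] := cx.
  by apply: le_trans (ltW x1); rewrite lerD2r tle.
rewrite ltr_norml => /andP[k1 k2].
have /lt_index k3 : t n < t k by lra.
have /lt_index k4 : t k < t n.+1 by lra.
nlia.
Qed.

Let range_le n k : t (n + k)%N - t n <= k%:R * (2 * D).
Proof.
elim: k => [|k IH]; first by rewrite addn0 subrr mul0r.
rewrite addnS -[in leRHS]addn1 natrD mulrDl mul1r; have := gap_le (n + k)%N; lra.
Qed.

Let window n W : tiles_on m (fun i : 'I_W.+1 => t (n + i)%N) (t n + D) (t (n + W)%N - D).
Proof.
apply: tiles_onP; apply: ae_mono2 disj cover => x dx cx /andP[x1 x2].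
have [|k Ak] := cx; first by apply: le_trans (ltW x1); rewrite lerD2r tle.
have := AD Ak; rewrite ltr_norml => /andP[k1 k2].
have k3 : (n < k)%N by apply: lt_index; lra.
have k4 : (k <= n + W)%N.
  by rewrite -ltnS; apply: lt_index; apply: lt_le_trans (tle (leqnSn _)); lra.
have kW : (k - n < W.+1)%N by nlia.
exists (Ordinal kW); split=> /=; first by rewrite subnKC // ltnW.
by move=> j Aj; apply: val_inj => /=; rewrite (dx _ _ Ak Aj) addKn.
Qed.

(* Quantized windows repeat, and by isolation the repetition is exact. *)
Lemma repeated_window r : exists q p, [/\ (r < p)%N &
  forall k, (k <= r)%N -> t (q + p + k)%N - t (q + p)%N = t (q + k)%N - t q].
Proof.
pose l := Num.bound ((2 * D + 1) / ga).
have lga : 2 * D + 1 <= l%:R * ga.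
  rewrite -ler_pdivrMr //; apply/ltW/archi_boundP/divr_ge0; last exact: ltW.
  by move: D0; lra.
pose e : R := (32 * 2 ^+ l)^-1.
have e0 : 0 < e by rewrite invr_gt0 mulr_gt0 // exprn_gt0.
have el : 16 * e * 2 ^+ l <= 2^-1.
  have p0 : 2 ^+ l != 0 :> R by rewrite expf_neq0.
  by rewrite /e le_eqVlt; apply/orP; left; apply/eqP; field; rewrite p0.
have g2 : 0 < ga / 2 by rewrite divr_gt0.
have [u1 [u1m u1D] /(_ e e0)[d1 d10 dn1]] := density_low g2.
have [u2 [u2m u2D] /(_ e e0)[d2 d20 dn2]] := density_high g2.
pose d := Num.min d1 d2.
have d0 : 0 < d by rewrite lt_min d10.
have dnn1 : dense_at m u1 e d.
  by move=> h /andP[h0 hd]; apply: dn1; rewrite h0 (lt_le_trans hd) // ge_min lexx.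
have dnn2 : dense_at m u2 e d.
  by move=> h /andP[h0 hd]; apply: dn2; rewrite h0 (lt_le_trans hd) // ge_min lexx orbT.
pose eps := Num.min (d / 2) (Num.min 1 (ga / 2)).
have eps0 : 0 < eps by rewrite !lt_min; apply/and3P; split; lra.
have epsd : eps < d by rewrite gt_min; apply/orP; left; lra.
have eps1 : eps <= 1 by rewrite !ge_min lexx !orbT.
have epsg : eps <= ga / 2 by rewrite !ge_min lexx !orbT.
(* Isolation needs a radius above [l], the conclusion one of at least [r]. The windows start at
   multiples of [r.+1], so that two different ones are more than [r] apart. *)
pose r' := (r + l).+1.
pose c := (3 * l + r' + 1)%N; pose W := (c + c)%N.
pose pos n := (n * r.+1)%N.
(* The cells have width [eps / 2], because aligning two windows at [c] rather than at their first
   index combines two such errors. *)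
pose v n (i : 'I_W.+1) := Num.truncn ((t (pos n + i)%N - t (pos n)) / (eps / 2)).
pose M := (Num.truncn (W%:R * (2 * D) / (eps / 2))).+1.
have vM n i : (v n i < M)%N.
  rewrite ltnS; apply: le_truncn; rewrite ler_pM2r ?invr_gt0; last lra.
  apply: le_trans (range_le _ _) _; rewrite ler_pM2r ?ler_nat; last by rewrite mulr_gt0.
  by have := ltn_ord i; nlia.
have [n1 [n2 [n12 E]]] := pigeonhole (fun n => [ffun i => Ordinal (vM n i)]).
have vE i : v n1 i = v n2 i by move/ffunP/(_ i): E; rewrite !ffunE => /(congr1 val).
pose q1 := pos n1; pose q2 := pos n2.
have q12 : (q1 + r < q2)%N.
  rewrite /q1 /q2 /pos; have : (n1.+1 * r.+1 <= n2 * r.+1)%N by rewrite leq_mul2r n12 orbT.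
  by rewrite mulSn; nlia.
have vd i : (i <= W)%N -> `|(t (q2 + i)%N - t q2) - (t (q1 + i)%N - t q1)| <= eps / 2.
  move=> iW; have iW' : (i < W.+1)%N by nlia.
  have := vE (Ordinal iW'); rewrite /v /= -/q1 -/q2.
  set x1 := t (q1 + i)%N - _; set x2 := t (q2 + i)%N - _ => X.
  have ep : 0 < eps / 2 by lra.
  have x10 : 0 <= x1 / (eps / 2).
    by rewrite divr_ge0 ?(ltW ep) // subr_ge0 tle // leq_addr.
  have x20 : 0 <= x2 / (eps / 2).
    by rewrite divr_ge0 ?(ltW ep) // subr_ge0 tle // leq_addr.
  have /andP[a1 b1] := truncn_itv x10; have /andP[a2 b2] := truncn_itv x20.
  rewrite X in a1 b1; move: a1 b1 a2 b2.
  set k := Num.truncn _; rewrite -(addn1 k) natrD ler_pdivlMr // ltr_pdivrMr //.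
  rewrite ler_pdivlMr // ltr_pdivrMr // !mulrDl mul1r => *.
  by apply/ler_normlP; split; lra.
pose tau := t (q2 + c)%N - t (q1 + c)%N.
pose a i := t (q1 + i)%N; pose sg i := t (q2 + i)%N - tau - t (q1 + i)%N.
have cW : (c <= W)%N by rewrite /W; nlia.
have sge i : (i <= W)%N -> `|sg i| <= eps.
  move=> iW; have := vd i iW; have := vd c cW.
  move=> /ler_normlP[? ?] /ler_normlP[? ?]; apply/ler_normlP; rewrite /sg /tau; split; lra.
have sgc : sg c = 0 by rewrite /sg /tau; ring.
have iso : forall i, (c <= i + r')%N -> (i <= c + r')%N -> sg i = 0.
  have sg0 := sge 0%N (leq0n _); have sgW := sge W (leqnn _).
  move/ler_normlP: sg0 => [z1 z2]; move/ler_normlP: sgW => [z3 z4].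
  apply: (@isolation _ m D mle mlip _ _ ga u1 u2 e d l ga0 e0 lga el u1D u2D dnn1 dnn2 u1m u2m
     r' c W a sg eps) => //.
  - by move=> y yD; rewrite !(cum_low AD).
  - by move=> y yD; rewrite !(cum_high AD).
  - by rewrite /r'; nlia.
  - by move=> i iW; rewrite /a addnS; apply: gaps.
  - by apply: tiles_on_sub (@window q1 W); rewrite /a ?addn0; lra.
  - have := tiles_on_shift (tau := - tau) (@window q2 W).
    rewrite (_ : (fun i : 'I_W.+1 => t (q2 + i)%N + - tau) = fun i : 'I_W.+1 => a i + sg i); last first.
      by apply/funext => i; rewrite /a /sg; ring.
    by apply: tiles_on_sub; move: z1 z2 z3 z4; rewrite /a /sg ?addn0; lra.
exists (q1 + c)%N, (q2 - q1)%N; split; first by nlia.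
move=> k kr.
have -> : (q1 + c + (q2 - q1) + k = q2 + (c + k))%N by nlia.
have -> : (q1 + c + (q2 - q1) = q2 + c)%N by nlia.
have : sg (c + k)%N = 0 by apply: iso; rewrite /r'; nlia.
by rewrite /sg /tau -addnA; lra.
Qed.

(** The repeated stretch of [r] steps is at least [2 * D] long. Hence on the period that starts at
    [t q + D], the translates of index [q] to [q + p - 1], together with the copies of the first
    [r.+1] of them moved by [N], act exactly as [t] does; moving by multiples of [N] extends this to
    the line. No periodicity of [t] itself is claimed. *)
Lemma sequence_periodic :
  exists p (b : 'I_p -> R) N, [/\ (0 < p)%N, 0 < N & periodic_tiling b N].
Proof.
pose r := Num.bound (2 * D / ga).
have rga : 2 * D <= r%:R * ga.
  rewrite -ler_pdivrMr //; apply/ltW/archi_boundP/divr_ge0; last exact: ltW.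
  by rewrite mulr_ge0 // ltW.
have [q [p [rp rep]]] := repeated_window r.
have [N NE] : exists N, t (q + p)%N = t q + N by exists (t (q + p)%N - t q); ring.
have ND : 2 * D <= N.
  have -> : N = t (q + p)%N - t q by rewrite NE; ring.
  apply: le_trans (gapn (leq_addr p q)); apply: le_trans rga _.
  by rewrite ler_pM2r // ler_nat; nlia.
have N0 : 0 < N by apply: lt_le_trans ND; rewrite mulr_gt0.
have wide i j : (i + r <= j)%N -> 2 * D <= t j - t i.
  move=> ij; have ij' : (i <= j)%N by nlia.
  apply: le_trans (gapn ij'); apply: le_trans rga _.
  by rewrite ler_pM2r // ler_nat; nlia.
pose b (j : 'I_p) := t (q + j)%N.
have base : {ae mu, forall x, t q + D <= x < t (q + p)%N + D ->
    exists! z : 'I_p * int, A (x - b z.1 - z.2%:~R * N)}.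
  apply: ae_mono2 disj cover => x; change (R : Type) in x => dx cx /andP[x1 x2].
  have key (j : 'I_p) (k : int) : A (x - b j - k%:~R * N) ->
      k = 0 /\ A (x - t (q + j)%N) \/ [/\ k = 1, (j <= r)%N & A (x - t (q + p + j)%N)].
    move=> Aj; have /ltr_normlP[j1 j2] := AD Aj.
    have b1 : t q <= b j by apply: tle; nlia.
    have b2 : b j < t (q + p)%N.
      rewrite -subr_gt0; apply: lt_le_trans ga0 (le_trans _ (gapn _)); last first.
        by have := ltn_ord j; nlia.
      rewrite -[leLHS]mul1r ler_pM2r // ler1n.
      by have := ltn_ord j; nlia.
    have [k0|k0] := ltP k 0.
      have kN : k%:~R * N <= - N.
        rewrite -mulN1r ler_pM2r // -[leRHS](mulrNz 1 1) ler_int; move: k0; clear; lia.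
      exfalso; move: D0 j1 j2 kN; set y := k%:~R * N => D0' j1 j2 kN; rewrite NE in b2.
      have f1 : t q < b j + y by lra.
      have f2 : b j + y < t q by lra.
      by move: f1; rewrite ltNge (ltW f2).
    have [k2|k2] := leP 2 k.
      have kN : 2 * N <= k%:~R * N.
        by rewrite ler_pM2r // -[leLHS]/(2%:~R) ler_int.
      exfalso; move: D0 j1 j2 kN; set y := k%:~R * N => D0' j1 j2 kN; rewrite NE in x2.
      have f1 : b j + y < t q + N + 2 * D by lra.
      have f2 : t q + N + 2 * D <= b j + y by lra.
      by move: f1; rewrite ltNge f2.
    have [k1|k1] : k = 0 \/ k = 1 by move: k0 k2; clear; lia.
      by left; move: Aj; rewrite k1 mul0r subr0.
    right; move: j1 j2 Aj; rewrite k1 mul1r => j1 j2 Aj.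
    have jr : (j <= r)%N.
      rewrite leqNgt; apply/negP => rj.
      have : 2 * D <= b j - t q by apply: wide; nlia.
      lra.
    split=> //; have E := rep j jr; congr (A _) : Aj; move: E; rewrite /b; lra.
  have [|n An] := cx; first by apply: le_trans x1; rewrite lerD2r tle.
  have /ltr_normlP[n1 n2] := AD An.
  have qn : (q < n)%N by apply: lt_index; lra.
  have [z Az] : exists z : 'I_p * int, A (x - b z.1 - z.2%:~R * N).
    have [np|np] := ltnP n (q + p)%N.
      have jp : (n - q < p)%N by nlia.
      by exists (Ordinal jp, 0); rewrite /= mul0r subr0 /b /= subnKC // ltnW.
    have jr : (n - (q + p) <= r)%N.
      rewrite leqNgt; apply/negP => rj.
      have : 2 * D <= t n - t (q + p)%N by apply: wide; nlia.
      lra.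
    have jp : (n - (q + p) < p)%N by nlia.
    exists (Ordinal jp, 1); rewrite /= mul1r.
    have := rep _ jr; rewrite subnKC // => E.
    by rewrite (_ : _ - _ - _ = x - t n) // /b /=; move: E; lra.
  exists z; split=> // z' Az'.
  case: z z' Az Az' => [j k] [j' k'] /= Az Az'.
  have jp := ltn_ord j; have jp' := ltn_ord j'.
  have [[-> a1]|[-> _ a1]] := key _ _ Az; have [[-> a2]|[-> _ a2]] := key _ _ Az';
    have := dx _ _ a1 a2; first [move=> h; exfalso; nlia | move=> /addnI/val_inj->//].
exists p, b, N; split => //; first by nlia.
have allz := ae_forall_int (fun z : int => ae_shift (z%:~R * N) base).
apply: ae_mono allz => x hx.
pose z := Num.floor ((x - (t q + D)) / N).
have /andP[z1 z2] := floor_itv ((x - (t q + D)) / N).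
move: z1 z2; rewrite -/z ler_pdivlMr // ltr_pdivrMr // intrD mulrDl mul1r => z1 z2.
have [|[j k] [/= Aj U]] := hx z; first by apply/andP; split; lra.
exists (j, k + z); split=> /=.
  by congr (A _): Aj; rewrite intrD; ring.
move=> [j' k'] /= Aj'.
have Az : A (x - z%:~R * N - b j' - (k' - z)%:~R * N).
  by congr (A _): Aj'; rewrite intrB; ring.
by have [-> ->] := U (j', k' - z) Az; rewrite subrK.
Qed.

End Sequence.
(** Around a point of density at least 7/8, two translates less than [d / 4] apart would exceed full
    density on a window of length [d]. *)
Lemma translates_apart : exists2 ga, 0 < ga & forall t u,
  {ae mu, forall x, ~ (A (x - t) /\ A (x - u))} -> ga <= `|t - u|.
Proof.
have [w _ /(_ 8^-1)] := density_low ltr01.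
rewrite invr_gt0 => /(_ (ltr0n _ _)) [d d0 dn].
exists (d / 4); first by rewrite divr_gt0.
move=> t u h.
have h1 : {ae mu, forall x, t + w - d / 2 < x <= t + w + d / 2 -> cnt A [:: t; u] x <= 1}.
  apply: ae_mono h => x hx _; rewrite /cnt big_cons big_seq1 !indicE.
  by case: (boolP (x - t \in A)) => a1; case: (boolP (x - u \in A)) => a2;
    rewrite ?addr0 ?add0r //; case: hx; split; apply/set_mem.
have ab : t + w - d / 2 <= t + w + d / 2 by lra.
have := cnt_le_itv mA AD ab h1; rewrite big_cons big_seq1.
have hd : 0 < d / 2 < d by apply/andP; split; lra.
have := dn _ hd.
have -> : t + w + d / 2 - t = w + d / 2 by ring.
have -> : t + w - d / 2 - t = w - d / 2 by ring.
have -> : t + w + d / 2 - u = w + d / 2 + (t - u) by ring.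
have -> : t + w - d / 2 - u = w - d / 2 + (t - u) by ring.
set dl := t - u.
have lip x : `|m (x + dl) - m x| <= `|dl|.
  have [g|g] := leP 0 dl.
    have l1 : m x <= m (x + dl) by apply: mle; lra.
    have l2 : m (x + dl) - m x <= x + dl - x by apply: mlip; lra.
    by rewrite (ger0_norm g) ger0_norm ?subr_ge0 //; move: l2; lra.
  have l1 : m (x + dl) <= m x by apply: mle; lra.
  have l2 : m x - m (x + dl) <= x - (x + dl) by apply: mlip; lra.
  by rewrite (ltr0_norm g) ler0_norm ?subr_le0 //; move: l2; lra.
have /ler_normlP[p1 p2] := lip (w + d / 2).
have /ler_normlP[p3 p4] := lip (w - d / 2).
move: p1 p2 p3 p4; set nd := `|dl|; lra.
Qed.

Section FromSet.
Variables (F T : set R).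
Hypothesis FD : forall x, F x -> `|x| < D.
Hypothesis FA : {ae mu, forall x, F x -> A x}.
Hypothesis T_disj : forall t u, T t -> T u -> t != u ->
  {ae mu, forall x, ~ (A (x - t) /\ A (x - u))}.
Hypothesis T_cover : {ae mu, forall x, exists t, T t /\ F (x - t)}.

(** Only the translates to the right of a chosen one are listed, which is enough for comparing
    windows further and further to the right. *)
Lemma tiling_sequence : exists (t : nat -> R) ga, [/\ 0 < ga,
  forall n, ga <= t n.+1 - t n,
  {ae mu, forall x, forall n k, A (x - t n) -> A (x - t k) -> n = k} &
  {ae mu, forall x, t 0%N + D <= x -> exists n, A (x - t n)}].
Proof.
have [ga ga0 apart] := translates_apart.
have gapT t u : T t -> T u -> t < u -> ga <= u - t.
  move=> Tt Tu tu; have := apart t u (T_disj Tt Tu (ltac:(by rewrite lt_eqF))).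
  by rewrite distrC gtr0_norm // subr_gt0.
have above K : exists2 t, T t & K < t.
  have KD : K + D < K + D + 1 by lra.
  have [x /andP[x1 _] [t [Tt /FD/ltr_normlP[_ h]]]] := ae_exists KD T_cover.
  by exists t => //; move: x1 h; lra.
(* Elements of [T] are at least [ga] apart, so descending from any element beyond [t] stops. *)
have next t : exists u, [/\ T u, t < u & forall v, T v -> t < v -> u <= v].
  have [u Tu tu] := above t.
  have [n] : exists n : nat, u - t < n%:R * ga.
    exists (Num.bound ((u - t) / ga)); rewrite -ltr_pdivrMr //.
    by apply: archi_boundP; rewrite divr_ge0 ?(ltW ga0) // subr_ge0 ltW.
  elim: n u Tu tu => [|n IH] u Tu tu h.
    by exfalso; move: h; rewrite mul0r subr_lt0 => h; move: (lt_trans h tu); rewrite ltxx.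
  have [[v [Tv tv vu]]|nv] := pselect (exists v, [/\ T v, t < v & v < u]).
    apply: (IH v) => //; have := gapT _ _ Tv Tu vu.
    by move: h; rewrite -(addn1 n) natrD mulrDl mul1r; lra.
  exists u; split => // v Tv tv; rewrite leNgt; apply/negP => vu.
  by apply: nv; exists v.
have /choice[nx nxP] := next.
have [t0 Tt0 _] := above 0.
pose t n := iter n nx t0.
have Tt n : T (t n) by case: n => //= n; have [] := nxP (t n).
have gaps n : ga <= t n.+1 - t n.
  by apply: gapT => //=; have [] := nxP (t n).
have tge n k : (n <= k)%N -> (k - n)%:R * ga <= t k - t n.
  by move=> nk; exact: gaps_sum (fun k _ => gaps k) nk (leqnn k).
have tlt n k : (n < k)%N -> t n < t k.
  move=> nk; rewrite -subr_gt0; apply: lt_le_trans (tge _ _ (ltnW nk)).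
  by rewrite mulr_gt0 // ltr0n subn_gt0.
have tall u : T u -> t 0%N <= u -> exists n, u = t n.
  move=> Tu u0.
  have [n] : exists n : nat, u < t n.
    exists (Num.bound ((u - t 0%N) / ga)); set n := Num.bound _.
    have : (u - t 0%N) / ga < n%:R.
      by apply: archi_boundP; rewrite divr_ge0 ?(ltW ga0) // subr_ge0.
    rewrite ltr_pdivrMr //; have := tge 0%N n (leq0n _); rewrite subn0; lra.
  elim: n => [|n IH] h; first by move: (lt_le_trans h u0); rewrite ltxx.
  have [/IH//|h2] := ltP u (t n).
  move: h2; rewrite le_eqVlt => /orP[/eqP <-|h2]; first by exists n.
  have [_ _ /(_ u Tu h2)] := nxP (t n); rewrite leNgt => /negP; case.
  exact: h.
exists t, ga; split => //.
  have h : {ae mu, forall x, forall n k, n != k -> ~ (A (x - t n) /\ A (x - t k))}.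
    apply: ae_foralln => n; apply: ae_foralln => k.
    have [nk|nk] := eqVneq n k; first exact: aeW.
    have tnk : t n != t k.
      have [/tlt h|/tlt h|nk'] := ltngtP n k; [by rewrite lt_eqF|by rewrite gt_eqF|].
      by move: nk; rewrite nk' eqxx.
    exact: ae_mono (T_disj (Tt n) (Tt k) tnk).
  apply: ae_mono h => x hx n k An Ak; apply/eqP; apply: contrapT => /negP nk.
  exact: hx nk (conj An Ak).
have h : {ae mu, forall x, forall n, F (x - t n) -> A (x - t n)}.
  by apply: ae_foralln => n; apply: (ae_shift (t n) FA).
apply: ae_mono2 h T_cover => x hx [u [Tu Fu]] xD.
have [|n un] := tall u Tu; first by have /ltr_normlP[_] := FD Fu; lra.
by exists n; apply: hx; rewrite -un.
Qed.

Lemma real_tiling_periodic :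
  exists p (b : 'I_p -> R) N, [/\ (0 < p)%N, 0 < N & periodic_tiling b N].
Proof.
have [t [ga [ga0 gaps disj cover]]] := tiling_sequence.
exact: sequence_periodic ga0 gaps disj cover.
Qed.

End FromSet.
End PeriodicTiling.

(** * Commensurability of the translates *)

Section Operators.

Lemma iter_binomial (W : zmodType) (U V : W -> W) n g :
  {morph U : x y / x + y} -> {morph V : x y / x + y} -> (forall w, U (V w) = V (U w)) ->
  iter n (fun w => U w + V w) g =
    \sum_(i < n.+1) iter (n - i) U (iter i V g) *+ 'C(n, i).
Proof.
move=> Ua Va UV.
have U0 : U 0 = 0 by apply: (addrI (U 0)); rewrite -Ua !addr0.
have V0 : V 0 = 0 by apply: (addrI (V 0)); rewrite -Va !addr0.
have Um w k : U (w *+ k) = U w *+ k.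
  by elim: k => [|k IH]; rewrite ?mulr0n // !mulrS Ua IH.
have Vm w k : V (w *+ k) = V w *+ k.
  by elim: k => [|k IH]; rewrite ?mulr0n // !mulrS Va IH.
have UiV k w : V (iter k U w) = iter k U (V w).
  by elim: k => //= k IH; rewrite -UV IH.
elim: n => [|n IH]; first by rewrite big_ord_recl big_ord0 /= addr0.
rewrite iterS IH (big_morph U Ua U0) (big_morph V Va V0).
rewrite [in LHS]big_ord_recl [X in _ + X]big_ord_recr.
rewrite [RHS]big_ord_recl [X in _ = _ + X]big_ord_recr /=.
rewrite !bin0 !binn !mulr1n !subn0 !subnn /= -!addrA; congr (_ + _).
rewrite addrA; congr (_ + _); rewrite -big_split /=; apply: eq_bigr => i _.
rewrite /bump /= !add1n subSS Um Vm UiV /= binS mulrnDr -[U (iter _ U _)]iterS.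
by rewrite -subSn // subSS.
Qed.

Lemma iter_prime_add (W : zmodType) (U V : W -> W) q g :
  prime q -> (forall w : W, w *+ q = 0) ->
  {morph U : x y / x + y} -> {morph V : x y / x + y} -> (forall w, U (V w) = V (U w)) ->
  iter q (fun w => U w + V w) g = iter q U g + iter q V g.
Proof.
move=> pq Wq Ua Va UV; rewrite iter_binomial //.
case: q pq Wq => // q pq Wq.
rewrite big_ord_recl big_ord_recr /= bin0 mulr1n.
rewrite big1 ?add0r; last first.
  move=> i _; have /dvdnP[k ->] : (q.+1 %| 'C(q.+1, bump 0 i))%N.
    by apply: prime_dvd_bin => //; rewrite /bump /= add1n ltnS ltn_ord.
  by rewrite mulrnA Wq.
by rewrite /bump /= add1n subnn binn mulr1n.
Qed.

Definition tsum (G F : zmodType) (s : seq G) (g : G -> F) : G -> F :=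
  fun x => \sum_(b <- s) g (x - b).

(* Frobenius for sums of commuting translations. *)
Lemma iter_tsum (G F : zmodType) (s : seq G) q (g : G -> F) :
  prime q -> (forall a : F, a *+ q = 0) ->
  iter q (tsum s) g = tsum [seq b *+ q | b <- s] g.
Proof.
move=> pq Fq; elim: s g => [|b s IH] g.
  case: q pq {Fq} => // q _; rewrite iterS.
  by apply/funext => x; rewrite /tsum !big_nil.
pose U (g : G -> F) : G -> F := fun x => g (x - b).
have -> : tsum (b :: s) = (fun w : G -> F => U w + tsum s w).
  by apply/funext => w; apply/funext => x; rewrite /tsum big_cons.
rewrite iter_prime_add //.
- rewrite IH; apply/funext => x; rewrite [RHS]big_cons; congr (_ + _).
  suff -> k : iter k U g = fun x => g (x - b *+ k) by [].
  elim: k => [|k IHk]; first by apply/funext => y; rewrite /= subr0.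
  rewrite iterS IHk; apply/funext => y; rewrite /U mulrS opprD addrA.
  by congr (g _); rewrite addrAC.
- move=> w; apply/funext => x; rewrite -[RHS](Fq (w x)).
  by elim: (q) => // k IHk; rewrite !mulrS -IHk.
- by move=> v w; apply/funext => x; exact: big_split.
- by move=> w; apply/funext => x; apply: eq_bigr => c _; congr (w _); rewrite addrAC.
Qed.

End Operators.

Section Rationality.
Variable R : realType.
Local Notation mu := (@lebesgue_measure R).
Local Notation mT := (measurableTypeR R).

Lemma ae_const_tsum (F : fieldType) (s : seq R) (g : R -> F) (c : F) :
  {ae mu, forall x, g x = c} -> {ae mu, forall x, tsum s g x = c *+ size s}.
Proof.
move=> gc; have : {ae mu, forall x, forall b, b \in s -> g (x - b) = c}.
  by apply: ae_all_seq => b _; apply: (ae_shift b gc).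
apply: ae_mono => x hx; rewrite /tsum big_seq (eq_bigr (fun=> c)) //.
by rewrite -big_seq big_const_seq count_predT iter_addr_0.
Qed.

Lemma ae_tsum_prime (F : fieldType) (q : nat) (s : seq R) (g : R -> F) (c : F) :
  q \in [pchar F] -> {ae mu, forall x, tsum s g x = c} ->
  {ae mu, forall x, tsum [seq b *+ q | b <- s] g x = c *+ size s ^ q.-1}.
Proof.
move=> qF h; have pq := pcharf_prime qF.
rewrite -iter_tsum //; last by move=> a; rewrite -mulr_natr (pcharf0 qF) mulr0.
rewrite -(prednK (prime_gt0 pq)) /=.
elim: q.-1 => [|k IH]; first by rewrite expn0 mulr1n.
rewrite expnSr mulrnA; exact: ae_const_tsum IH.
Qed.

Lemma ae_tsum_prime_power (F : fieldType) (q n : nat) (s : seq R) (g : R -> F) (c : F) :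
  q \in [pchar F] -> (size s)%:R != 0 :> F -> c != 0 ->
  {ae mu, forall x, tsum s g x = c} ->
  {ae mu, forall x, tsum [seq b *+ q ^ n | b <- s] g x != 0}.
Proof.
move=> qF s0 c0 h.
suff [c' c'0 h'] : exists2 c', c' != 0 &
    {ae mu, forall x, tsum [seq b *+ q ^ n | b <- s] g x = c'}.
  by apply: ae_mono h' => x ->.
elim: n => [|n [c' c'0 h']].
  by exists c => //; rewrite expn0 (eq_map (g := id)) ?map_id.
have := ae_tsum_prime qF h'; rewrite -map_comp size_map => h2.
exists (c' *+ size s ^ q.-1).
  by rewrite -mulr_natr natrX mulf_neq0 // expf_neq0.
rewrite (eq_map (g := (fun b : R => b *+ q) \o (fun b => b *+ q ^ n))) //.
by move=> b /=; rewrite -mulrnA expnSr.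
Qed.

Section Tiling.
Variables (A : set mT) (D : R).
Hypothesis mA : measurable A.
Hypothesis AD : forall x, A x -> `|x| < D.
Hypothesis A0 : cum A (- D) < cum A D.
Local Notation m := (cum A).
Let mle := cum_le mA AD.
Let mlip := cum_lip mA AD.

(* Tijdeman's argument on the line, with the functions [R -> 'F_q] in place of
   the group ring. *)
Lemma multiple_covers (I : finType) (b : I -> R) N q n :
  periodic_tiling A b N -> prime q -> ~~ (q %| #|I|)%N ->
  {ae mu, forall x, exists z : I * int, A (x - b z.1 *+ q ^ n - z.2%:~R * N)}.
Proof.
move=> tl pq qI.
have qF : q \in [pchar 'F_q] by exact: pchar_Fp.
pose P (x : R) := exists k : int, A (x - k%:~R * N).
pose g (x : R) : 'F_q := if `[< P x >] then 1 else 0.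
pose s := [seq b i | i <- enum I].
have sz : size s = #|I| by rewrite size_map cardE.
have s0 : (size s)%:R != 0 :> 'F_q by rewrite sz -(dvdn_pcharf qF).
have h : {ae mu, forall x, tsum s g x = 1}.
  apply: ae_mono tl => x [[i k] [/= Ai U]].
  rewrite /tsum /s big_map big_enum (bigD1 i) //= big1 ?addr0.
    by rewrite /g asboolT //; exists k.
  move=> j ji; rewrite /g asboolF // => -[k' Aj].
  by have [ij _] := U (j, k') Aj; rewrite ij eqxx in ji.
have := ae_tsum_prime_power n qF s0 (oner_neq0 _) h.
apply: ae_mono => x; rewrite -map_comp /tsum big_map big_enum => hx.
have [i gi] : exists i, g (x - b i *+ q ^ n) != 0.
  apply: contrapT => ng; move/eqP: hx; apply; apply: big1 => i _.
  by apply/eqP; apply: contrapT => /negP gi; apply: ng; exists i.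
move: gi; rewrite /g; case: asboolP => [[k Ak] _|]; last by rewrite eqxx.
by exists (i, k).
Qed.

(** The periodic family cut off to the shifts by [- K * N] up to [K * N], because [tiles_on] takes a
    finite index type. *)
Definition translates (I : finType) (c : I -> R) (N : R) (K : nat)
    (z : I * 'I_(K.*2.+1)) : R :=
  c z.1 + (z.2%:R - K%:R) * N.

(** Seen from consecutive shifts by [N], an interval of length [N] occupies adjacent positions, so
    for each [i] the increments telescope to the whole mass of the tile. *)
Lemma translates_telescope (I : finType) (c : I -> R) (N C : R) K (x : R) : 0 < N ->
  (forall i, `|c i| <= C) -> D + C + `|x| <= K%:R * N ->
  \sum_z (m (x + N - translates c N (K := K) z) - m (x - translates c N z)) =
    #|I|%:R * (m D - m (- D)).
Proof.
move=> N0 cC KN.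
rewrite -(pair_bigA _ (fun i k => m (x + N - translates c N (K := K) (i, k)) -
   m (x - translates c N (i, k)))) /=.
rewrite mulr_natl -sumr_const; apply: eq_bigr => i _.
pose h k : R := - m (x + N - (c i + (k%:R - K%:R) * N)).
rewrite (eq_bigr (fun k : 'I_(K.*2.+1) => h k.+1 - h k)); last first.
  move=> k _; rewrite /h /translates /= opprK addrC; congr (- m _ + _).
  by rewrite -natr1; ring.
rewrite -(big_mkord xpredT (fun k => h k.+1 - h k)) telescope_sumr // /h opprK addrC.
have /ler_normlP[c1 c2] := cC i.
have x1 := ler_norm x; have x2 := ler_norm (- x); rewrite normrN in x2.
have hi : D <= x + N - (c i + (0%:R - K%:R) * N).
  by move: KN; rewrite mulrBl mul0r; set y := K%:R * N; lra.
have lo : x + N - (c i + (K.*2.+1%:R - K%:R) * N) <= - D.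
  have -> : (K.*2.+1%:R - K%:R) * N = K%:R * N + N.
    by rewrite -natr1 -addnn natrD; ring.
  by move: KN; set y := K%:R * N; lra.
by rewrite (cum_high AD hi) (cum_high AD (lexx D)) (cum_low AD lo) (cum_low AD (lexx (- D))).
Qed.

Lemma periodic_tiling_density (I : finType) (b : I -> R) (N : R) : 0 < N ->
  periodic_tiling A b N -> #|I|%:R * (m D - m (- D)) <= N.
Proof.
move=> N0 tl.
pose C := \sum_i `|b i|.
have bC i : `|b i| <= C.
  by rewrite /C (bigD1 i) //= lerDl sumr_ge0 // => j _; exact: normr_ge0.
have D0 : 0 <= D.
  rewrite leNgt; apply/negP => D0; move: A0; rewrite ltNge mle //; lra.
have C0 : 0 <= C by apply: sumr_ge0 => i _; exact: normr_ge0.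
pose K := Num.bound ((D + C) / N).
have KN : D + C + `|0 : R| <= K%:R * N.
  rewrite normr0 addr0 -ler_pdivrMr //; apply/ltW/archi_boundP.
  by rewrite divr_ge0 ?(ltW N0) // addr_ge0.
rewrite -(translates_telescope N0 bC KN).
have h : {ae mu, forall x, 0 < x <= 0 + N ->
    cnt A [seq translates b N z | z <- enum {: I * 'I_(K.*2.+1)}] x <= 1}.
  apply: ae_mono tl => x [z0 [Az0 U]] _.
  have U' (z : I * 'I_(K.*2.+1)) : A (x - translates b N z) ->
      z0 = (z.1, z.2%:Z - K%:Z).
    move=> Az; apply: U => /=; congr (A _): Az.
    by rewrite /translates intrB /=; ring.
  rewrite /cnt big_map big_enum /=.
  have [[z Az]|nz] := pselect (exists z : I * 'I_(K.*2.+1), A (x - translates b N z)).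
    rewrite (bigD1 z) //= indicE mem_set // big1 ?addr0 // => z' zz'.
    rewrite indicE memNset // => Az'; move: zz'.
    have := U' _ Az; rewrite (U' _ Az') => -[e1 /addIr [e2]].
    by rewrite (_ : z' = z) ?eqxx //; case: z z' e1 e2 {Az Az'} => ? ? [? ?] /= -> /val_inj ->.
  by rewrite big1 // => z _; rewrite indicE memNset // => Az; apply: nz; exists z.
have h0 : 0 <= 0 + N by rewrite add0r ltW.
have := cnt_le_itv mA AD h0 h; rewrite big_map big_enum /= => E.
by apply: le_trans E _; rewrite add0r subr0.
Qed.

(* A covering whose density is that of a tiling has no overlaps. *)
Lemma cover_tiles_on (I : finType) (c : I -> R) (N al be : R) : 0 < N ->
  #|I|%:R * (m D - m (- D)) <= N ->
  {ae mu, forall x, exists z : I * int, A (x - c z.1 - z.2%:~R * N)} ->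
  exists K0, forall K, (K0 <= K)%N -> tiles_on m (translates c N (K := K)) al be.
Proof.
move=> N0 dens cov.
pose C := \sum_i `|c i|.
have cC i : `|c i| <= C.
  by rewrite /C (bigD1 i) //= lerDl sumr_ge0 // => j _; exact: normr_ge0.
have D0 : 0 <= D.
  rewrite leNgt; apply/negP => D0; move: A0; rewrite ltNge mle //; lra.
have C0 : 0 <= C by apply: sumr_ge0 => i _; exact: normr_ge0.
pose L := Num.bound (`|be - al| / N).
have LN : `|be - al| < L%:R * N.
  by rewrite -ltr_pdivrMr //; apply: archi_boundP; rewrite divr_ge0 // ltW.
have LN0 : 0 <= L%:R * N by rewrite mulr_ge0 // ltW.
pose X := `|al| + `|be| + L%:R * N.
have X0 : 0 <= X by rewrite !addr_ge0.
exists (Num.bound ((D + C + X) / N)) => K K0.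
have KN : D + C + X <= K%:R * N.
  rewrite -ler_pdivrMr //; apply: (@le_trans _ _ (Num.bound ((D + C + X) / N))%:R).
    by apply/ltW/archi_boundP; rewrite divr_ge0 ?(ltW N0) // !addr_ge0.
  by rewrite ler_nat.
pose S x y := \sum_z (m (y - translates c N (K := K) z) - m (x - translates c N z)).
have SD x y w : S x y + S y w = S x w.
  by rewrite /S -big_split /=; apply: eq_bigr => z _; ring.
have tele x : `|x| <= X -> S x (x + N) <= N.
  by move=> xX; rewrite /S (translates_telescope N0 cC) //; move: KN xX; lra.
have Sge x y : - X <= x -> x <= y -> y <= X -> y - x <= S x y.
  move=> xX xy yX.
  suff h : {ae mu, forall w, x < w <= y ->
      1 <= cnt A [seq translates c N z | z <- enum {: I * 'I_(K.*2.+1)}] w}.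
    by have := cnt_ge_itv mA AD xy h; rewrite big_map big_enum.
  apply: ae_mono cov => w [[i k] /= Aw] /andP[xw wy].
  have /ltr_normlP[w1 w2] := AD Aw; have /ler_normlP[c1 c2] := cC i.
  have k1 : - K%:R * N < k%:~R * N + N by move: w1 w2 KN; rewrite mulNr; lra.
  have k2 : k%:~R * N < K%:R * N + N by move: w1 w2 KN; lra.
  have {}k1 : (- K%:Z < k + 1)%R.
    by rewrite -(ltr_int R) rmorphN rmorphD /= -(ltr_pM2r N0) [ltRHS]mulrDl mul1r.
  have {}k2 : (k < K%:Z + 1)%R.
    by rewrite -(ltr_int R) rmorphD /= -(ltr_pM2r N0) [ltRHS]mulrDl mul1r.
  have kK : (absz (k + K%:Z)%R < K.*2.+1)%N by move: k1 k2; clear; lia.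
  rewrite /cnt big_map big_enum /= (bigD1 (i, Ordinal kK)) //= indicE mem_set; last first.
    congr (A _): Aw; rewrite /translates /=.
    have -> : (absz (k + K%:Z)%R)%:R = k%:~R + K%:R :> R.
      by rewrite natr_absz ger0_norm ?intrD //; move: k1 k2; clear; lia.
    ring.
  by rewrite lerDl sumr_ge0.
move=> x y ax xy yb; apply/le_anti/andP; split; last first.
  apply: Sge => //; rewrite /X.
    by have := ler_norm (- al); have := normr_ge0 be; rewrite normrN; lra.
  by have := ler_norm be; have := normr_ge0 al; lra.
have hb1 := ler_norm (- al); have hb2 := ler_norm be; rewrite normrN in hb1.
have hb3 := normr_ge0 al; have hb4 := normr_ge0 be; have hb5 := ler_norm (be - al).
(* Whole periods bound the mass from above, while covering bounds it from below on every interval.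
   The upper bound from [x] to [x + L * N] minus the lower bound from [y] on gives the upper bound
   from [x] to [y]. *)
have iterS n : (n <= L)%N -> S x (x + n%:R * N) <= n%:R * N.
  elim: n => [|n IH] nL; first by rewrite mul0r addr0 /S big1 // => z _; rewrite subrr.
  rewrite -(SD _ (x + n%:R * N)).
  have nN : 0 <= n%:R * N by rewrite mulr_ge0 // ltW.
  have nLN : n%:R * N <= L%:R * N by rewrite ler_pM2r // ler_nat ltnW.
  have -> : n.+1%:R * N = n%:R * N + N by rewrite -addn1 natrD; ring.
  apply: lerD; first by apply: IH; rewrite ltnW.
  rewrite addrA; apply: tele; rewrite /X ler_norml; apply/andP; split; lra.
have := iterS L (leqnn L); rewrite -(SD _ y).
have := Sge y (x + L%:R * N); rewrite -/(S x y) /X.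
move=> h; have {h} := h (ltac:(lra)) (ltac:(lra)) (ltac:(lra)).
lra.
Qed.

(* Among the multiples of [b] by powers of [q], two are close modulo [N]. The
   flux of the deviation [sg] at its maximum shows that they are equal. *)
Lemma periodic_tiling_commensurable (I : finType) (b : I -> R) (N : R) (i0 : I) :
  0 < N -> b i0 = 0 -> periodic_tiling A b N ->
  exists2 Q : nat, (0 < Q)%N & forall i, exists z : int, b i * Q%:R = z%:~R * N.
Proof.
move=> N0 bi0 tl.
have dens := periodic_tiling_density N0 tl.
have [q qI pq] := prime_above #|I|.
have qnI : ~~ (q %| #|I|)%N.
  by rewrite gtnNdvd //; apply/card_gt0P; exists i0.
have [w [_ wD] /(_ 32^-1)] := density_low mA AD A0 ltr01.
rewrite invr_gt0 => /(_ (ltr0n _ _)) [d d0 dn].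
pose eps := Num.min (d / 2) 1.
have eps0 : 0 < eps by rewrite lt_min ltr01 andbT divr_gt0.
have epsd : eps < d by rewrite gt_min; apply/orP; left; lra.
have eps1 : eps <= 1 by rewrite ge_min lexx orbT.
pose k n i := Num.floor (b i *+ q ^ n / N).
pose c n i := b i *+ q ^ n - (k n i)%:~R * N.
have c0 n i : 0 <= c n i.
  have /andP[h _] := floor_itv (b i *+ q ^ n / N).
  by move: h; rewrite ler_pdivlMr // /c subr_ge0.
have cN n i : c n i < N.
  have /andP[_ h] := floor_itv (b i *+ q ^ n / N).
  by move: h; rewrite ltr_pdivrMr // intrD mulrDl mul1r /c ltrBlDl addrC.
have ci0 n : c n i0 = 0.
  by rewrite /c /k bi0 mul0rn mul0r floor0 mul0r subrr.
have cov n : {ae mu, forall x, exists z : I * int, A (x - c n z.1 - z.2%:~R * N)}.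
  apply: ae_mono (multiple_covers n tl pq qnI) => x [[i j] /= Ax].
  exists (i, j + k n i); congr (A _): Ax; rewrite /= /c intrD; ring.
pose v n i := Num.truncn (c n i / eps).
pose M := (Num.truncn (N / eps)).+1.
have vM n i : (v n i < M)%N.
  by rewrite ltnS; apply: le_truncn; rewrite ler_pM2r ?invr_gt0 // ltW.
have [n1 [n2 [n12 E]]] := pigeonhole (fun n => [ffun i => Ordinal (vM n i)]).
have vE i : v n1 i = v n2 i by move/ffunP/(_ i): E; rewrite !ffunE => /(congr1 val).
pose sg i := c n2 i - c n1 i.
have sge i : `|sg i| <= eps.
  have := vE i; rewrite /v => X.
  have x1 : 0 <= c n1 i / eps by rewrite divr_ge0 // ltW.
  have x2 : 0 <= c n2 i / eps by rewrite divr_ge0 // ltW.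
  have /andP[a1 b1] := truncn_itv x1; have /andP[a2 b2] := truncn_itv x2.
  rewrite X in a1 b1; move: a1 b1 a2 b2.
  set j := Num.truncn _; rewrite -(natr1 j) ler_pdivlMr // ltr_pdivrMr //.
  rewrite ler_pdivlMr // ltr_pdivrMr // !mulrDl mul1r => *.
  by apply/ler_normlP; rewrite /sg; split; lra.
have [K1 HK1] := cover_tiles_on (- D - 1) (N + D + 1) N0 dens (cov n1).
have [K2 HK2] := cover_tiles_on (- D - 1) (N + D + 1) N0 dens (cov n2).
pose K := maxn K1 K2.
have tl1 := HK1 K (leq_maxl _ _); have tl2 := HK2 K (leq_maxr _ _).
pose J : finType := (I * 'I_(K.*2.+1))%type.
pose t (z : J) := translates (c n1) N z; pose s (z : J) := sg z.1.
have {}tl2 : tiles_on m (fun z : J => t z + s z) (- D - 1) (N + D + 1).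
  rewrite (_ : (fun z : J => t z + s z) = translates (c n2) N (K := K)) //.
  by apply/funext => z; rewrite /t /s /sg /translates; ring.
have sg0 i : sg i = 0.
  pose j := [arg max_(j > i0) `|sg j|]%O.
  have jmax i' : `|sg i'| <= `|sg j|.
    by rewrite /j; case: arg_maxP => // j' _; apply.
  suff : `|sg j| <= 0.
    by move=> h; apply/eqP; rewrite -normr_eq0 -normr_le0 normr_id (le_trans (jmax i)).
  rewrite leNgt; apply/negP => sj.
  have fl i' : `|flux m t s (c n1 i' + w) + sg i'| <= 4 * 32^-1 * `|sg j|.
    have KK : (K < K.*2.+1)%N by rewrite -addnn ltnS leq_addr.
    have tE : t (i', Ordinal KK) = c n1 i' by rewrite /t /translates /= subrr mul0r addr0.
    have /ler_normlP[w1 w2] := wD; have := c0 n1 i'; have := cN n1 i' => h1 h2.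
    have sj1 := sge j.
    have := @flux_at _ m mle mlip _ t s (- D - 1) (N + D + 1) (i', Ordinal KK) w 32^-1 d `|sg j|.
    rewrite tE; apply => //.
    - exact: le_lt_trans (sge j) epsd.
    - by move: eps1 sj1; lra.
    - by move: eps1 sj1; lra.
    - by exact: jmax.
    - by move=> z _; left; exact: jmax.
  (* The translate [i0] does not move, so the flux is at most an eighth of the largest deviation
     [sg j]. At [j] the same flux equals [- sg j] up to an eighth, which is impossible unless
     [sg j = 0]; this is the reason for [32^-1]. *)
  have := fl j; have := fl i0; rewrite ci0 add0r /sg !ci0 subr0 addr0 -/(sg j).
  have -> : flux m t s w = flux m t s (c n1 j + w).
    have /ler_normlP[w1 w2] := wD; have := c0 n1 j; have := cN n1 j => h1 h2.
    by apply: (flux_const tl1 tl2); lra.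
  set P := flux _ _ _ _; move=> p1 p2.
  have := ler_normB (P + sg j) P.
  by rewrite [P + _]addrC addrK [sg j + _]addrC; move: p1 p2 sj; lra.
exists (q ^ n2 - q ^ n1)%N; first by rewrite subn_gt0 ltn_exp2l // prime_gt1.
move=> i; exists (k n2 i - k n1 i); have := sg0 i; rewrite /sg /c.
rewrite natrB; last by rewrite leq_exp2l ?prime_gt1 // ltnW.
by rewrite -(mulr_natr _ (q ^ n2)) -(mulr_natr _ (q ^ n1)) intrB => h; move: h; lra.
Qed.

(** In units of [u = N / Q] all translates become integers once one of them is moved to 0. Over
    almost every [x] the fiber of [A] is then a set of integers that tiles [Z] with the classes of
    the [z i] modulo [Q]. *)
Lemma real_tiling_rational (F T : set R) :
  (forall x, F x -> `|x| < D) -> {ae mu, forall x, F x -> A x} ->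
  (forall t u, T t -> T u -> t != u -> {ae mu, forall x, ~ (A (x - t) /\ A (x - u))}) ->
  {ae mu, forall x, exists t, T t /\ F (x - t)} ->
  exists p (z : 'I_p -> int) (Q : nat) (u : R), [/\ (0 < Q)%N, 0 < u &
    {ae mu, forall x, forall n : int, exists! y : 'I_p * int,
       A (x + (n - z y.1 - y.2 * Q%:Z)%:~R * u)}].
Proof.
move=> FD FA Td Tc.
have [p [b0 [N [p0 N0 tl0]]]] := real_tiling_periodic mA AD A0 FD FA Td Tc.
pose i0 := Ordinal p0; pose b i := b0 i - b0 i0.
have bi0 : b i0 = 0 by rewrite /b subrr.
have tl : periodic_tiling A b N.
  apply: ae_mono (ae_shift (- b0 i0) tl0) => x [y [Ay U]]; exists y; split.
    by congr (A _): Ay; rewrite /b; ring.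
  by move=> y' Ay'; apply: U; congr (A _): Ay'; rewrite /b; ring.
have [Q Q0 comm] := periodic_tiling_commensurable N0 bi0 tl.
have /choice[z zP] := comm.
have QR : Q%:R != 0 :> R by rewrite pnatr_eq0 -lt0n.
pose u := N / Q%:R.
have u0 : 0 < u by rewrite divr_gt0 // ltr0n.
have bE i : b i = (z i)%:~R * u by rewrite /u mulrA -zP mulfK.
have NE : N = Q%:R * u by rewrite /u mulrC divfK.
exists p, z, Q, u; split => //.
apply: ae_mono (ae_forall_int (fun n : int => ae_shift (- (n%:~R * u)) tl)) => x hx n.
have [y [Ay U]] := hx n.
have E y' : x - - (n%:~R * u) - b y'.1 - y'.2%:~R * N =
    x + (n - z y'.1 - y'.2 * Q%:Z)%:~R * u.
  rewrite bE NE !intrB intrM; set k1 := (n%:~R); set k2 := (z _)%:~R; set k3 := (y'.2)%:~R.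
  by rewrite -[(Q%:Z)%:~R]/(Q%:R); ring.
by exists y; split; [rewrite -E|move=> y'; rewrite -E; exact: U].
Qed.

End Tiling.
End Rationality.

(** * Completed Lebesgue measure *)

Section Completion.
Variable R : realType.
Local Notation mu := (@lebesgue_measure R).
Local Notation nu := (@completed_lebesgue_measure R).
Local Notation mT := (measurableTypeR R).
Local Notation lT := (lebesgueT R).

Lemma measurable_lebesgue (A : set mT) : measurable A -> measurable (A : set lT).
Proof. exact: sub_caratheodory. Qed.

Lemma measurable_fun_lebesgue d (T : measurableType d) (f : mT -> T) (F : set lT) :
  measurable_fun setT f -> measurable_fun F (f : lT -> T).
Proof.
move=> mf; apply: (@measurable_funS _ _ _ _ setT) => //.
by move=> _ Y mY; apply: measurable_lebesgue; exact: mf.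
Qed.

Lemma ae_lebesgue (P : R -> Prop) : {ae mu, forall x, P x} -> {ae nu, forall x, P x}.
Proof.
by move=> [N [mN N0 PN]]; exists N; split => //; exact: measurable_lebesgue.
Qed.

Lemma lebesgue_measurable_borel (F : set lT) : measurable F ->
  exists (A : set mT), [/\ measurable A, A `<=` F & mu.-negligible (F `\` A)].
Proof.
rewrite -[measurable F]/(@measurable _ (lebesgueT R) F) -completed_caratheodory_measurable.
rewrite g_sigma_completed_algebra_genE => -[A mA [N nN] <-].
exists A; split => //.
by apply: negligibleS nN => x [[Ax /(_ Ax)|]].
Qed.

Lemma negligible_borel (N : set R) : nu.-negligible N -> mu.-negligible N.
Proof.
move=> [M [mM M0 NM]].
have [A [mA AM nA]] := lebesgue_measurable_borel mM.
have A0 : mu A = 0%E.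
  apply/eqP; rewrite eq_le measure_ge0 andbT -M0; exact: le_outer_measure.
have nA' : mu.-negligible A by exists A; split.
have := negligibleU nA' nA; apply: negligibleS => x /NM Mx.
by have [|] := pselect (A x); [left|right].
Qed.

(** Serves both for the identity from the completed to the Borel structure and for translations. *)
Lemma integral_measure_preserving d (X : measurableType d) (m : {measure set X -> \bar R})
    (phi : X -> mT) (g : mT -> \bar R) :
  measurable_fun setT phi -> (forall B : set mT, measurable B -> m (phi @^-1` B) = mu B) ->
  mu.-integrable setT g -> (\int[m]_x g (phi x) = \int[mu]_x g x)%E.
Proof.
move=> mphi mp ig; have mg := measurable_int mu ig.
have E f : (\int[pushforward m phi]_x f x = \int[mu]_x f x)%E.
  by apply: eq_measure_integral => B mB _; exact: mp.
rewrite -E (@integral_pushforward _ _ X mT R phi mphi m setT g) ?preimage_setT //.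
apply/integrableP; split; first exact: measurableT_comp.
have := (@ge0_integral_pushforward _ _ X mT R phi mphi m setT (fun x => `|g x|)%E measurableT).
rewrite E preimage_setT => <- //; last exact: measurableT_comp.
by have /integrableP[] := ig.
Qed.

Lemma integral_lebesgue (g : mT -> \bar R) : mu.-integrable setT g ->
  (\int[nu]_x g x = \int[mu]_x g x)%E.
Proof.
move=> ig; have mid : measurable_fun [set: lT] (id : lT -> mT) by exact: measurable_fun_lebesgue.
exact: (integral_measure_preserving mid).
Qed.

Lemma integral_shift (g : mT -> \bar R) (t : R) : mu.-integrable setT g ->
  (\int[mu]_x g (x + t)%R = \int[mu]_x g x)%E.
Proof.
move=> ig; apply: (integral_measure_preserving (phi := fun x : mT => x + t : mT)) => //.
  exact: measurable_funD.
move=> B mB; rewrite -(lebesgue_measure_shift (- t) mB); congr (mu _).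
by apply/funext => x /=; rewrite opprK.
Qed.

Lemma integrable_bounded (g : mT -> R) E C : measurable_fun setT g ->
  (forall x, `|g x| <= C) -> (forall x, g x != 0 -> `|x| < E) ->
  mu.-integrable setT (EFin \o g).
Proof.
move=> mg gC gE.
have i1 : mu.-integrable setT (EFin \o (fun x : mT => C * \1_(`[- E, E]%classic) x)).
  rewrite (_ : _ \o _ = (fun x => C%:E * (\1_(`[- E, E]%classic) x)%:E)%E); last first.
    by apply/funext => x /=; rewrite EFinM.
  by apply: integrableZl => //; exact: (integrable_indic_itv (- E) E true false).
apply: le_integrable i1 => //; first exact/measurable_EFinP.
move=> x _ /=; rewrite lee_fin.
have C0 : 0 <= C by apply: le_trans (gC x).
have [->|gx] := eqVneq (g x) 0; first by rewrite normr0.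
rewrite indicE mem_set ?mulr1; first by rewrite (ger0_norm C0).
by rewrite /= in_itv /= -ler_norml ltW // gE.
Qed.

End Completion.

(** * Orthogonality *)

Section Fiber.
Variable R : realType.
Local Notation C := R[i].

(** A right inverse of a square matrix is also a left inverse, so orthogonal rows give orthogonal
    columns. *)
Lemma spectrum_dual M (A Lam : seq nat) : uniq A -> is_spectrum R M A Lam ->
  forall a a', a \in A -> a' \in A -> a != a' ->
    \sum_(l <- Lam) cis ((a%:R - a'%:R) * (l%:R / M%:R) : R) = 0.
Proof.
move=> uA [sz uL orth] a a' aA a'A aa'.
set n := size A in sz.
have n0 : (0 < n)%N by rewrite /n; case: (A) aA.
have mxE' (F : nat -> C) s : size s = n -> \sum_(k < n) F (nth 0%N s k) = \sum_(x <- s) F x.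
  by move=> sn; rewrite (big_nth 0%N) big_mkord sn.
pose U : 'M[C]_n := \matrix_(i, j) cis ((nth 0%N A j)%:R * ((nth 0%N Lam i)%:R / M%:R)).
pose V : 'M[C]_n := \matrix_(i, j) cis (- ((nth 0%N A i)%:R * ((nth 0%N Lam j)%:R / M%:R))).
have UV : U *m V = (n%:R)%:M.
  apply/matrixP => i j; rewrite !mxE.
  under eq_bigr => k _ do rewrite !mxE -cisD.
  set li := nth 0%N Lam i; set lj := nth 0%N Lam j.
  rewrite (mxE' (fun x => cis (x%:R * (li%:R / M%:R) + - (x%:R * (lj%:R / M%:R))) : C)) //.
  have [ij|ij] := eqVneq i j.
    rewrite mulr1n (eq_bigr (fun=> 1)); last by move=> x _; rewrite /li ij subrr cis0.
    by rewrite big_const_seq count_predT iter_addr_0.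
  rewrite mulr0n -[RHS](orth li lj) ?mem_nth ?sz //; last by rewrite nth_uniq ?sz.
  by apply: eq_bigr => x _; congr cis; ring.
have nC : (n%:R : C) != 0 by rewrite pnatr_eq0 -lt0n.
have VU : V *m U = (n%:R)%:M.
  have /mulmx1C : (n%:R^-1 *: U) *m V = 1%:M.
    by rewrite -scalemxAl UV scale_scalar_mx mulVf.
  move=> /(congr1 (fun W => n%:R *: W)); rewrite -scalemxAr scalerA mulfV // scale1r => ->.
  by rewrite scale_scalar_mx mulr1.
have ia : (index a A < n)%N by rewrite index_mem.
have ia' : (index a' A < n)%N by rewrite index_mem.
move/matrixP/(_ (Ordinal ia') (Ordinal ia)): VU; rewrite !mxE.
rewrite -val_eqE /= (negPf (_ : index a' A != index a A)); last first.
  by apply: contra aa' => /eqP h; rewrite -(nth_index 0%N aA) -h nth_index.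
rewrite mulr0n => VU; rewrite -[RHS]VU.
under [RHS]eq_bigr => k _ do rewrite !mxE -cisD /= !nth_index //.
rewrite (mxE' (fun l => cis (- (a'%:R * (l%:R / M%:R)) + a%:R * (l%:R / M%:R)) : C)) //.
by apply: eq_bigr => l _; congr cis; ring.
Qed.

(** Adding [I0] makes the elements of [E] natural numbers, and replacing [z i] by its residue only
    changes the multiple of [Q]. *)
Lemma fiber_tile (I : finType) (z : I -> int) (Q I0 : nat) (E : int -> Prop) :
  (0 < Q)%N -> (forall i, E i -> (`|i|%N <= I0)%N) ->
  (forall n : int, exists! y : I * int, E (n - z y.1 - y.2 * Q%:Z)) ->
  tilem Q [seq a <- iota 0 I0.*2.+1 | `[< E (a%:Z - I0%:Z) >]]
    [seq `|(z i %% Q)%Z|%N | i <- enum I].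
Proof.
move=> Q0 EI tl.
have memA a : (a \in [seq a <- iota 0 I0.*2.+1 | `[< E (a%:Z - I0%:Z) >]]) <-> E (a%:Z - I0%:Z).
  rewrite mem_filter mem_iota add0n leq0n /=; split=> [/andP[/asboolP//]|Ea].
  rewrite asboolT //=; have := EI _ Ea; lia.
have QZ : Q%:Z != 0 by move: Q0; case: (Q).
have bE i : (`|(z i %% Q)%Z|%N)%:Z = z i - (z i %/ Q)%Z * Q.
  by rewrite gez0_abs ?modz_ge0 // {2}(divz_eq (z i) Q) addrC addKr.
have un n i k i' k' : E (n - z i - k * Q%:Z) -> E (n - z i' - k' * Q%:Z) -> i = i' /\ k = k'.
  move=> h h'; have [y [_ U]] := tl n.
  by have := U (i, k) h; rewrite (U (i', k') h') => -[-> ->].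
apply: tilem_intro => //.
- by rewrite filter_uniq ?iota_uniq.
- have [[i0 k0] [/= E0 _]] := tl 0.
  rewrite map_inj_in_uniq ?enum_uniq // => i i' _ _ ii'.
  have [] // := un (0 - z i0 - k0 * Q%:Z + z i) i 0 i' ((z i %/ Q)%Z - (z i' %/ Q)%Z).
    by congr E: E0; ring.
  congr E: E0; have := bE i; rewrite ii' bE => h.
  by apply/eqP; rewrite -subr_eq0; move/eqP: h; rewrite -subr_eq0 => /eqP h; apply/eqP; rewrite -[RHS]h; ring.
- move=> a a' _ _ /memA Ea /memA Ea' /mapP[i _ ->] /mapP[i' _ ->] h.
  set b := `|(z i %% Q)%Z|%N in h *; set b' := `|(z i' %% Q)%Z|%N in h *.
  have [c Ec] : exists c : int, a%:Z + b%:Z = a'%:Z + b'%:Z + c * Q%:Z.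
    exists (((a + b) %/ Q)%N%:Z - ((a' + b') %/ Q)%N%:Z).
    have := divn_eq (a + b) Q; have := divn_eq (a' + b') Q; rewrite h; nia.
  have [||ii' k0] := un (a%:Z - I0%:Z + z i) i 0 i' ((z i %/ Q)%Z - (z i' %/ Q)%Z + c).
  - by congr E: Ea; ring.
  - congr E: Ea'; have := bE i; have := bE i'; rewrite -/b -/b' => h1 h2.
    have Z1 : z i = b%:Z + (z i %/ Q)%Z * Q by rewrite h2 subrK.
    have Z2 : z i' = b'%:Z + (z i' %/ Q)%Z * Q by rewrite h1 subrK.
    rewrite {1}Z1 {1}Z2; have -> : a'%:Z = a%:Z + b%:Z - b'%:Z - c * Q%:Z by rewrite Ec; ring.
    by ring.
  have c0 : c = 0 by move: k0; rewrite ii' subrr add0r => <-.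
  split; last by rewrite /b ii'.
  by move: Ec; rewrite c0 mul0r addr0 /b ii' => /addIr[].
- move=> y yQ; have [[i k] [/= Ei _]] := tl (y%:Z - I0%:Z).
  have aI := EI _ Ei; set a := (y%:Z - I0%:Z - z i - k * Q%:Z) in Ei aI.
  have aE : (`|(a + I0%:Z)%R|%N)%:Z = a + I0%:Z by rewrite gez0_abs //; move: aI; clear; lia.
  exists `|(a + I0%:Z)%R|%N, `|(z i %% Q)%Z|%N; split.
  - by apply/memA; rewrite aE addrK.
  - by apply: map_f; rewrite mem_enum.
  apply/eqP; rewrite -eqz_nat -!modz_nat PoszD aE bE.
  have -> : a + I0%:Z + (z i - (z i %/ Q)%Z * Q) = (- k - (z i %/ Q)%Z) * Q + y%:Z.
    by rewrite /a; ring.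
  by rewrite modzMDl.
Qed.

(** [Lam] is chosen before [E], since the fibers differ from point to point. The first identity
    serves the orthogonality of the exponentials, the second the expansion of functions on a
    fiber. *)
Lemma fiber_spectrum (I : finType) (z : I -> int) (Q I0 : nat) : (0 < Q)%N ->
  exists2 Lam : seq nat, uniq Lam & forall E : int -> Prop,
    (forall i, E i -> (`|i|%N <= I0)%N) ->
    (forall n : int, exists! y : I * int, E (n - z y.1 - y.2 * Q%:Z)) ->
    let ind (a : 'I_(I0.*2.+1)) : C := if `[< E (a%:Z - I0%:Z) >] then 1 else 0 in
    (0 < size Lam)%N /\
    (forall l l', l \in Lam -> l' \in Lam ->
      \sum_a ind a * cis (((a%:Z - I0%:Z)%:~R * ((l%:R - l'%:R) / Q%:R)) : R) =
        if l == l' then (size Lam)%:R else 0) /\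
    (forall a a' : int, E a -> E a' ->
      \sum_(l <- Lam) cis (((a - a')%:~R * (l%:R / Q%:R)) : R) =
        if a == a' then (size Lam)%:R else 0).
Proof.
move=> Q0; pose B := [seq `|(z i %% Q)%Z|%N | i <- enum I].
have [Lam0 HL] := @universal_spectrum R Q B Q0.
(* [HL] yields uniqueness only when some [E] is given, so [undup] secures it in advance. *)
exists (undup Lam0); first exact: undup_uniq.
move=> E EI tl ind; have tE := fiber_tile Q0 EI tl.
have [sz uL orth] := HL _ tE; rewrite (undup_id uL).
set s := [seq a <- _ | _] in sz orth tE.
have us : uniq s by rewrite filter_uniq ?iota_uniq.
have sumE (f : nat -> C) : \sum_(a : 'I_(I0.*2.+1)) ind a * f a = \sum_(a <- s) f a.
  rewrite /s big_filter -[iota _ _]/(index_iota 0 I0.*2.+1) big_mkord [RHS]big_mkcond /=.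
  by apply: eq_bigr => a _; rewrite /ind; case: asboolP => _; rewrite ?mul1r ?mul0r.
have phase (l l' : nat) (a : nat) :
    cis (((a%:Z - I0%:Z)%:~R * ((l%:R - l'%:R) / Q%:R)) : R) =
    cis (- (I0%:R * ((l%:R - l'%:R) / Q%:R)) : R) * cis (a%:R * ((l%:R - l'%:R) / Q%:R) : R).
  rewrite -cisD intrB; congr cis.
  by rewrite -[(a%:Z)%:~R]/(a%:R) -[(I0%:Z)%:~R]/(I0%:R); ring.
split.
  have [sQ _ _ _] := tE; rewrite sz lt0n; apply/eqP => s0; move: Q0.
  by rewrite -sQ s0 mul0n.
split=> [l l' lL l'L|a a' Ea Ea'].
  rewrite (sumE (fun a => cis ((a%:Z - I0%:Z)%:~R * ((l%:R - l'%:R) / Q%:R)))).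
  have [<-|ll'] := eqVneq l l'.
    rewrite (eq_bigr (fun=> 1)); last by move=> a _; rewrite subrr mul0r mulr0 cis0.
    by rewrite big_const_seq count_predT iter_addr_0 sz.
  under eq_bigr => a _ do rewrite phase.
  by rewrite -mulr_sumr orth // mulr0.
have [<-|aa'] := eqVneq a a'.
  rewrite (eq_bigr (fun=> 1)); last by move=> l _; rewrite subrr mul0r cis0.
  by rewrite big_const_seq count_predT iter_addr_0.
have lift b : E b -> exists2 c : nat, c \in s & b = c%:Z - I0%:Z.
  move=> Eb; have bI := EI _ Eb.
  have bE : (`|(b + I0%:Z)%R|%N)%:Z = b + I0%:Z by rewrite gez0_abs //; move: bI; clear; lia.
  exists `|(b + I0%:Z)%R|%N; last by rewrite bE addrK.
  rewrite mem_filter mem_iota bE addrK add0n leq0n /=; apply/andP; split; first exact/asboolP.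
  by move: bI; clear; lia.
have [c cs cE] := lift a Ea; have [c' c's cE'] := lift a' Ea'.
rewrite -[RHS](spectrum_dual us (HL _ tE) cs c's); last first.
  by apply: contra aa' => /eqP cc; rewrite cE cE' cc.
apply: eq_bigr => l _; congr (cis (_ * _)); rewrite cE cE'.
have -> : c%:Z - I0%:Z - (c'%:Z - I0%:Z) = c%:Z - c'%:Z by ring.
by rewrite intrB.
Qed.

End Fiber.

(** * Integrals of exponentials over a period *)

Section Oscillation.
Variable R : realType.
Local Notation mu := (@lebesgue_measure R).
Local Notation mT := (measurableTypeR R).

Lemma continuous_Re_cis (c : R) : continuous (fun x : R => complex.Re (cis (c * x))).
Proof.
move=> x; rewrite /cis /=.
apply: (@continuous_comp _ _ _ (fun x : R => 2 * pi * (c * x)) cos); last exact: continuous_cos.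
by apply: continuousM; [exact: cst_continuous|apply: continuousM; [exact: cst_continuous|]].
Qed.

Lemma continuous_Im_cis (c : R) : continuous (fun x : R => complex.Im (cis (c * x))).
Proof.
move=> x; rewrite /cis /=.
apply: (@continuous_comp _ _ _ (fun x : R => 2 * pi * (c * x)) sin); last exact: continuous_sin.
by apply: continuousM; [exact: cst_continuous|apply: continuousM; [exact: cst_continuous|]].
Qed.

Lemma measurable_Re_cis (c : R) : measurable_fun setT (fun x : mT => complex.Re (cis (c * x)) : mT).
Proof. by apply: continuous_measurable_fun; exact: continuous_Re_cis. Qed.

Lemma measurable_Im_cis (c : R) : measurable_fun setT (fun x : mT => complex.Im (cis (c * x)) : mT).
Proof. by apply: continuous_measurable_fun; exact: continuous_Im_cis. Qed.

Lemma Re_cis_le1 (x : R) : `|complex.Re (cis x)| <= 1.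
Proof. by rewrite /= ler_norml cos_geN1 cos_le1. Qed.

Lemma Im_cis_le1 (x : R) : `|complex.Im (cis x)| <= 1.
Proof. by rewrite /= ler_norml sin_geN1 sin_le1. Qed.

Lemma integral_derivative0 (f F : R -> R) (u : R) : 0 < u -> continuous f ->
  (forall x : R, is_derive x 1 F (f x)) -> F u = F 0 ->
  (\int[mu]_(x in `[0%R, u[) (f x)%:E = 0)%E.
Proof.
move=> u0 cf dF Fu.
have mf : measurable_fun (`[0%R, u[%classic : set mT) (EFin \o f).
  by apply/measurable_EFinP; apply: measurable_funTS; exact: continuous_measurable_fun.
rewrite (integral_itv_bndo_bndc mf) (@continuous_FTC2 _ f F 0 u) //.
- by rewrite Fu subee.
- by apply: continuous_subspaceT.
- have cF : continuous F.
    by move=> x; apply: differentiable_continuous; apply/derivable1_diffP; have [] := dF x.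
  split => //.
  + by apply: cvg_at_right_filter; exact: cF.
  + by apply: cvg_at_left_filter; exact: cF.
- by move=> x _; rewrite derive1E; have [_ ->] := dF x.
Qed.

Lemma integral_cis0 (u : R) (k : int) : 0 < u -> k != 0 ->
  (\int[mu]_(x in `[0%R, u[) (complex.Re (cis (k%:~R / u * x)))%:E = 0)%E /\
  (\int[mu]_(x in `[0%R, u[) (complex.Im (cis (k%:~R / u * x)))%:E = 0)%E.
Proof.
move=> u0 k0; pose w : R := 2 * pi * (k%:~R / u).
have w0 : w != 0.
  apply: mulf_neq0; first by rewrite mulf_neq0 ?pnatr_eq0 // gt_eqF ?pi_gt0.
  by rewrite mulf_neq0 ?intr_eq0 // invr_neq0 // gt_eqF.
have E x : 2 * pi * (k%:~R / u * x) = w * x :> R by rewrite /w !mulrA.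
have [cu su] : cos (w * u) = 1 /\ sin (w * u) = 0.
  have := cis_int R k; rewrite /cis.
  have -> : 2 * pi * k%:~R = w * u by rewrite /w -!mulrA mulVf ?mulr1 // gt_eqF.
  by move=> [-> ->].
have dw (x : R) : is_derive x 1 (fun x => w * x) w.
  by apply: is_derive_eq; exact: mulr1.
split.
- apply: (@integral_derivative0 _ (fun x => w^-1 * sin (w * x))) => //.
  + exact: continuous_Re_cis.
  + move=> x; rewrite /= E.
    have -> : cos (w * x) = w^-1 * (cos (w * x) * w) by rewrite [cos _ * w]mulrC mulKf.
    have h := is_derive1_comp (is_derive_sin (w * x)) (dw x).
    exact: (is_deriveZ w^-1 h).
  + by rewrite su !mulr0 sin0 mulr0.
- apply: (@integral_derivative0 _ (fun x => - w^-1 * cos (w * x))) => //.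
  + exact: continuous_Im_cis.
  + move=> x; rewrite /= E.
    have -> : sin (w * x) = - w^-1 * (- sin (w * x) * w) by rewrite mulNr mulNr mulrN opprK [sin _ * w]mulrC mulKf.
    have h := is_derive1_comp (is_derive_cos (w * x)) (dw x).
    exact: (is_deriveZ (- w^-1) h).
  + by rewrite cu !mulr0 cos0.
Qed.

End Oscillation.

Section Folding.
Variable R : realType.
Local Notation mu := (@lebesgue_measure R).
Local Notation nu := (@completed_lebesgue_measure R).
Local Notation mT := (measurableTypeR R).
Local Notation lT := (lebesgueT R).
Variables (F : set lT) (A : set mT) (D u : R).
Hypothesis mF : measurable F.
Hypothesis mA : measurable A.
Hypothesis AF : A `<=` F.
Hypothesis FA : {ae mu, forall x, F x -> A x}.
Hypothesis FD : forall x, F x -> `|x| < D.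
Hypothesis u0 : 0 < u.

(** The summand 1 accounts for the base point of a fiber, which varies in [[0, u)]. *)
Definition fold_bound : nat := Num.bound (`|D| / u + 1).
Local Notation J := 'I_(fold_bound.*2.+1).
Definition offset (a : J) : R := (a%:Z - fold_bound%:Z)%:~R * u.

Let bound_lt : `|D| / u + 1 < fold_bound%:R.
Proof. by apply: archi_boundP; rewrite addr_ge0 // divr_ge0 // ltW. Qed.

Lemma fold_index (y : R) (i : int) : 0 <= y < u -> A (y + i%:~R * u) ->
  (`|i|%N <= fold_bound)%N.
Proof.
move=> /andP[y0 yu] /AF/FD/lt_le_trans/(_ (ler_norm D))/ltr_normlP[h1 h2].
have bu : (`|D| / u + 1) * u < fold_bound%:R * u by rewrite ltr_pM2r.
rewrite mulrDl divfK ?gt_eqF // mul1r in bu.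
have l1 : i%:~R * u < fold_bound%:R * u by move: h2 y0 u0 bu; lra.
have l2 : - fold_bound%:R * u < i%:~R * u by rewrite mulNr; move: h1 yu u0 bu; lra.
rewrite ltr_pM2r // -[fold_bound%:R]/(fold_bound%:Z%:~R) ltr_int in l1.
rewrite ltr_pM2r // -[fold_bound%:R]/(fold_bound%:Z%:~R) -mulrNz ltr_int in l2.
by move: l1 l2; move: fold_bound => b; clear; lia.
Qed.

Lemma sum_cells (x : R) : `|x| < D ->
  \sum_(a : J) \1_(`[0, u[%classic) (x - offset a) = 1 :> R.
Proof.
move=> /lt_le_trans/(_ (ler_norm D))/ltr_normlP[h1 h2].
have /andP[] := floor_itv (x / u); set k := Num.floor _.
rewrite ler_pdivlMr // ltr_pdivrMr // intrD mulrDl mul1r => k1 k2.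
have bu : (`|D| / u + 1) * u < fold_bound%:R * u by rewrite ltr_pM2r.
rewrite mulrDl divfK ?gt_eqF // mul1r in bu.
have l1 : k%:~R * u < fold_bound%:R * u by move: h2 u0 bu; lra.
have l2 : - fold_bound%:R * u < k%:~R * u by rewrite mulNr; move: h1 u0 bu; lra.
rewrite ltr_pM2r // -[fold_bound%:R]/(fold_bound%:Z%:~R) ltr_int in l1.
rewrite ltr_pM2r // -[fold_bound%:R]/(fold_bound%:Z%:~R) -mulrNz ltr_int in l2.
have kI : (absz (k + fold_bound%:Z)%R < fold_bound.*2.+1)%N.
  by move: l1 l2; move: fold_bound => b; clear; lia.
have kE : (absz (k + fold_bound%:Z)%R)%:Z - fold_bound%:Z = k.
  by rewrite gez0_abs ?addrK //; move: l1 l2; move: fold_bound => b; clear; lia.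
rewrite (bigD1 (Ordinal kI)) //= /offset /= kE indicE mem_set; last first.
  by rewrite /= in_itv /=; apply/andP; split; move: k1 k2; lra.
rewrite big1 ?addr0 // => a ak; rewrite indicE memNset // /= in_itv /=.
set c := (a%:Z - _) => /andP[c1 c2]; move/eqP: ak; apply; apply: val_inj => /=.
have ck : k = c.
  apply: floor_def; rewrite ler_pdivlMr // ltr_pdivrMr // intrD mulrDl mul1r.
  by apply/andP; split; move: c1 c2; lra.
have : (absz (k + fold_bound%:Z)%R)%:Z = a%:Z by rewrite ck /c subrK.
by case.
Qed.

(** The line is cut into cells of length [u], each of which is moved back to [[0, u)]; only the
    finitely many cells of [J] are needed, since [A] is bounded. *)
Lemma fold_integral (g : mT -> R) : measurable_fun setT g -> (forall x, `|g x| <= 1) ->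
  (\int[nu]_(x in F) (g x)%:E =
   \int[mu]_(x in `[0%R, u[) (\sum_(a : J) \1_A (x + offset a) * g (x + offset a))%:E)%E.
Proof.
move=> mg g1.
pose G (x : mT) : R := \1_A x * g x.
have mG : measurable_fun setT G by apply: measurable_funM => //; exact: measurable_indic.
have GD x : G x != 0 -> `|x| < D.
  rewrite /G indicE; case: (boolP (x \in A)) => [/set_mem/AF/FD//|_].
  by rewrite mul0r eqxx.
have G1 x : `|G x| <= 1.
  by rewrite /G indicE; case: (x \in A); rewrite ?mul1r // mul0r normr0.
pose H (a : J) (x : mT) : R := G x * \1_(`[0, u[%classic) (x - offset a).
have mcell (t : R) : measurable_fun setT (fun x : mT => \1_(`[0, u[%classic) (x - t) : R).
  under eq_fun => x do rewrite indic_shift.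
  by apply: measurable_indic; exact: measurable_shift.
have iH a : mu.-integrable setT (EFin \o H a).
  apply: (@integrable_bounded _ _ D 1).
  - exact: measurable_funM.
  - by move=> x; rewrite /H indicE; case: (_ \in _); rewrite ?mulr1 ?mulr0 ?normr0.
  - by move=> x hx; apply: GD; apply: contra hx => /eqP Gx; rewrite /H Gx mul0r.
have iG : mu.-integrable setT (EFin \o G) by apply: (@integrable_bounded _ _ D 1).
transitivity (\int[nu]_x (EFin \o G) x)%E.
  apply: (etrans (@integral_mkcond _ lT R nu F (fun x : lT => (g x)%:E))).
  have mh : measurable_fun setT ((fun x : lT => (g x)%:E) \_ F).
    apply/(measurable_restrictT _ mF)/measurable_EFinP.
    by apply: measurable_fun_lebesgue.
  have mh' : measurable_fun setT (EFin \o G : lT -> \bar R).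
    by apply/measurable_EFinP; exact: (@measurable_fun_lebesgue _ _ _ G).
  apply: (ae_eq_integral _ _ measurableT mh mh').
  apply: ae_mono (ae_lebesgue FA) => x hx _.
  rewrite /patch [RHS]/= /G [X in _ = (X * _)%:E]indicE; case: ifPn => xF.
    by rewrite mem_set ?mul1r //; apply: hx; exact: set_mem.
  by rewrite memNset ?mul0r // => /AF/mem_set; exact/negP.
rewrite integral_lebesgue //.
transitivity (\int[mu]_x (\sum_(a : J) (EFin \o H a) x))%E.
  apply: eq_integral => x _; rewrite sumEFin /H -mulr_sumr /=; congr (_%:E).
  have [->|Gx] := eqVneq (G x) 0; first by rewrite mul0r.
  by rewrite sum_cells ?mulr1 //; exact: GD.
rewrite integral_sum //.
transitivity (\sum_(a : J) \int[mu]_x (EFin \o H a) (x + offset a)%R)%E.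
  by apply: eq_bigr => a _; rewrite (integral_shift (offset a) (iH a)).
have iH' a : mu.-integrable setT (fun x => (EFin \o H a) (x + offset a)%R).
  apply: (@integrable_bounded _ _ (D + `|offset a|) 1).
  - by apply: (measurableT_comp (f := H a)); [apply: measurable_funM|apply: measurable_funD].
  - by move=> x; rewrite /H indicE; case: (_ \in _); rewrite ?mulr1 ?mulr0 ?normr0.
  - move=> x hx; have /GD h : G (x + offset a) != 0.
      by apply: contra hx => /eqP Gx; rewrite /H Gx mul0r.
    have -> : x = (x + offset a) - offset a by rewrite addrK.
    by apply: le_lt_trans (ler_normB _ _) _; rewrite ltrD2r.
rewrite -integral_sum // [RHS]integral_mkcond; apply: eq_integral => x _.
rewrite sumEFin /patch /H /G; case: ifPn => xu.
  by congr (_%:E); apply: eq_bigr => a _; rewrite addrK [X in _ * X]indicE xu mulr1.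
by rewrite big1 // => a _; rewrite addrK [X in _ * X]indicE (negbTE xu) mulr0.
Qed.

End Folding.

Section Orthogonality.
Variable R : realType.
Local Notation mu := (@lebesgue_measure R).
Local Notation nu := (@completed_lebesgue_measure R).
Local Notation mT := (measurableTypeR R).
Local Notation lT := (lebesgueT R).

Definition fiber_indicator (A : set R) (u : R) (I0 : nat) (x : R) (a : 'I_(I0.*2.+1)) : R[i] :=
  if `[< A (x + (a%:Z - I0%:Z)%:~R * u) >] then 1 else 0.

(* The values of the characters of [Z/Q] in [Lam], sampled along the fiber
   [A :&: (x + u Z)], form an orthogonal square matrix. *)
Definition fiber_orthogonal (A : set R) (u : R) (Q I0 : nat) (Lam : seq nat) (x : R) :=
  (forall l l', l \in Lam -> l' \in Lam ->
     \sum_(a : 'I_(I0.*2.+1)) fiber_indicator A u x a *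
       cis (((a%:Z - I0%:Z)%:~R * ((l%:R - l'%:R) / Q%:R)) : R) =
     if l == l' then (size Lam)%:R else 0) /\
  (forall a a' : int, A (x + a%:~R * u) -> A (x + a'%:~R * u) ->
     \sum_(l <- Lam) cis (((a - a')%:~R * (l%:R / Q%:R)) : R) =
     if a == a' then (size Lam)%:R else 0).

Variables (F : set lT) (A : set mT) (D u : R) (Q : nat) (Lam : seq nat).
Hypothesis mF : measurable F.
Hypothesis mA : measurable A.
Hypothesis AF : A `<=` F.
Hypothesis FA : {ae mu, forall x, F x -> A x}.
Hypothesis FD : forall x, F x -> `|x| < D.
Hypothesis u0 : 0 < u.
Hypothesis Q0 : (0 < Q)%N.
Local Notation I0 := (fold_bound D u).
Hypothesis fibers : {ae mu, forall x, 0 <= x < u -> fiber_orthogonal A u Q I0 Lam x}.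

Definition frequency (l : nat) (n : int) : R := (l%:R + n%:~R * Q%:R) / (Q%:R * u).
Definition spectrum : set R := [set la | exists l n, l \in Lam /\ la = frequency l n].

Lemma Re_sum (I : Type) (s : seq I) (f : I -> R[i]) :
  complex.Re (\sum_(i <- s) f i) = \sum_(i <- s) complex.Re (f i).
Proof. by apply: (big_morph (@complex.Re R)) => // -[? ?] [? ?]. Qed.

Lemma Im_sum (I : Type) (s : seq I) (f : I -> R[i]) :
  complex.Im (\sum_(i <- s) f i) = \sum_(i <- s) complex.Im (f i).
Proof. by apply: (big_morph (@complex.Im R)) => // -[? ?] [? ?]. Qed.

Lemma Re_realM (r : R) (w : R[i]) : complex.Re (r%:C * w) = r * complex.Re w.
Proof. by case: w => a b /=; rewrite mul0r subr0. Qed.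

Lemma Im_realM (r : R) (w : R[i]) : complex.Im (r%:C * w) = r * complex.Im w.
Proof. by case: w => a b /=; rewrite mul0r addr0. Qed.

Let Q1 : Q%:R != 0 :> R.
Proof. by rewrite pnatr_eq0 -lt0n. Qed.
Let u1 : u != 0.
Proof. by rewrite gt_eqF. Qed.

(** Along a fiber [n] and [n'] contribute integers to the phase, so only [l] and [l'] are felt. *)
Lemma fiber_exponential_sum l n l' n' x : l \in Lam -> l' \in Lam ->
  fiber_orthogonal A u Q I0 Lam x ->
  \sum_(a : 'I_(I0.*2.+1)) (\1_A (x + offset a))%:C *
     cis ((frequency l n - frequency l' n') * (x + offset a)) =
  (if l == l' then size Lam else 0%N)%:R%:C * cis ((frequency l n - frequency l' n') * x).
Proof.
move=> lL l'L [/(_ l l' lL l'L) E _].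
have -> : (if l == l' then size Lam else 0%N)%:R%:C = (if l == l' then (size Lam)%:R else 0) :> R[i].
  by case: ifP => _; rewrite ?rmorph_nat ?rmorph0.
rewrite -E mulr_suml; apply: eq_bigr => a _.
have -> : cis ((frequency l n - frequency l' n') * (x + offset a)) =
    cis ((a%:Z - I0%:Z)%:~R * ((l%:R - l'%:R) / Q%:R)) *
    cis ((frequency l n - frequency l' n') * x).
  rewrite mulrDr addrC cisD; congr (_ * _).
  have -> : (frequency l n - frequency l' n') * offset a =
      (a%:Z - I0%:Z)%:~R * ((l%:R - l'%:R) / Q%:R) + ((a%:Z - I0%:Z) * (n - n'))%:~R.
    rewrite intrM [(n - n')%:~R]intrB /frequency /offset; set k := (a%:Z - _)%:~R.
    by set n1 := n%:~R; set n2 := n'%:~R; field; rewrite u1 Q1.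
  by rewrite cisD cis_int mulr1.
rewrite mulrA; congr (_ * _ * _).
rewrite /fiber_indicator indicE -/(offset a).
by case: asboolP => h; [rewrite mem_set|rewrite memNset].
Qed.

(** [h] stands for the real or the imaginary part. For [l != l'] the sum over almost every fiber
    vanishes; for [l = l'] it is a multiple of an exponential with a nonzero integer number of
    periods on [[0, u)]. *)
Lemma integral_exponential0 (h : R[i] -> R) (la la' : R) :
  (forall c : R, measurable_fun setT (fun x : mT => h (cis (c * x)) : mT)) ->
  (forall x : R, `|h (cis x)| <= 1) ->
  (forall (r : R) w, h (r%:C * w) = r * h w) ->
  (forall (s : seq 'I_(I0.*2.+1)) (f : 'I_(I0.*2.+1) -> R[i]),
     h (\sum_(i <- s) f i) = \sum_(i <- s) h (f i)) ->
  (forall k : int, k != 0 -> (\int[mu]_(x in `[0%R, u[) (h (cis (k%:~R / u * x)))%:E = 0)%E) ->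
  spectrum la -> spectrum la' -> la != la' ->
  (\int[nu]_(x in F) (h (cis ((la - la') * x)))%:E = 0)%E.
Proof.
move=> mh h1 hM hS h0 [l [n [lL ->]]] [l' [n' [l'L ->]]] ll'.
set de := frequency l n - frequency l' n'.
have := @fold_integral R F A D u mF mA AF FA FD u0 (fun x => h (cis (de * x))) (mh de) (fun x => h1 _).
move=> ->.
pose ka : R := (if l == l' then size Lam else 0%N)%:R.
have mS : measurable_fun (`[0%R, u[%classic : set mT) (fun x : mT =>
   (\sum_(a : 'I_(I0.*2.+1)) \1_A (x + offset a) * h (cis (de * (x + offset a))))%:E).
  apply/measurable_EFinP/measurable_funTS/measurable_sum => a; apply: measurable_funM.
    rewrite (_ : (fun x : mT => \1_A (x + offset a)) = \1_([set x | A (x - - offset a)] : set mT)).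
      by apply: measurable_indic; exact: measurable_shift.
    by apply/funext => x; rewrite -indic_shift opprK.
  apply: (measurableT_comp (f := fun x : mT => h (cis (de * x)))) (mh de) _.
  exact: measurable_funD.
have mS' : measurable_fun (`[0%R, u[%classic : set mT) (fun x : mT => (ka * h (cis (de * x)))%:E).
  by apply/measurable_EFinP/measurable_funTS/measurable_funM => //; exact: mh.
rewrite (ae_eq_integral _ _ _ mS mS') //; last first.
  apply: ae_mono fibers => x hx; rewrite /= in_itv /= => /hx h2.
  rewrite -hM -(fiber_exponential_sum n n' lL l'L h2) hS; congr (_%:E).
  by apply: eq_bigr => a _; rewrite hM.
rewrite /ka; case: eqP => [E|_]; last first.
  by under eq_integral => x _ do rewrite mul0r; rewrite integral0.
have nn' : n - n' != 0.
  by apply: contra ll'; rewrite subr_eq0 E => /eqP ->.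
have deE : de = (n - n')%:~R / u.
  rewrite /de /frequency E intrB; set n1 := n%:~R; set n2 := n'%:~R.
  by field; rewrite u1 Q1.
have id0 : mu.-integrable (`[0%R, u[%classic) (fun x : mT => (h (cis (de * x)))%:E).
  apply: (measurable_bounded_integrable (f := fun x : mT => h (cis (de * x)))) => //.
  - rewrite [X in (X < _)%E](_ : _ = u%:E) ?ltry //; apply: etrans (lebesgue_measure_itv _) _.
    by rewrite /= lte_fin u0 oppr0 adde0.
  - exact: (measurable_funTS (mh de)).
  - by exists 1; split => // M M1 x _ /=; apply: le_trans (h1 _) (ltW M1).
under eq_integral => x _ do rewrite EFinM.
by rewrite integralZl // deE h0 // mule0.
Qed.

Lemma spectrum_orthogonal la la' : spectrum la -> spectrum la' -> la != la' ->
  L2dot F (expi la) (expi la') = 0.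
Proof.
move=> sl sl' ll'; rewrite /L2dot /Rintegral.
have E x : expi la x * (expi la' x)^* = cis ((la - la') * x).
  by rewrite !expiE conj_cis -cisD; congr cis; ring.
under eq_integral => x _ do rewrite E.
under [X in _ +i* fine X]eq_integral => x _ do rewrite E.
rewrite !integral_exponential0 //.
- exact: measurable_Im_cis.
- exact: Im_cis_le1.
- exact: Im_realM.
- by move=> s f; exact: Im_sum.
- by move=> k k0; have [] := integral_cis0 u0 k0.
- exact: measurable_Re_cis.
- exact: Re_cis_le1.
- exact: Re_realM.
- by move=> s f; exact: Re_sum.
- by move=> k k0; have [] := integral_cis0 u0 k0.
Qed.

End Orthogonality.

(** * Density of the exponentials *)

Section Approximation.
Variable R : realType.
Local Notation nu := (@completed_lebesgue_measure R).
Local Notation lT := (lebesgueT R).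
Variables (F : set lT) (L : set R).
Hypothesis mF : measurable F.

(** Frequencies may repeat, so that addition is concatenation; [trigE] restores the coefficient
    function that [real_spectral] asks for. *)
Definition trig (t : seq (R * R[i])) (x : R) : R[i] := \sum_(p <- t) p.2 * expi p.1 x.

Lemma trigE (t : seq (R * R[i])) x :
  trig t x = \sum_(l <- undup [seq p.1 | p <- t]) (\sum_(p <- t | p.1 == l) p.2) * expi l x.
Proof.
transitivity (\sum_(l <- undup [seq p.1 | p <- t]) \sum_(p <- t | p.1 == l) p.2 * expi p.1 x).
  rewrite (exchange_big_dep xpredT) //= /trig big_seq [RHS]big_seq; apply: eq_bigr => p pt.
  rewrite (eq_bigl (pred1 p.1)); last by move=> l; rewrite /= eq_sym.
  by rewrite -big_filter filter_pred1_uniq ?undup_uniq ?mem_undup ?map_f // big_seq1.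
apply: eq_bigr => l _; rewrite mulr_suml; apply: eq_bigr => p /eqP -> //.
Qed.

Definition measurableC (f : R -> R[i]) :=
  measurable_fun F (fun x => complex.Re (f x) : R) /\
  measurable_fun F (fun x => complex.Im (f x) : R).

Definition approx (f : R -> R[i]) := measurableC f /\
  forall e : R, 0 < e -> exists2 t, (forall p, p \in t -> L p.1) &
    (L2norm_sq F (fun x => f x - trig t x)%R < e%:E)%E.

Lemma measurableC_add f g : measurableC f -> measurableC g -> measurableC (fun x => f x + g x).
Proof.
move=> [f1 f2] [g1 g2]; split.
  rewrite (_ : (fun x => _) = fun x => complex.Re (f x) + complex.Re (g x)).
    exact: measurable_funD.
  by apply/funext => x; case: (f x) (g x) => ? ? [? ?].
rewrite (_ : (fun x => _) = fun x => complex.Im (f x) + complex.Im (g x)).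
  exact: measurable_funD.
by apply/funext => x; case: (f x) (g x) => ? ? [? ?].
Qed.

Lemma measurableC_mul f g : measurableC f -> measurableC g -> measurableC (fun x => f x * g x).
Proof.
move=> [f1 f2] [g1 g2]; split.
  rewrite (_ : (fun x => _) = fun x => complex.Re (f x) * complex.Re (g x) -
     complex.Im (f x) * complex.Im (g x)).
    by apply: measurable_funB; exact: measurable_funM.
  by apply/funext => x; case: (f x) (g x) => ? ? [? ?].
rewrite (_ : (fun x => _) = fun x => complex.Re (f x) * complex.Im (g x) +
     complex.Im (f x) * complex.Re (g x)).
  by apply: measurable_funD; exact: measurable_funM.
by apply/funext => x; case: (f x) (g x) => ? ? [? ?].
Qed.

Lemma measurableC_cst (c : R[i]) : measurableC (fun=> c).
Proof. by split; exact: measurable_cst. Qed.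

Lemma measurableC_scale (c : R[i]) f : measurableC f -> measurableC (fun x => c * f x).
Proof. exact: (@measurableC_mul (fun=> c) f (measurableC_cst c)). Qed.

Lemma measurableC_sub f g : measurableC f -> measurableC g -> measurableC (fun x => f x - g x).
Proof.
move=> mf mg; rewrite (_ : (fun x => _) = fun x => f x + -1 * g x).
  exact: (measurableC_add mf (measurableC_scale _ mg)).
by apply/funext => x; rewrite mulN1r.
Qed.

Lemma measurableC_real (f : R -> R) : measurable_fun F (f : lT -> R) ->
  measurableC (fun x => (f x)%:C).
Proof. by move=> mf; split => //=; exact: measurable_cst. Qed.

Lemma measurableC_expi l : measurableC (expi l).
Proof.
split; under eq_fun => x do rewrite expiE; apply: measurable_fun_lebesgue.
  exact: measurable_Re_cis.
exact: measurable_Im_cis.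
Qed.

Lemma measurableC_trig t : measurableC (trig t).
Proof.
elim: t => [|p t IH].
  rewrite (_ : trig _ = fun=> 0); first exact: measurableC_cst.
  by apply/funext => x; rewrite /trig big_nil.
rewrite (_ : trig _ = fun x => p.2 * expi p.1 x + trig t x).
  exact: (measurableC_add (measurableC_scale p.2 (measurableC_expi p.1)) IH).
by apply/funext => x; rewrite /trig big_cons.
Qed.

Definition sqnorm (z : R[i]) : R := complex.Re z ^+ 2 + complex.Im z ^+ 2.

Lemma sqnorm_ge0 z : 0 <= sqnorm z.
Proof. by rewrite addr_ge0 // sqr_ge0. Qed.

Lemma sqnormM z w : sqnorm (z * w) = sqnorm z * sqnorm w.
Proof. by case: z w => a b [c d]; rewrite /sqnorm /=; ring. Qed.

Lemma sqnormD_le z w : sqnorm (z + w) <= 2 * sqnorm z + 2 * sqnorm w.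
Proof.
case: z w => a b [c d]; rewrite /sqnorm /=.
by have := sqr_ge0 (a - c); have := sqr_ge0 (b - d); nra.
Qed.

Lemma measurable_sqnorm f : measurableC f -> measurable_fun F (fun x : lT => (sqnorm (f x))%:E).
Proof.
move=> [f1 f2]; apply/measurable_EFinP; apply: measurable_funD; exact: measurable_funX.
Qed.

(** This replaces the triangle inequality and avoids square roots; its factors 2 are the reason for
    the errors [e / 4] below. *)
Lemma L2norm_sqD f g : measurableC f -> measurableC g ->
  (L2norm_sq F (fun x => f x + g x)%R <= 2%:E * L2norm_sq F f + 2%:E * L2norm_sq F g)%E.
Proof.
move=> mf mg.
have s0 (h : R -> R[i]) (x : lT) : F x -> (0 <= (sqnorm (h x))%:E)%E.
  by move=> _; rewrite lee_fin sqnorm_ge0.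
have Z (h : R -> R[i]) : measurableC h ->
    (2%:E * L2norm_sq F h = \int[nu]_(x in F) (2%:E * (sqnorm (h x))%:E))%E.
  have two0 : (0 <= 2%:E :> \bar R)%E by rewrite lee_fin.
  move=> mh; apply: esym.
  exact: (@ge0_integralZl _ lT R nu F mF _ (measurable_sqnorm mh) 2%:E (s0 h) two0).
have m2 (h : R -> R[i]) : measurableC h ->
    measurable_fun F (fun x : lT => 2%:E * (sqnorm (h x))%:E)%E.
  by move=> mh; apply: measurable_funeM; exact: measurable_sqnorm.
have z2 (h : R -> R[i]) (x : lT) : F x -> (0 <= 2%:E * (sqnorm (h x))%:E)%E.
  by move=> Fx; apply: mule_ge0 => //; exact: s0.
rewrite (Z f mf) (Z g mg) -(@ge0_integralD _ lT R nu F mF _ _ (z2 f) (m2 f mf) (z2 g) (m2 g mg)).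
apply: (@ge0_le_integral _ lT R nu F mF _ _ (s0 (fun x => f x + g x))
  (measurable_sqnorm (measurableC_add mf mg))).
- by apply: emeasurable_funD; exact: m2.
- by move=> x _; rewrite -!EFinM -EFinD lee_fin; exact: sqnormD_le.
Qed.

Lemma approx_near f : measurableC f ->
  (forall e : R, 0 < e -> exists2 g, approx g & (L2norm_sq F (fun x => f x - g x)%R < e%:E)%E) ->
  approx f.
Proof.
move=> mf h; split => // e e0.
have e4 : 0 < e / 4 by rewrite divr_gt0.
have [g [mg ag] fg] := h _ e4; have [t tL gt] := ag _ e4.
exists t => //.
have -> : (fun x => f x - trig t x) = fun x => (f x - g x) + (g x - trig t x).
  by apply/funext => x; rewrite addrA subrK.
apply: le_lt_trans (L2norm_sqD (measurableC_sub mf mg) (measurableC_sub mg (measurableC_trig t))) _.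
have -> : e%:E = (2%:E * (e / 4)%:E + 2%:E * (e / 4)%:E)%E.
  by rewrite -!EFinM -EFinD; congr (_%:E); field.
by apply: lteD; rewrite lte_pmul2l.
Qed.

Lemma L2norm_sq_eq0 f : measurableC f -> {ae nu, forall x, F x -> f x = 0} -> L2norm_sq F f = 0%E.
Proof.
move=> mf h.
have ae0 : ae_eq nu F (fun x : lT => (sqnorm (f x))%:E) (cst 0%E).
  by apply: ae_mono h => x hx Fx; rewrite /sqnorm (hx Fx) /= expr0n /= addr0.
apply: etrans (@ae_eq_integral _ lT R nu F _ _ mF (measurable_sqnorm mf) (measurable_cst _) ae0) _.
exact: integral0.
Qed.

Lemma approx_ae f g : measurableC g -> {ae nu, forall x, F x -> g x = f x} -> approx f -> approx g.
Proof.
move=> mg h af; apply: approx_near => // e e0; exists f => //.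
have [mf _] := af.
have h0 : {ae nu, forall x, F x -> g x - f x = 0} by apply: ae_mono h => x hx /hx ->; rewrite subrr.
by rewrite (L2norm_sq_eq0 (measurableC_sub mg mf) h0) lte_fin.
Qed.

Lemma approx_trig t : (forall p, p \in t -> L p.1) -> approx (trig t).
Proof.
move=> tL; split; first exact: measurableC_trig.
move=> e e0; exists t => //.
have h0 : {ae nu, forall x, F x -> trig t x - trig t x = 0} by apply: aeW => x _; rewrite subrr.
by rewrite (L2norm_sq_eq0 (measurableC_sub (measurableC_trig t) (measurableC_trig t)) h0) lte_fin.
Qed.

Lemma approx_expi l : L l -> approx (expi l).
Proof.
move=> Ll; rewrite (_ : expi l = trig [:: (l, 1)]).
  by apply: approx_trig => p; rewrite inE => /eqP ->.
by apply/funext => x; rewrite /trig big_seq1 mul1r.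
Qed.

Lemma approxD f g : approx f -> approx g -> approx (fun x => f x + g x).
Proof.
move=> [mf af] [mg ag]; split; first exact: measurableC_add.
move=> e e0; have e4 : 0 < e / 4 by rewrite divr_gt0.
have [t tL ft] := af _ e4; have [s sL gs] := ag _ e4.
exists (t ++ s) => [p|]; first by rewrite mem_cat => /orP[/tL|/sL].
have mN k u (mk : measurableC k) := measurableC_sub mk (measurableC_trig u).
have -> : (fun x => f x + g x - trig (t ++ s) x) = fun x => (f x - trig t x) + (g x - trig s x).
  by apply/funext => x; rewrite /trig big_cat /= addrACA opprD.
apply: le_lt_trans (L2norm_sqD (mN _ _ mf) (mN _ _ mg)) _.
have -> : e%:E = (2%:E * (e / 4)%:E + 2%:E * (e / 4)%:E)%E.
  by rewrite -!EFinM -EFinD; congr (_%:E); field.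
by apply: lteD; rewrite lte_pmul2l.
Qed.

Lemma approxZ (c : R[i]) f : approx f -> approx (fun x => c * f x).
Proof.
move=> [mf af]; split; first exact: measurableC_scale.
move=> e e0; pose k := sqnorm c + 1.
have k0 : 0 < k by rewrite ltr_wpDl // sqnorm_ge0.
have ek : 0 < e / k by rewrite divr_gt0.
have [t tL ft] := af _ ek.
exists [seq (p.1, c * p.2) | p <- t].
  by move=> _ /mapP[p /tL Lp ->].
have mft := measurableC_sub mf (measurableC_trig t).
have -> : (fun x => c * f x - trig [seq (p.1, c * p.2) | p <- t] x) =
    fun x => c * (f x - trig t x).
  apply/funext => x; rewrite mulrBr /trig big_map mulr_sumr; congr (_ - _).
  by apply: eq_bigr => p _; rewrite mulrA.
apply: (@le_lt_trans _ _ (k%:E * L2norm_sq F (fun x => f x - trig t x)%R)%E).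
  have s0 (h : R -> R[i]) (x : lT) : F x -> (0 <= (sqnorm (h x))%:E)%E.
    by move=> _; rewrite lee_fin sqnorm_ge0.
  have k0' : (0 <= k%:E)%E by rewrite lee_fin ltW.
  have E := @ge0_integralZl _ lT R nu F mF _ (measurable_sqnorm mft) k%:E
    (s0 (fun x => f x - trig t x)) k0'.
  rewrite -[X in (_ <= _ * X)%E]/(\int[nu]_(x in F) (sqnorm (f x - trig t x))%:E)%E -E.
  apply: (@ge0_le_integral _ lT R nu F mF _ _ (s0 (fun x => c * (f x - trig t x)))
    (measurable_sqnorm (measurableC_scale c mft))).
  - by apply: measurable_funeM; exact: measurable_sqnorm.
  - move=> x _; rewrite -EFinM lee_fin -/(sqnorm _) -/(sqnorm _) sqnormM.
    by rewrite ler_wpM2r ?sqnorm_ge0 // lerDl.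
have -> : e%:E = (k%:E * (e / k)%:E)%E by rewrite -EFinM mulrC divfK // gt_eqF.
by rewrite lte_pmul2l.
Qed.

Lemma approx_sum (I : Type) (s : seq I) (f : I -> R -> R[i]) :
  (forall i, approx (f i)) -> approx (fun x => \sum_(i <- s) f i x).
Proof.
move=> af; elim: s => [|i s IH].
  rewrite (_ : (fun x => _) = trig [::]); first by apply: approx_trig.
  by apply/funext => x; rewrite /trig !big_nil.
rewrite (_ : (fun x => _) = fun x => f i x + \sum_(j <- s) f j x); first exact: approxD.
by apply/funext => x; rewrite big_cons.
Qed.

(** Dominated convergence for the squares of [phi_ n - phi]; the unimodular [w] drops out of the
    norm. *)
Lemma approx_lim (phi_ : nat -> R -> R) (phi h : R -> R) (w : R -> R[i]) :
  (forall n, measurable_fun F (phi_ n : lT -> R)) -> measurable_fun F (phi : lT -> R) ->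
  measurableC w -> (forall x, sqnorm (w x) = 1) ->
  (forall n, approx (fun x => (phi_ n x)%:C * w x)) ->
  (forall x, F x -> phi_ ^~ x @ \oo --> phi x) ->
  (forall n x, F x -> `|phi_ n x - phi x| <= h x) ->
  nu.-integrable F (fun x => (h x ^+ 2)%:E) ->
  approx (fun x => (phi x)%:C * w x).
Proof.
move=> mphi_ mphi mw w1 aphi cphi phih ih.
have mm (k : R -> R) : measurable_fun F (k : lT -> R) -> measurableC (fun x => (k x)%:C * w x).
  by move=> mk; exact: (measurableC_mul (measurableC_real mk) mw).
apply: approx_near => [|e e0]; first exact: mm.
pose g_ n (x : lT) := ((phi_ n x - phi x) ^+ 2)%:E.
have mg n : measurable_fun F (g_ n).
  by apply/measurable_EFinP; apply: measurable_funX; exact: measurable_funB.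
have cg : {ae nu, forall x, F x -> g_ ^~ x @ \oo --> (cst 0%E : lT -> \bar R) x}.
  apply: aeW => x Fx; rewrite -[cst 0%E x]/((0 : R)%:E); apply/fine_cvgP; split; first exact: nearW.
  have h0 : (fun n => phi_ n x - phi x) @ \oo --> (0 : R).
    rewrite -(subrr (phi x)); apply: cvgB; [exact: cphi|exact: cvg_cst].
  rewrite (_ : _ \o _ = fun n => (phi_ n x - phi x) * (phi_ n x - phi x)).
    by rewrite -[X in _ --> X](mulr0 0); exact: cvgM.
  by apply/funext => n; rewrite /g_ /= expr2.
have gh : {ae nu, forall x n, F x -> (`|g_ n x| <= (h x ^+ 2)%:E)%E}.
  apply: aeW => x n Fx; rewrite /g_ /= lee_fin ger0_norm ?sqr_ge0 //.
  by rewrite -real_normK ?num_real // ler_sqr ?nnegrE // ?phih // (le_trans _ (phih n x Fx)).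
have [_ cv _] := dominated_convergence mF mg (measurable_cst _) cg ih gh.
have oe : ((0 : R)%:E < e%:E)%E by rewrite lte_fin.
have [n _ Hn] := cv _ (open_ereal_lt' oe).
exists (fun x => (phi_ n x)%:C * w x); first exact: aphi.
have := Hn n (leqnn n); rewrite /=; apply: le_lt_trans.
rewrite /L2norm_sq le_eqVlt; apply/orP; left; apply/eqP.
apply: eq_integral => x _; rewrite subr0 ger0_norm ?sqr_ge0 //; congr (_%:E).
rewrite -/(sqnorm _) -mulrBl sqnormM w1 mulr1 /sqnorm /= subrr expr0n addr0.
by rewrite -(sqrrN (phi x - _)) opprB.
Qed.

End Approximation.

(** * Indicators as limits of trigonometric polynomials *)

Section Sharpening.
Variable R : realType.
Implicit Types (y r t : R) (n k : nat).

Lemma onemX_ge t k : 0 <= t <= 1 -> 1 - k%:R * t <= (1 - t) ^+ k.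
Proof.
move=> /andP[t0 t1]; elim: k => [|k IH]; first by rewrite mul0r subr0 expr0.
rewrite exprS; have t2 : 0 <= 1 - t by rewrite subr_ge0.
have := ler_wpM2l t2 IH; apply: le_trans.
have kt : 0 <= k%:R * t * t by rewrite !mulr_ge0.
by rewrite -natr1; move: kt; nra.
Qed.

Lemma onemX_le t k : 0 <= t <= 1 -> (1 - t) ^+ k * (1 + k%:R * t) <= 1.
Proof.
move=> /andP[t0 t1]; elim: k => [|k IH]; first by rewrite mul0r addr0 expr0 mul1r.
have t2 : 0 <= 1 - t by rewrite subr_ge0.
apply: le_trans IH; rewrite exprS -mulrA mulrCA ler_wpM2l ?exprn_ge0 //.
have kt : 0 <= k%:R * t * t by rewrite !mulr_ge0.
by rewrite -natr1; move: kt t0; nra.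
Qed.

Lemma cvg_natM_expr r : 0 <= r < 1 -> (fun n => n%:R * r ^+ n) @ \oo --> (0 : R).
Proof.
(* Then [r <= s ^+ 2], so one factor [s ^+ n] absorbs [n] and the other tends to 0. *)
move=> /andP[r0 r1]; pose s := (1 + r) / 2.
have s0 : 0 < s by rewrite /s; lra.
have s1 : s < 1 by rewrite /s; lra.
have sr : r <= s ^+ 2 by rewrite /s expr2; have := sqr_ge0 (1 - r); nra.
pose de := s^-1 - 1.
have de0 : 0 < de by rewrite subr_gt0 invf_gt1.
have ns n : n%:R * s ^+ n <= de^-1.
  have h : 1 + n%:R * de <= s^-1 ^+ n.
    elim: n => [|n IH]; first by rewrite mul0r addr0 expr0.
    have si : 0 <= s^-1 by rewrite invr_ge0 ltW.
    rewrite exprS; apply: le_trans (ler_wpM2l si IH).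
    have -> : s^-1 = 1 + de by rewrite /de; ring.
    have dd : 0 <= n%:R * de * de by rewrite !mulr_ge0 // ltW.
    by rewrite -natr1; move: dd; nra.
  have sn : 0 < s ^+ n by rewrite exprn_gt0.
  rewrite -[leRHS]mul1r ler_pdivlMr // -(ler_pM2r (_ : 0 < (s ^+ n)^-1)) ?invr_gt0 //.
  rewrite mul1r mulrAC mulfK ?gt_eqF // -exprVn.
  by apply: le_trans h; rewrite lerDr.
have g : geometric de^-1 s @ \oo --> (0 : R).
  by apply: cvg_geometric; rewrite gtr0_norm.
apply: (squeeze_cvgr _ (cvg_cst (0 : R)) g).
apply: nearW => n; apply/andP; split; first by rewrite mulr_ge0 ?exprn_ge0.
rewrite /geometric /=; apply: le_trans (_ : n%:R * (s ^+ n * s ^+ n) <= _).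
  rewrite ler_wpM2l // -exprMn -expr2 lerXn2r ?nnegrE ?sqr_ge0 //.
by rewrite mulrA ler_wpM2r ?exprn_ge0 ?(ltW s0).
Qed.

(* Turns a trigonometric polynomial with values in [0, 1] into the indicator of
   the set where it is below [1/2]. *)
Lemma cvg_sharpen y : 0 <= y <= 1 ->
  (fun n => (1 - y ^+ n) ^+ (n * 2 ^ n)) @ \oo --> ((y < 2^-1)%R%:R : R).
Proof.
move=> /andP[y0 y1].
have yn n : 0 <= y ^+ n <= 1 by rewrite exprn_ge0 // exprn_ile1.
(* This quantity decides both Bernoulli-type bounds: it tends to 0 for [y < 2^-1]. The additional
   factor [n] makes it at least [n] otherwise, including the boundary case [y = 2^-1]. *)
have E n : (n * 2 ^ n)%:R * y ^+ n = n%:R * (2 * y) ^+ n.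
  by rewrite natrM natrX exprMn; ring.
have ge0 n k : 0 <= (1 - y ^+ n) ^+ k.
  by rewrite exprn_ge0 // subr_ge0; have /andP[] := yn n.
case: ltP => yh /=.
  have r01 : 0 <= 2 * y < 1 by apply/andP; split; lra.
  have c := cvg_natM_expr r01.
  have c1 : (fun n => 1 - n%:R * (2 * y) ^+ n) @ \oo --> (1 : R).
    by rewrite -[X in _ --> X]subr0; apply: cvgB => //; exact: cvg_cst.
  apply: (squeeze_cvgr _ c1 (cvg_cst (1 : R))).
  apply: nearW => n; rewrite -E onemX_ge //=.
  by rewrite exprn_ile1 // ?subr_ge0 ?gerBl; have /andP[] := yn n.
apply: (squeeze_cvgr _ (cvg_cst (0 : R)) (cvg_harmonic (R := R))).
apply: nearW => n; rewrite ge0 /= /harmonic /=.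
have h : n.+1%:R <= 1 + (n * 2 ^ n)%:R * y ^+ n.
  rewrite E -natr1 addrC lerD2l -[leLHS]mulr1 ler_wpM2l // exprn_ege1 //; lra.
rewrite -[leRHS]mul1r ler_pdivlMr ?ltr0n //.
by apply: le_trans (onemX_le (n * 2 ^ n) (yn n)); rewrite ler_wpM2l.
Qed.

End Sharpening.

Section SimpleFunctions.
Import HBNNSimple.

Lemma nnsfun_ind d (T : measurableType d) (R : realType) (P : (T -> R) -> Prop) :
  P (fun=> 0) -> (forall f g, P f -> P g -> P (fun x => f x + g x)) ->
  (forall (r : R) f, P f -> P (fun x => r * f x)) ->
  (forall B, measurable B -> P \1_B) -> forall f : {nnsfun T >-> R}, P f.
Proof.
move=> P0 PD PZ PI f.
have -> : (f : T -> R) = fun x => \sum_(r <- finmap.enum_fset (fset_set (range f)))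
    r * \1_(f @^-1` [set r]) x.
  by apply/funext => x; rewrite fimfunE fsbig_finite.
elim: (finmap.enum_fset _) => [|r s IH].
  by rewrite (_ : (fun x => _) = fun=> 0) //; apply/funext => x; rewrite big_nil.
rewrite (_ : (fun x => _) = fun x => r * \1_(f @^-1` [set r]) x +
    \sum_(r <- s) r * \1_(f @^-1` [set r]) x).
  by apply: PD => //; apply: PZ; apply: PI.
by apply/funext => x; rewrite big_cons.
Qed.

End SimpleFunctions.

Section Fold.
Variable R : realType.
Local Notation mT := (measurableTypeR R).
Variable u : R.
Hypothesis u0 : 0 < u.

Definition fold (x : R) : R := x - (Num.floor (x / u))%:~R * u.

Lemma measurable_floor : measurable_fun setT (fun x : mT => (Num.floor x)%:~R : mT).
Proof.
apply: (measurability _ (RGenOInfty.measurableE R)) => _ [_ [a ->] <-].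
rewrite setTI (_ : _ @^-1` _ = `[(Num.floor a + 1)%:~R, +oo[%classic) //.
apply/seteqP; split => x /=; rewrite !in_itv /= !andbT => h.
  have /andP[f1 _] := floor_itv x; apply: le_trans f1.
  rewrite ler_int -ltzD1 ltrD2r -(ltr_int R); have /andP[f2 _] := floor_itv a.
  exact: le_lt_trans f2 h.
have /andP[_ f1] := floor_itv a; have /andP[_ f2] := floor_itv x.
apply: lt_le_trans f1 _; rewrite ler_int -ltzD1 -(ltr_int R).
exact: le_lt_trans h f2.
Qed.

Lemma measurable_fold : measurable_fun setT (fold : mT -> mT).
Proof.
apply: measurable_funB => //; apply: measurable_funM => //.
apply: (measurableT_comp (f := fun x : mT => (Num.floor x)%:~R : mT)) measurable_floor _.
exact: measurable_funM.
Qed.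

Lemma fold_itv x : 0 <= fold x < u.
Proof.
have /andP[] := floor_itv (x / u); rewrite ler_pdivlMr // ltr_pdivrMr //.
rewrite intrD mulrDl mul1r /fold; set k := _ * u => h1 h2.
by apply/andP; split; lra.
Qed.

Lemma fold_unfold x : x = fold x + (Num.floor (x / u))%:~R * u.
Proof. by rewrite /fold subrK. Qed.

Lemma cis_fold x : cis (x / u) = cis (fold x / u).
Proof.
rewrite {1}(fold_unfold x) mulrDl mulfK ?gt_eqF // cisD cis_int mulr1 //.
Qed.

(** The second sine has the sign of [x - a]; the first is nonnegative. Each alone has period
    [2 * u], but their product has period [u] and is, by [arc_identity], a trigonometric polynomial
    of degree one. *)
Lemma sin_arc (a x : R) : 0 <= a < u -> 0 <= x < u ->
  (0 < sin (pi * (x / u)) * sin (pi * ((x - a) / u))) = (a < x).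
Proof.
move=> /andP[a0 au] /andP[x0 xu].
have pi0 := pi_gt0 R.
have pos (t : R) : 0 < t < u -> 0 < sin (pi * (t / u)).
  move=> /andP[t0 tu]; apply: sin_gt0_pi; rewrite mulr_gt0 ?divr_gt0 //=.
  by rewrite gtr_pMr // ltr_pdivrMr // mul1r.
have sx : 0 <= sin (pi * (x / u)).
  move: x0; rewrite le_eqVlt => /orP[/eqP<-|x0]; first by rewrite mul0r mulr0 sin0.
  by rewrite ltW // pos // x0.
have [ax|xa|->] := ltgtP a x.
- rewrite mulr_gt0 // pos //; apply/andP; split; lra.
- apply/negbTE; rewrite -leNgt mulr_ge0_le0 //.
  have -> : pi * ((x - a) / u) = - (pi * ((a - x) / u)) by rewrite -mulrN -mulNr opprB.
  by rewrite sinN oppr_le0 ltW // pos //; apply/andP; split; lra.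
- by rewrite subrr mul0r mulr0 sin0 mulr0 ltxx.
Qed.

Lemma arc_identity (a x : R) :
  2 * (sin (pi * (x / u)) * sin (pi * ((x - a) / u))) =
  cos (pi * (a / u)) - (cos (pi * (a / u)) * complex.Re (cis (x / u)) +
     sin (pi * (a / u)) * complex.Im (cis (x / u))).
Proof.
have uN : u != 0 by rewrite gt_eqF.
pose p := pi * (x / u); pose b := pi * (a / u).
have -> : pi * ((x - a) / u) = p - b by rewrite /p /b mulrBl mulrBr.
rewrite /cis /=; have -> : 2 * pi * (x / u) = p + p by rewrite /p; ring.
rewrite -/p -/b cosD sinB sinD.
have := cos2Dsin2 p; set cp := cos p; set sp := sin p; set cb := cos b; set sb := sin b.
move=> E; have -> : cb - (cb * (cp * cp - sp * sp) + sb * (sp * cp + cp * sp)) =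
   cb * (cp ^+ 2 + sp ^+ 2) - (cb * (cp * cp - sp * sp) + sb * (sp * cp + cp * sp)).
  by rewrite E mulr1.
ring.
Qed.

End Fold.

Import HBNNSimple.

Section Multipliers.
Variable R : realType.
Local Notation nu := (@completed_lebesgue_measure R).
Local Notation mT := (measurableTypeR R).
Local Notation lT := (lebesgueT R).
Variables (F : set lT) (L : set R) (u : R).
Hypothesis mF : measurable F.
Hypothesis F_fin : (nu F < +oo)%E.
Hypothesis u0 : 0 < u.
Hypothesis L_shift : forall la, L la -> L (la + u^-1) /\ L (la - u^-1).
Implicit Types phi psi : R -> R.

(** Asking for all [la] in [L] at once makes the notion stable under multiplication by the cosine
    and sine of period [u], which move [la] by [u^-1]. *)
Definition multiplier phi := measurable_fun F (phi : lT -> R) /\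
  forall la, L la -> approx F L (fun x => (phi x)%:C * expi la x).

Lemma multiplier_eq phi psi : (forall x, phi x = psi x) -> multiplier phi -> multiplier psi.
Proof. by move=> E; rewrite (_ : phi = psi) //; apply/funext. Qed.

Lemma multiplier1 : multiplier (fun=> 1).
Proof.
split; first exact: measurable_cst.
move=> la Lla; rewrite (_ : (fun x => _) = expi la); first exact: approx_expi.
by apply/funext => x; rewrite mul1r.
Qed.

Lemma multiplierD phi psi : multiplier phi -> multiplier psi ->
  multiplier (fun x => phi x + psi x).
Proof.
move=> [m1 h1] [m2 h2]; split; first exact: measurable_funD.
move=> la Lla; rewrite (_ : (fun x => _) = fun x => (phi x)%:C * expi la x + (psi x)%:C * expi la x).
  exact: (approxD mF (h1 _ Lla) (h2 _ Lla)).
by apply/funext => x; rewrite rmorphD mulrDl.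
Qed.

Lemma multiplierZ (r : R) phi : multiplier phi -> multiplier (fun x => r * phi x).
Proof.
move=> [m1 h1]; split; first exact: measurable_funM.
move=> la Lla; rewrite (_ : (fun x => _) = fun x => r%:C * ((phi x)%:C * expi la x)).
  exact: (approxZ mF r%:C (h1 _ Lla)).
by apply/funext => x; rewrite rmorphM mulrA.
Qed.

Lemma multiplier_cst (r : R) : multiplier (fun=> r).
Proof. by apply: multiplier_eq (multiplierZ r multiplier1) => x; rewrite mulr1. Qed.

Lemma multiplier_sum (I : Type) (s : seq I) (f : I -> R -> R) :
  (forall i, multiplier (f i)) -> multiplier (fun x => \sum_(i <- s) f i x).
Proof.
move=> mf; elim: s => [|i s IH].
  by apply: multiplier_eq (multiplier_cst 0) => x; rewrite big_nil.
by apply: multiplier_eq (multiplierD (mf i) IH) => x; rewrite big_cons.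
Qed.

Lemma multiplier_lim (phi_ : nat -> R -> R) phi (C : R) :
  (forall n, multiplier (phi_ n)) -> measurable_fun F (phi : lT -> R) ->
  (forall x, F x -> phi_ ^~ x @ \oo --> phi x) ->
  (forall n x, F x -> `|phi_ n x - phi x| <= C) -> multiplier phi.
Proof.
move=> mphi_ mphi cphi bphi; split; [exact: mphi|move=> la Lla].
apply: (approx_lim (h := fun=> C) mF _ mphi (measurableC_expi F la) _ _ cphi bphi).
- by move=> n; have [] := mphi_ n.
- by move=> x; rewrite /sqnorm /expi /= cos2Dsin2.
- by move=> n; have [_ h] := mphi_ n; exact: h.
- apply/integrableP; split; first exact: measurable_cst.
  rewrite (_ : (fun x => _) = cst (`|C ^+ 2|)%:E) //.
  by rewrite (integral_cst nu mF) lte_mul_pinfty // lee_fin.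
Qed.

Let expi_shift (la x : R) : expi (la + u^-1) x = expi la x * cis (x / u) /\
  expi (la - u^-1) x = expi la x * cis (- (x / u)).
Proof. by rewrite !expiE -!cisD; split; congr cis; ring. Qed.

Lemma multiplier_cos phi : multiplier phi ->
  multiplier (fun x => phi x * complex.Re (cis (x / u))).
Proof.
move=> [m1 h1]; split.
  apply: (measurable_funM m1); apply: measurable_fun_lebesgue.
  by under eq_fun => x do rewrite mulrC; exact: measurable_Re_cis.
move=> la Lla; have [L1 L2] := L_shift Lla.
rewrite (_ : (fun x => _) = fun x => (2^-1)%:C *
    ((phi x)%:C * expi (la + u^-1) x + (phi x)%:C * expi (la - u^-1) x)).
  exact: (approxZ mF _ (approxD mF (h1 _ L1) (h1 _ L2))).
apply/funext => x; have [-> ->] := expi_shift la x.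
rewrite -conj_cis; case: (cis _) => c s; case: (expi la x) => p q.
by apply/eqP; rewrite eq_complex /=; apply/andP; split; apply/eqP; field.
Qed.

Lemma multiplier_sin phi : multiplier phi ->
  multiplier (fun x => phi x * complex.Im (cis (x / u))).
Proof.
move=> [m1 h1]; split.
  apply: (measurable_funM m1); apply: measurable_fun_lebesgue.
  by under eq_fun => x do rewrite mulrC; exact: measurable_Im_cis.
move=> la Lla; have [L1 L2] := L_shift Lla.
rewrite (_ : (fun x => _) = fun x => (0 -i* 2^-1) *
    ((phi x)%:C * expi (la + u^-1) x + (-1) * ((phi x)%:C * expi (la - u^-1) x))).
  exact: (approxZ mF _ (approxD mF (h1 _ L1) (approxZ mF (-1) (h1 _ L2)))).
apply/funext => x; have [-> ->] := expi_shift la x.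
rewrite -conj_cis; case: (cis _) => c s; case: (expi la x) => p q.
by apply/eqP; rewrite eq_complex /=; apply/andP; split; apply/eqP; field.
Qed.

Definition trig1 (al be ga x : R) : R :=
  al + be * complex.Re (cis (x / u)) + ga * complex.Im (cis (x / u)).

Lemma multiplier_trig1 al be ga phi : multiplier phi ->
  multiplier (fun x => phi x * trig1 al be ga x).
Proof.
move=> mphi.
apply: multiplier_eq (multiplierD (multiplierD (multiplierZ al mphi)
   (multiplierZ be (multiplier_cos mphi))) (multiplierZ ga (multiplier_sin mphi))) => x.
by rewrite /trig1; ring.
Qed.

Lemma multiplier_sharpen al be ga n k :
  multiplier (fun x => (1 - trig1 al be ga x ^+ n) ^+ k).
Proof.
elim: k => [|k IH]; first by apply: multiplier_eq multiplier1 => x; rewrite expr0.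
have pw j : multiplier (fun x => (1 - trig1 al be ga x ^+ n) ^+ k * trig1 al be ga x ^+ j).
  elim: j => [|j IHj]; first by apply: multiplier_eq IH => x; rewrite expr0 mulr1.
  by apply: multiplier_eq (multiplier_trig1 al be ga IHj) => x; rewrite exprSr mulrA.
apply: multiplier_eq (multiplierD IH (multiplierZ (-1) (pw n))) => x.
by rewrite exprSr; ring.
Qed.

Local Notation fold := (fold u).

Lemma measurable_comp_fold (g : mT -> R) : measurable_fun setT g ->
  measurable_fun F (fun x : lT => g (fold x)).
Proof.
move=> mg; apply: (@measurable_fun_lebesgue _ _ _ (fun x : mT => g (fold x))).
apply: (measurableT_comp mg); exact: measurable_fold.
Qed.

Lemma multiplier_arc (a : R) : multiplier (fun x => \1_(`]a, +oo[%classic) (fold x)).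
Proof.
have [a0|a0] := ltP a 0.
  apply: multiplier_eq multiplier1 => x; rewrite indicE mem_set //= in_itv /= andbT.
  by have /andP[h _] := fold_itv u0 x; apply: lt_le_trans h.
(* By [arc_identity], [y] below is [2^-1] minus half the product in [sin_arc]. *)
have [au|au] := leP u a.
  apply: multiplier_eq (multiplier_cst 0) => x; rewrite indicE memNset //= in_itv /= andbT.
  by have /andP[_ h] := fold_itv u0 x; apply/negP; rewrite -leNgt (le_trans (ltW h)).
pose b := pi * (a / u); pose y := trig1 (2^-1 - cos b / 4) (cos b / 4) (sin b / 4).
have yE x : y x = 2^-1 - 2^-1 * (sin (pi * (fold x / u)) * sin (pi * ((fold x - a) / u))).
  have := arc_identity u0 a (fold x); rewrite -cis_fold // -/b /y /trig1.
  set S := sin _ * _; lra.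
have y01 x : 0 <= y x <= 1.
  rewrite yE; set S := sin _ * _; have : `|S| <= 1.
    by rewrite normrM mulr_ile1 // ler_norml sin_geN1 sin_le1.
  by move=> /ler_normlP[? ?]; apply/andP; split; lra.
have lim x : (fun n => (1 - y x ^+ n) ^+ (n * 2 ^ n)) @ \oo --> (\1_(`]a, +oo[%classic) (fold x) : R).
  have := cvg_sharpen (y01 x); rewrite indicE (_ : (y x < 2^-1) = (fold x \in `]a, +oo[%classic)) //.
  rewrite yE ltrBlDr ltrDl pmulr_rgt0 // sin_arc ?a0 // ?fold_itv //.
  by apply/idP/idP => [h|/set_mem]; [apply: mem_set|]; rewrite /= in_itv /= andbT.
apply: (@multiplier_lim (fun n x => (1 - y x ^+ n) ^+ (n * 2 ^ n)) _ 1).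
- by move=> n; exact: multiplier_sharpen.
- by apply: measurable_comp_fold; exact: measurable_indic.
- by move=> x _; exact: lim.
- move=> n x _; have /andP[h1 h2] := y01 x.
  have /andP[p0 p1] : 0 <= (1 - y x ^+ n) ^+ (n * 2 ^ n) <= 1.
    by rewrite exprn_ge0 ?exprn_ile1 // ?subr_ge0 ?gerBl ?exprn_ge0 // exprn_ile1.
  by apply/ler_normlP; rewrite indicE; case: (_ \in _) => /=; split; lra.
Qed.

(** Half-lines form a generating class closed under intersection, and multipliers are stable under
    complements and countable disjoint unions, so Dynkin's theorem applies. *)
Lemma multiplier_indic (B : set mT) : measurable B -> multiplier (fun x => \1_B (fold x)).
Proof.
have mB0 (S : set mT) : measurable S -> measurable_fun F (fun x : lT => (\1_S (fold x) : R)).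
  by move=> mS; apply: measurable_comp_fold; exact: measurable_indic.
move=> mB; have sB : (@RGenOInfty.G R).-sigma.-measurable B by rewrite -RGenOInfty.measurableE.
apply: (@dynkin_induction _ mT (@RGenOInfty.G R) (fun B => multiplier (fun x => \1_B (fold x)))) sB.
- exact: RGenOInfty.measurableE.
- move=> _ _ [a ->] [b ->]; exists (Num.max a b); apply/seteqP; split => x /=; rewrite !in_itv /= !andbT gt_max.
    by move=> [-> ->].
  by move=> /andP[].
- by apply: multiplier_eq multiplier1 => x; rewrite indicE mem_set.
- by move=> _ [a ->]; exact: multiplier_arc.
- move=> S mS hS; apply: multiplier_eq (multiplierD multiplier1 (multiplierZ (-1) hS)) => x.
  by rewrite !indicE in_setC; case: (_ \in _); rewrite /= ?mulr1 ?mulr0 ?subrr ?addr0.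
move=> E mE tE hE.
have partial (n : nat) (y : R) :
    \sum_(k <- index_iota 0 n) \1_(E k) y = (`[< exists2 k, (k < n)%N & E k y >])%:R :> R.
  rewrite big_mkord; case: asboolP => [[k kn Ek]|nE].
    rewrite (bigD1 (Ordinal kn)) //= indicE mem_set // big1 ?addr0 // => j jk.
    rewrite indicE memNset // => Ej; move/eqP: jk; apply; apply: val_inj => /=.
    by apply: (tE _ _ I I); exists y.
  by rewrite big1 // => j _; rewrite indicE memNset // => Ej; apply: nE; exists j.
apply: (@multiplier_lim (fun n x => \sum_(k <- index_iota 0 n) \1_(E k) (fold x)) _ 1).
- by move=> n; exact: multiplier_sum.
- by apply: mB0; exact: bigcupT_measurable.
- move=> x _; have [[k _ Ek]|nE] := pselect ((\bigcup_k E k) (fold x)).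
    apply: cvg_near_cst; exists k.+1 => // n /= kn.
    by rewrite partial asboolT ?indicE ?mem_set //; [exists k|exists k].
  apply: cvg_near_cst; apply: nearW => n.
  by rewrite partial asboolF ?indicE ?memNset // => -[k _ Ek]; apply: nE; exists k.
- move=> n x _; rewrite partial indicE.
  by case: (asbool _); case: (_ \in _); rewrite ?subrr ?subr0 ?sub0r ?normrN ?normr0 ?normr1.
Qed.

Lemma multiplier_bounded (g : mT -> R) C : measurable_fun setT g -> (forall x, `|g x| <= C) ->
  multiplier (fun x => g (fold x)).
Proof.
move=> mg gC.
suff main (h : mT -> R) K : measurable_fun setT h -> (forall x, 0 <= h x <= K) ->
    multiplier (fun x => h (fold x)).
  have := main (fun x => g x + C) (C + C).
  move=> /(_ _ _)/(multiplierD (multiplier_cst (- C))) h.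
  apply: (multiplier_eq _ (h _ _)) => [x||x]; first by ring.
    exact: measurable_funD.
  by have /ler_normlP[? ?] := gC x; apply/andP; split; lra.
move=> mh hK.
have mh' : measurable_fun setT (EFin \o h) by exact/measurable_EFinP.
have h0 x : setT x -> (0 <= (EFin \o h) x)%E by rewrite lee_fin; have /andP[] := hK x.
pose h_ n := nnsfun_approx measurableT mh' n.
have h_le n x : 0 <= h_ n x <= h x.
  apply/andP; split; first exact: fun_ge0.
  rewrite -lee_fin /h_ nnsfun_approxE; exact: le_approx.
apply: (@multiplier_lim (fun n x => h_ n (fold x)) _ K).
- move=> n; apply: (@nnsfun_ind _ _ _ (fun f : mT -> R => multiplier (fun x => f (fold x)))).
  + exact: multiplier_cst.
  + by move=> f f' hf hf'; exact: (multiplierD hf hf').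
  + by move=> r f hf; exact: (multiplierZ r hf).
  + exact: multiplier_indic.
- exact: measurable_comp_fold.
- move=> x _; have := @cvg_nnsfun_approx _ mT R setT measurableT _ mh' h0 (fold x) I.
  by move=> /fine_cvgP[_].
- move=> n x _; have /andP[a1 a2] := h_le n (fold x); have /andP[b1 b2] := hK (fold x).
  by apply/ler_normlP; split; lra.
Qed.

End Multipliers.

Section Completeness.
Variable R : realType.
Local Notation mu := (@lebesgue_measure R).
Local Notation nu := (@completed_lebesgue_measure R).
Local Notation mT := (measurableTypeR R).
Local Notation lT := (lebesgueT R).
Variables (F : set lT) (A : set mT) (D u : R) (Q : nat) (Lam : seq nat).
Hypothesis mF : measurable F.
Hypothesis F_fin : (nu F < +oo)%E.
Hypothesis mA : measurable A.
Hypothesis AF : A `<=` F.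
Hypothesis FA : {ae mu, forall x, F x -> A x}.
Hypothesis FD : forall x, F x -> `|x| < D.
Hypothesis u0 : 0 < u.
Hypothesis Q0 : (0 < Q)%N.
Hypothesis Lam0 : (0 < size Lam)%N.
Local Notation I0 := (fold_bound D u).
Local Notation J := 'I_(I0.*2.+1).
Hypothesis fibers : {ae mu, forall x, 0 <= x < u -> fiber_orthogonal A u Q I0 Lam x}.
Local Notation L := (spectrum u Q Lam).
Local Notation freq := (frequency u Q).

Let Q1 : Q%:R != 0 :> R.
Proof. by rewrite pnatr_eq0 -lt0n. Qed.
Let u1 : u != 0.
Proof. by rewrite gt_eqF. Qed.

Let L_shift la : L la -> L (la + u^-1) /\ L (la - u^-1).
Proof.
move=> [l [n [lL ->]]]; split; [exists l, (n + 1)|exists l, (n - 1)]; split => //.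
  by rewrite /frequency intrD; field; rewrite u1 Q1.
by rewrite /frequency intrB; field; rewrite u1 Q1.
Qed.

Lemma ae_fold_fiber : {ae mu, forall x, fiber_orthogonal A u Q I0 Lam (fold u x)}.
Proof.
apply: ae_mono (ae_forall_int (fun k : int => ae_shift (k%:~R * u) fibers)) => x hx.
exact: (hx (Num.floor (x / u)) (fold_itv u0 x)).
Qed.

(* On each fiber the exponentials of [Lam] form an orthogonal basis, and the
   coefficients of [\1_B] in this basis are [u]-periodic functions. *)
Lemma fiber_expansion (B : set R) x : A x -> fiber_orthogonal A u Q I0 Lam (fold u x) ->
  (\1_B x)%:C = \sum_(l <- Lam) \sum_(a : J) (size Lam)%:R^-1 *
    ((\1_(A `&` B) (fold u x + offset a))%:C * cis (- (freq l 0 * (fold u x + offset a)))) *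
    cis (freq l 0 * x).
Proof.
move=> Ax [_ dual]; set y := fold u x in dual *; pose j := Num.floor (x / u).
have xE : x = y + j%:~R * u := fold_unfold u x.
have n0 : (size Lam)%:R != 0 :> R[i] by rewrite pnatr_eq0 -lt0n.
have Ay : A (y + j%:~R * u) by rewrite -xE.
have jI : (`|j|%N <= I0)%N by apply: (fold_index AF FD u0 (fold_itv u0 x)) Ay.
have jE : (absz (j + I0%:Z)%R)%:Z - I0%:Z = j.
  by rewrite gez0_abs ?addrK //; move: jI; move: I0 => b; clear; lia.
have aI : (absz (j + I0%:Z)%R < I0.*2.+1)%N.
  by move: jI; move: I0 => b; clear; lia.
pose a0 : J := Ordinal aI.
have off0 : offset a0 = j%:~R * u by rewrite /offset /= jE.
rewrite exchange_big /=.
rewrite (eq_bigr (fun a : J => (size Lam)%:R^-1 * (\1_(A `&` B) (y + offset a))%:C *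
   \sum_(l <- Lam) cis ((j - (a%:Z - I0%:Z))%:~R * (l%:R / Q%:R)))); last first.
  move=> a _; rewrite mulr_sumr; apply: eq_bigr => l _.
  rewrite -!mulrA; congr (_ * (_ * _)); rewrite -cisD; congr cis.
  rewrite xE intrB /frequency /offset; set k := (a%:Z - _)%:~R; set jj := j%:~R.
  by rewrite mulr0z; field; rewrite u1 Q1.
rewrite (bigD1 a0) // [X in _ = _ + X]big1 ?addr0 => [|a aa0]; last first.
  rewrite indicE; have [/set_mem[Aa _]|_] := boolP (_ \in _); last by rewrite mulr0 mul0r.
  rewrite (dual j _ Ay Aa) ifN ?mulr0 //.
  apply: contra aa0 => /eqP E; apply/eqP/val_inj => /=.
  have : (absz (j + I0%:Z)%R)%:Z = a%:Z by rewrite -[a%:Z](subrK I0%:Z) -E -{2}jE subrK.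
  by case=> ->.
rewrite jE (dual j j Ay Ay) eqxx mulrAC mulVf // mul1r off0 -xE.
rewrite !indicE in_setI (mem_set Ax) //.
Qed.

Lemma approx_borel (B : set mT) : measurable B -> approx F L (fun x => (\1_B x)%:C).
Proof.
move=> mB.
pose g l a (h : R[i] -> R) (y : mT) : R :=
  \1_(A `&` B) (y + offset (a : J)) * h (cis ((- freq l 0) * (y + offset a))).
have mg l a h : (forall c : R, measurable_fun setT (fun x : mT => h (cis (c * x)) : mT)) ->
    (forall x : R, `|h (cis x)| <= 1) -> multiplier F L (fun x => g l a h (fold u x)).
  move=> mh h1; apply: (multiplier_bounded mF F_fin u0 L_shift (C := 1)).
    apply: measurable_funM.
      rewrite (_ : (fun y : mT => \1_(A `&` B) (y + offset a)) =
         \1_([set x | (A `&` B) (x - - offset a)] : set mT)).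
        by apply: measurable_indic; apply: measurable_shift; exact: measurableI.
      by apply/funext => x; rewrite -indic_shift opprK.
    apply: (measurableT_comp (f := fun x : mT => h (cis (- freq l 0 * x)))) (mh _) _.
    exact: measurable_funD.
  move=> x; rewrite /g indicE; case: (_ \in _); rewrite ?mul1r ?h1 //.
  by rewrite mul0r normr0.
(* Multipliers are real, so the periodic coefficient enters through its real part and ['i] times its
   imaginary part. *)
pose term l a x : R[i] := (size Lam)%:R^-1 *
  ((g l a (@complex.Re R) (fold u x))%:C * expi (freq l 0) x +
    'i * ((g l a (@complex.Im R) (fold u x))%:C * expi (freq l 0) x)).
have aterm l a : l \in Lam -> approx F L (term l a).
  move=> lL; have Ll : L (freq l 0) by exists l, 0.
  have [_ h1] := mg l a _ (@measurable_Re_cis R) (@Re_cis_le1 R).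
  have [_ h2] := mg l a _ (@measurable_Im_cis R) (@Im_cis_le1 R).
  exact: (approxZ mF _ (approxD mF (h1 _ Ll) (approxZ mF 'i (h2 _ Ll)))).
have asum : approx F L (fun x => \sum_(i < size Lam) \sum_(a : J) term (nth 0%N Lam i) a x).
  apply: (approx_sum mF) => i; apply: (approx_sum mF) => a; apply: aterm.
  by rewrite mem_nth.
apply: (approx_ae mF _ _ asum).
  by apply: measurableC_real; apply: measurable_fun_lebesgue; exact: measurable_indic.
have h : {ae mu, forall x, F x -> (\1_B x)%:C =
    \sum_(i < size Lam) \sum_(a : J) term (nth 0%N Lam i) a x}.
  apply: ae_mono2 FA ae_fold_fiber => x FAx hx /FAx Ax.
  rewrite (fiber_expansion B Ax hx) (big_nth 0%N) big_mkord.
  apply: eq_bigr => i _; apply: eq_bigr => a _; rewrite /term -!mulrA; congr (_ * _).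
  rewrite !mulrA -mulrDl expiE; congr (_ * _).
  rewrite /g mulNr; case: (cis _) => p q; set k := \1_(_) _.
  by apply/eqP; rewrite eq_complex /=; apply/andP; split; apply/eqP; ring.
exact: ae_lebesgue h.
Qed.

Lemma approx_lebesgue (B : set lT) : measurable B -> approx F L (fun x => (\1_B x)%:C).
Proof.
move=> mB; have [B' [mB' BB nB]] := lebesgue_measurable_borel mB.
apply: (approx_ae mF _ _ (approx_borel mB')).
  by apply: measurableC_real; exact: measurable_indic.
have h : {ae mu, forall x, B x -> B' x}.
  by apply: negligibleS nB => x /= /not_implyP.
apply: ae_mono (ae_lebesgue h) => x hx _; congr (_%:C); rewrite !indicE; congr (_%:R).
by congr (nat_of_bool _); apply/idP/idP => /set_mem; [move=> /hx|move=> /BB]; exact: mem_set.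
Qed.

Import HBNNSimple.

Lemma approx_nonneg (f : R -> R) : measurable_fun F (f : lT -> R) -> (forall x, 0 <= f x) ->
  nu.-integrable F (fun x => (f x ^+ 2)%:E) -> approx F L (fun x => (f x)%:C).
Proof.
move=> mf f0 if2.
have mf' : measurable_fun F (EFin \o (f : lT -> R)) by exact/measurable_EFinP.
have f0' (x : lT) : F x -> (0 <= (EFin \o (f : lT -> R)) x)%E by move=> _; rewrite lee_fin.
pose f_ n : {nnsfun lT >-> R} := nnsfun_approx mF mf' n.
have f_le n x : F x -> 0 <= f_ n x <= f x.
  move=> Fx; apply/andP; split; first exact: fun_ge0.
  rewrite -lee_fin /f_ nnsfun_approxE; exact: le_approx.
have simple (g : {nnsfun lT >-> R}) : approx F L (fun x => (g x)%:C).
  apply: (@nnsfun_ind _ _ _ (fun g : lT -> R => approx F L (fun x => (g x)%:C))).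
  - have := approx_lebesgue (@measurable0 _ lT).
    by rewrite (_ : (fun x => _) = fun=> 0%:C) //; apply/funext => x; rewrite indic0.
  - move=> g1 g2 h1 h2; rewrite (_ : (fun x => _) = fun x => (g1 x)%:C + (g2 x)%:C).
      exact: (approxD mF h1 h2).
    by apply/funext => x; rewrite rmorphD.
  - move=> r g1 h1; rewrite (_ : (fun x => _) = fun x => r%:C * (g1 x)%:C).
      exact: (approxZ mF _ h1).
    by apply/funext => x; rewrite rmorphM.
  - exact: approx_lebesgue.
rewrite (_ : (fun x => _) = fun x => (f x)%:C * 1); last by apply/funext => x; rewrite mulr1.
apply: (@approx_lim R F L mF (fun n => f_ n) f f (fun=> 1)).
- by move=> n; apply: measurable_funTS; exact: measurable_funPT.
- exact: mf.
- exact: measurableC_cst.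
- by move=> x; rewrite /sqnorm /= expr1n expr0n addr0.
- move=> n; rewrite (_ : (fun x => _) = fun x => (f_ n x)%:C); first exact: simple.
  by apply/funext => x; rewrite mulr1.
- move=> x Fx; have := @cvg_nnsfun_approx _ lT R F mF _ mf' f0' x Fx.
  by move=> /fine_cvgP[_].
- move=> n x Fx; have /andP[a1 a2] := f_le n x Fx.
  by apply/ler_normlP; split; lra.
- exact: if2.
Qed.

Lemma approx_L2 f : in_L2 F f -> approx F L f.
Proof.
move=> [mRe mIm f2].
have int (p : R -> R) : measurable_fun F (p : lT -> R) -> (forall x, p x ^+ 2 <= sqnorm (f x)) ->
    nu.-integrable F (fun x => (p x ^+ 2)%:E).
  move=> mp hp.
  have mp2 : measurable_fun F (fun x : lT => (p x ^+ 2)%:E).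
    by apply/measurable_EFinP; exact: measurable_funX.
  have mf2 : measurable_fun F (fun x : lT => (sqnorm (f x))%:E) by apply: measurable_sqnorm.
  apply: (@le_integrable _ lT R nu F mF _ (fun x => (sqnorm (f x))%:E) mp2).
    move=> x _; rewrite lee_fin !ger0_norm ?sqr_ge0 ?sqnorm_ge0 //; exact: hp.
  apply/integrableP; split => //.
  rewrite (_ : (\int[nu]_(x in F) _)%E = L2norm_sq F f) //.
  by apply: eq_integral => x _; rewrite gee0_abs // lee_fin sqnorm_ge0.
pose po (p : R -> R) x := Num.max (p x) 0.
have real_part (p : R -> R) : measurable_fun F (p : lT -> R) ->
    (forall x, p x ^+ 2 <= sqnorm (f x)) -> approx F L (fun x => (po p x)%:C).
  move=> mp hp.
  have mpo : measurable_fun F (po p : lT -> R).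
    by apply: measurable_maxr => //; exact: measurable_cst.
  apply: (approx_nonneg mpo) => [x|]; first by rewrite le_max lexx orbT.
  apply: (int _ mpo) => x; apply: le_trans (hp x); rewrite /po.
  by case: (leP (p x) 0) => // _; rewrite expr0n sqr_ge0.
have mN (p : R -> R) : measurable_fun F (p : lT -> R) ->
    measurable_fun F ((fun x => - p x) : lT -> R).
  move=> mp; rewrite (_ : (fun x => - p x) = fun x => -1 * p x).
    by apply: measurable_funM => //; exact: measurable_cst.
  by apply/funext => x; rewrite mulN1r.
have b1 x : complex.Re (f x) ^+ 2 <= sqnorm (f x) by rewrite lerDl sqr_ge0.
have b2 x : complex.Im (f x) ^+ 2 <= sqnorm (f x) by rewrite lerDr sqr_ge0.
have b3 x : (- complex.Re (f x)) ^+ 2 <= sqnorm (f x) by rewrite sqrrN.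
have b4 x : (- complex.Im (f x)) ^+ 2 <= sqnorm (f x) by rewrite sqrrN.
have a1 := real_part _ mRe b1; have a2 := real_part _ (mN _ mRe) b3.
have a3 := real_part _ mIm b2; have a4 := real_part _ (mN _ mIm) b4.
have := approxD mF (approxD mF a1 (approxZ mF (-1) a2))
  (approxZ mF 'i (approxD mF a3 (approxZ mF (-1) a4))).
congr (approx F L _); apply/funext => x.
have pE (p : R) : Num.max p 0 - Num.max (- p) 0 = p.
  by rewrite /Num.max oppr_lt0; case: ltgtP => h; lra.
rewrite /po; case: (f x) => p q /=; rewrite -{3}(pE p) -{3}(pE q).
by apply/eqP; rewrite eq_complex /=; apply/andP; split; apply/eqP; ring.
Qed.

Lemma spectrum_real_spectral : real_spectral F.
Proof.
exists L; split; first exact: (spectrum_orthogonal mF mA AF FA FD u0 Q0 fibers).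
move=> f /approx_L2[_ af] e e0; have [t tL ft] := af e e0.
exists (undup [seq p.1 | p <- t]), (fun l => \sum_(p <- t | p.1 == l) p.2); split.
  by move=> l; rewrite mem_undup => /mapP[p /tL Lp ->].
apply: le_lt_trans ft; rewrite le_eqVlt; apply/orP; left; apply/eqP.
by congr (L2norm_sq F _); apply/funext => x; rewrite trigE.
Qed.

End Completeness.

Lemma real_tile_spectral (R : realType) (F : set R) :
  bounded_set F -> lebesgue_measurable F ->
  (0 < completed_lebesgue_measure F < +oo)%E -> real_tile F -> real_spectral F.
Proof.
move=> [M [_ HM]] mF /andP[F0 F_fin] [T [T_disj T_cover]].
(* [bounded_set] gives bounds only by numbers larger than [M], and the bound by [D] is to be
   strict. *)
pose D := M + 2.
have FD x : F x -> `|x| < D.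
  move=> Fx; have M1 : M < M + 1 by rewrite ltrDl.
  by apply: le_lt_trans (HM _ M1 x Fx) _; rewrite /D ltrD2l ltr1n.
have [A [mA AF nA]] := lebesgue_measurable_borel mF.
have FA : {ae @lebesgue_measure R, forall x, F x -> A x}.
  by apply: negligibleS nA => x /= /not_implyP.
have AD x : A x -> `|x| < D by move=> /AF/FD.
have A0 : cum A (- D) < cum A D.
  rewrite (cum_low AD) // (cum_high AD) // fine_gt0 //; apply/andP; split.
    rewrite lt0e measure_ge0 andbT; apply/eqP => A0.
    have nA' : (@lebesgue_measure R).-negligible A by exists A; split.
    have [N [mN N0 FN]] := negligibleU nA' nA.
    move: F0; rewrite ltNge => /negP; apply; rewrite -N0.
    apply: le_outer_measure => x Fx; apply: FN.
    by have [|] := pselect (A x); [left|right].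
  by have := cum_set_lty mA AD (@measurableT _ (measurableTypeR R)); rewrite setIT.
have Td t v : T t -> T v -> t != v ->
    {ae @lebesgue_measure R, forall x, ~ (A (x - t) /\ A (x - v))}.
  move=> Tt Tv tv; apply: negligibleS (negligible_borel (T_disj t v Tt Tv tv)) => x /=.
  move=> /contrapT[/AF Ft /AF Fv].
  by split; [exists (x - t)|exists (x - v)]; rewrite ?subrK.
have Tc : {ae @lebesgue_measure R, forall x, exists t, T t /\ F (x - t)}.
  apply: negligibleS (negligible_borel T_cover) => x /= nx [t Tt [y Fy yx]].
  by apply: nx; exists t; split => //; rewrite -yx addrK.
have [p [z [Q [u [Q0 u0 tl]]]]] := real_tiling_rational mA AD A0 FD FA Td Tc.
have [Lam _ HL] := @fiber_spectrum R 'I_p z Q (fold_bound D u) Q0.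
have fib : {ae @lebesgue_measure R, forall x, 0 <= x < u ->
    (0 < size Lam)%N /\ fiber_orthogonal A u Q (fold_bound D u) Lam x}.
  apply: ae_mono tl => x hx xu.
  have [||Lam0 [orth dual]] := HL (fun i : int => A (x + i%:~R * u)).
  - by move=> i; exact: (fold_index AF FD u0 xu).
  - exact: hx.
  by split.
(* A single good fiber shows that [Lam] is nonempty. *)
have [x /andP[x0 xu] /(_ _)[|Lam0 _]] := ae_exists u0 fib; first by rewrite (ltW x0).
apply: (spectrum_real_spectral mF F_fin mA AF FA FD u0 Q0 Lam0).
by apply: ae_mono fib => y hy /hy[].
Qed.

Theorem corollary1p2 (R : realType) :
  ((forall (m : nat) (A : {fset 'I_m.+1}), group_tile A -> group_spectral R A) /\
   (forall A : {fset int}, group_tile A -> group_spectral R A)) /\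
  (forall F : set R,
     bounded_set F ->
     lebesgue_measurable F ->
     (0 < completed_lebesgue_measure F < +oo)%E ->
     real_tile F ->
     real_spectral F).
Proof.
split; first by split=> [m|] A; [exact: cyclic_tile_spectral|exact: int_tile_spectral].
by move=> F; exact: real_tile_spectral.
Qed.
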